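(* There exists $\epsilon_0>0$ such that the following holds for every constant $0<\epsilon<\epsilon_0$. Let $d=d(n)$ satisfy $d=o(n)$, $d\ge 3$, and let $p=\frac{1+\epsilon}{d}$. Assume $\frac{2}{\ln(n/d)}<\alpha<\epsilon^4$, and let $G=(V,E)$ be an $(n,d,\lambda)$-graph with $\lambda/d\le \alpha^{2/\alpha}$. Then there exists a constant $\beta=\beta(\epsilon)>0$ such that with probability at least $1-\left(\frac{n}{d}\right)^{-\beta\ln\ln(n/d)}$, $G[V_p]$ has a unique giant connected component, and all but at most $\frac{15\alpha n}{d}$ of the vertices of $V_p$ belong either to connected components of $G[V_p]$ that are trees on at most $\frac{1}{\alpha}$ vertices, or to this unique giant component.
   Context: An $(n,d,\lambda)$-graph is a $d$-regular graph on $n$ vertices whose adjacency eigenvalues $d=\lambda_1\ge\lambda_2\ge\dots\ge\lambda_n$ satisfy $\lambda=\max(|\lambda_2|,|\lambda_n|)$. $V_p$ is the random subset of $V$ obtained by including each vertex independently with probability $p$, and $G[V_p]$ is the induced subgraph. The giant component refers to the largest connected component of $G[V_p]$ (of size about $xn/d$, where $x\in(0,1)$ solves $x=(1+\epsilon)(1-e^{-x})$); all other components are of size $O(\alpha n/d)$. The parameter $\alpha$ may depend on $n$. *)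

(* Defs.v *)
From mathcomp Require Export all_boot all_order all_algebra.
From mathcomp Require Export all_classical all_reals all_analysis.
Export Order.TTheory GRing.Theory Num.Theory.
Export numFieldNormedType.Exports.

Set Implicit Arguments.
Unset Strict Implicit.
Unset Printing Implicit Defensive.

Local Open Scope ring_scope.

Section Graphs.
Variables (T : finType) (e : rel T).

Definition simple_graph : Prop := symmetric e /\ irreflexive e.

Definition regular (d : nat) : Prop := forall v, #|[set u | e v u]| = d.

Definition induced (S : {set T}) : rel T :=
  [rel u v | [&& u \in S, v \in S & e u v]].

Definition component (S : {set T}) (v : T) : {set T} :=
  [set u in S | connect (induced S) v u].

Definition components (S : {set T}) : {set {set T}} :=
  [set component S v | v in S].

Definition connected_in (C : {set T}) : Prop :=
  C != finset.set0 /\ {in C &, forall u v, connect (induced C) u v}.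

(* A cycle is a closed walk on at least 3 pairwise distinct vertices. *)
Definition acyclic_in (C : {set T}) : Prop :=
  forall c : seq T, (3 <= size c)%N -> ~ ucycle (induced C) c.

Definition tree_in (C : {set T}) : Prop := connected_in C /\ acyclic_in C.

End Graphs.

Section Spectrum.
Variable R : realType.

Definition adjacency (T : finType) (e : rel T) : 'M[R]_#|T| :=
  \matrix_(i, j) (e (enum_val i) (enum_val j))%:R.

(* The eigenvalues, with multiplicity, in nonincreasing order. *)
Definition spectrum (m : nat) (A : 'M[R]_m) (s : seq R) : Prop :=
  sorted (fun a b : R => b <= a) s /\
  char_poly A = \prod_(z <- s) ('X - z%:P).

(* Indices are shifted: lambda_i is nth 0 s (i - 1). *)
Definition ndl_graph (n d : nat) (lambda : R) (T : finType) (e : rel T) : Prop :=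
  [/\ #|T| = n, simple_graph e, regular e d &
      exists s : seq R,
        [/\ spectrum (adjacency e) s, nth 0 s 0 = d%:R &
            lambda = Num.max `|nth 0 s 1| `|nth 0 s n.-1| ]].

End Spectrum.

Section Percolation.
Variable R : realType.

(* Probability that V_p satisfies E, each vertex being kept independently
   with probability p. *)
Definition site_prob (T : finType) (p : R) (E : {set T} -> Prop) : R :=
  \sum_(S : {set T} | `[< E S >]) \prod_(v : T) (if v \in S then p else 1 - p).

Definition giant_density (eps x : R) : Prop :=
  0 < x < 1 /\ x = (1 + eps) * (1 - expR (- x)).

(* L is the unique giant component of G[S], N standing for n/d: its size is
   x N up to an error K alpha N, and every other component is strictly
   smaller than L and has at most K alpha N vertices. *)
Definition unique_giant (K x alpha N : R) (T : finType) (e : rel T)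
    (S L : {set T}) : Prop :=
  [/\ L \in components e S,
      `| #|L|%:R - x * N | <= K * alpha * N &
      forall C, C \in components e S -> C != L ->
        (#|C| < #|L|)%N /\ #|C|%:R <= K * alpha * N].

Definition small_tree (alpha : R) (T : finType) (e : rel T) (C : {set T}) : Prop :=
  tree_in e C /\ #|C|%:R <= alpha^-1.

(* Vertices of S outside L whose component in G[S] is not a tree on at most
   1/alpha vertices. *)
Definition exceptional (alpha : R) (T : finType) (e : rel T)
    (S L : {set T}) : {set T} :=
  [set v in S | (v \notin L) && ~~ `[< small_tree alpha e (component e S v) >] ].

End Percolation.

(* Main.v *)
(* Write N = n/d. The set V_p is exposed as S1 u S3 u S4, where S3 and S4 have density
   alpha/(10d) and S1 takes almost all of p.

   Exploring a component from a vertex is compared with a branching process with Bin(d, p)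
   offspring. It is dominated by it, and by expander mixing few pairs of vertices have many
   common neighbours, so it also dominates a slightly thinner one up to alpha^-16 vertices.
   As short cycles are rare, about (1 + eps - x) N vertices lie in trees on at most 1/alpha
   vertices, and about x N vertices of S1 lie in components on at least alpha^-16 vertices.
   These counts concentrate, because on the event that G[V_p] has maximum degree at most
   (ln N)^2 they change little when a vertex is added.

   If the large components of S1 did not nearly all merge in V_p, they would split into two
   families with linear-size neighbourhoods X and Y such that no edge joins S3 in X to S4 in
   Y. Expander mixing makes this so unlikely that a union bound over the 2^(2 alpha^16 N)
   splittings succeeds. Counting vertices then leaves O(alpha N) of them outside the small
   trees and the merged component. *)

Require Import Defs.
From mathcomp Require Import all_boot all_order all_algebra.
From mathcomp Require Import all_classical all_reals all_analysis.
From mathcomp Require spectral complex.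
(* Imported again since MathComp-Analysis has a (deprecated) notation [induced]. *)
Require Import Defs.
From mathcomp Require Import fintype finset.
From mathcomp Require Import ring lra zify.
Import Order.TTheory GRing.Theory Num.Theory.
Import numFieldNormedType.Exports.

Set Implicit Arguments.
Unset Strict Implicit.
Unset Printing Implicit Defensive.

Local Open Scope ring_scope.

(** * The spectral gap as a bound on bilinear forms *)

(** The spectral hypothesis is used in two strengths. Already lambda/d <= alpha^30 forces d >=
    alpha^-59 and keeps common neighbourhoods small. The exponent 2/alpha is spent on short cycles:
    their expected number grows like (1 + eps)^(1/alpha) (1 + N lambda/d). Since alpha > 2/ln N,
    that growth factor is at most sqrt N, and N absorbs the powers of ln N and 1/alpha that occur.

    Two sprinkled sets are used because vertices are percolated. The neighbourhoods X and Y of the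
    two families may be disjoint, so that no single new vertex joins them. A path through two new
    vertices can be found, and independence allows S3 to be revealed before S4.

    The threshold alpha^-16 comes from comparing exponents: one splitting survives the sprinkling
    with probability at most about exp(-c alpha^13 N), so the number of large components has to be
    well below alpha^13 N.

    The counts of vertices in small components are Lipschitz with a useful constant only where the
    maximum degree is bounded. They are therefore replaced by functions that are Lipschitz
    everywhere and agree with them there. *)

Section SpectralMixing.
Import spectral complex.

Lemma char_poly_conj (F : comUnitRingType) m (P D : 'M[F]_m) :
  P \in unitmx -> char_poly (invmx P *m D *m P) = char_poly D.
Proof.
move=> uP; rewrite /char_poly /char_poly_mx.
have -> : 'X%:M - map_mx polyC (invmx P *m D *m P) =
   map_mx polyC (invmx P) *m ('X%:M - map_mx polyC D) *m map_mx polyC P.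
  rewrite mulmxBr mulmxBl !map_mxM; congr (_ - _).
  by rewrite -mulmxA -scalar_mxC mulmxA -map_mxM mulVmx // map_mx1 mul1mx.
by rewrite !det_mulmx mulrAC -det_mulmx -map_mxM mulVmx // map_mx1 det1 mul1r.
Qed.

Lemma sum_Cauchy_Schwarz (F : rcfType) (I : finType) (a b : I -> F) :
  (\sum_i a i * b i) ^+ 2 <= (\sum_i a i ^+ 2) * (\sum_i b i ^+ 2).
Proof.
set A := \sum_i a i ^+ 2; set B := \sum_i b i ^+ 2; set S := \sum_i _.
have A0 : 0 <= A by apply: sumr_ge0 => i _; exact: sqr_ge0.
have B0 : 0 <= B by apply: sumr_ge0 => i _; exact: sqr_ge0.
have key t u : 0 <= t ^+ 2 * A - 2 * t * u * S + u ^+ 2 * B.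
  rewrite /A /S /B !mulr_sumr -sumrB -big_split /=.
  apply: sumr_ge0 => i _.
  have -> : t ^+ 2 * a i ^+ 2 - 2 * t * u * (a i * b i) + u ^+ 2 * b i ^+ 2 =
    (t * a i - u * b i) ^+ 2 by ring.
  exact: sqr_ge0.
have [B00|Bn0] := eqVneq B 0.
  have bi0 i : b i = 0.
    apply/eqP; rewrite -sqrf_eq0; apply/eqP.
    by move/psumr_eq0P: B00; apply => // j _; exact: sqr_ge0.
  by rewrite /S big1 ?expr0n ?mulr_ge0 // => i _; rewrite bi0 mulr0.
have Bp : 0 < B by rewrite lt_def Bn0.
have := key B S.
have -> : B ^+ 2 * A - 2 * B * S * S + S ^+ 2 * B = B * (A * B - S ^+ 2) by ring.
by rewrite pmulr_rge0 // subr_ge0.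
Qed.

Section SymmetricSpectrum.
Variables (F : rcfType) (m : nat) (A : 'M[F]_m) (s : seq F).
Hypotheses (symA : A^T = A) (chA : char_poly A = \prod_(z <- s) ('X - z%:P)).

Local Notation C := (complex F).
Local Notation rc := (real_complex F).
Local Notation Ac := (map_mx rc A).
Local Open Scope sesquilinear_scope.

Lemma complexified_hermitian : Ac \is hermsymmx.
Proof.
apply: realsym_hermsym.
  apply/is_hermitianmxP; rewrite expr0 scale1r map_mx_id //.
  by rewrite map_trmx symA.
by apply/mxOverP => i j; rewrite mxE complex_real.
Qed.

(** Spectral theorem for the complexified matrix. Comparing root multiplicities of the
    characteristic polynomial identifies the diagonal with [s] as a multiset; the multiplicities are
    what later shows that the eigenvalue d occurs only once. *)
Lemma complexified_diagonalization :
  exists (P : 'M[C]_m) (D : 'rV[C]_m),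
    [/\ P *m P^t* = 1%:M, Ac = P^t* *m diag_mx D *m P &
    forall x : C, #|[pred i | D 0 i == x]| = count_mem x [seq rc z | z <- s]].
Proof.
have uP := spectral_unitarymx Ac; have uP' := spectral_unit Ac.
have /hermitian_normalmx/orthomx_spectralP := complexified_hermitian.
move: (spectralmx Ac) (spectral_diag Ac) uP uP' => P D uP uP' eA.
exists P, D; split; [exact/unitarymxP|by rewrite -invmx_unitary|move=> x].
have chD : char_poly Ac = \prod_(i < m) ('X - (D 0 i)%:P).
  rewrite eA char_poly_conj // char_poly_trig; last first.
    by apply/is_trig_mxP => i j ij; rewrite mxE -val_eqE ltn_eqF.
  by apply: eq_bigr => i _; rewrite mxE eqxx mulr1n.
have : char_poly Ac = \prod_(z <- [seq rc z | z <- s]) ('X - z%:P).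
  by rewrite -map_char_poly chA big_map map_prod_XsubC.
rewrite chD -(big_map (fun i => D 0 i) predT (fun z => 'X - z%:P)).
move/(congr1 (mup x)); rewrite !mu_prod_XsubC => <-.
by rewrite count_map cardE /enum_mem size_filter.
Qed.

(** In an orthonormal eigenbasis the form is a weighted sum of products of coordinates. A weight
    exceeding [lambda] can only be the simple eigenvalue [d], whose eigenline is spanned by [u], and
    [f] has no coordinate there. Cauchy-Schwarz bounds the rest. *)
Lemma symmetric_form_bound (u : 'rV[F]_m) (d lambda : F) :
  u != 0 -> u *m A = d *: u -> 0 <= lambda ->
  (forall z, z \in s -> `|z| <= lambda \/ z = d /\ (count_mem d s <= 1)%N) ->
  forall f g : 'rV[F]_m, f *m u^T = 0 ->
    (f *m A *m g^T) 0 0 ^+ 2 <=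
      lambda ^+ 2 * ((f *m f^T) 0 0 * (g *m g^T) 0 0).
Proof.
move=> un0 uA l0 hs f g fu.
have [P [D [PP eA cD]]] := complexified_diagonalization.
have PP' : P^t* *m P = 1%:M by apply: mulmx1C.
pose cf (X : 'rV[F]_m) := map_mx rc X *m P^t*.
have conjrc (k : 'rV[F]_m) : (map_mx rc k)^t* = map_mx rc k^T.
  by apply/matrixP => i j; rewrite !mxE conj_Creal ?complex_real.
have cfE X : (cf X)^t* = P *m map_mx rc X^T.
  by rewrite trmx_mul map_mxM conjrc trmxCK.
have orth (X Y : 'rV[F]_m) : \sum_i cf X 0 i * (cf Y 0 i)^*%R = rc ((X *m Y^T) 0 0).
  have : cf X *m (cf Y)^t* = map_mx rc (X *m Y^T).
    by rewrite cfE /cf !mulmxA -[_ *m P^t* *m P]mulmxA PP' mulmx1 map_mxM.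
  move/matrixP/(_ 0 0); rewrite mxE [RHS]mxE => <-.
  by apply: eq_bigr => i _; rewrite !mxE.
have form : rc ((f *m A *m g^T) 0 0) = \sum_i cf f 0 i * D 0 i * (cf g 0 i)^*%R.
  have : map_mx rc (f *m A *m g^T) = cf f *m diag_mx D *m (cf g)^t*.
    by rewrite cfE /cf !map_mxM eA !mulmxA.
  move/matrixP/(_ 0 0); rewrite mxE [RHS]mxE => ->.
  by apply: eq_bigr => i _; rewrite mul_mx_diag !mxE.
have wD i : cf u 0 i * D 0 i = rc d * cf u 0 i.
  have : map_mx rc u *m Ac = rc d *: map_mx rc u by rewrite -map_mxM uA map_mxZ.
  rewrite eA => /(congr1 (fun X => X *m P^t*)) /=.
  rewrite !mulmxA -[_ *m P *m _]mulmxA PP mulmx1 -scalemxAl.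
  by move/matrixP/(_ 0 i); rewrite mul_mx_diag !mxE.
have Dbnd i : `|cf f 0 i * D 0 i| <= rc lambda * `|cf f 0 i|.
  have : D 0 i \in [seq rc z | z <- s].
    rewrite -has_pred1 has_count -cD; apply/card_gt0P; exists i.
    by rewrite inE /= eqxx.
  case/mapP => z zs Dz; have [zl|[zd c1]] := hs z zs.
    rewrite normrM mulrC ler_wpM2r ?normr_ge0 // Dz.
    by rewrite normc_def /= expr0n addr0 sqrtr_sqr lecR.
  (* The coordinates of [u] vanish away from the eigenvalue [d], and [d] sits at the single index
     [i]; hence [u] is concentrated on [i], and orthogonality to [u] kills the coordinate of [f]
     there. *)
  suff -> : cf f 0 i = 0 by rewrite mul0r !normr0 mulr0.
  have wj j : j != i -> cf u 0 j = 0.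
    move=> ji; apply/eqP; apply: contraT => wj0.
    have Dj : D 0 j = rc d.
      by apply: (mulfI wj0); rewrite wD mulrC.
    have : (1 < #|[pred k | (D 0 k == rc d)%R]|)%N.
      by apply/card_gt1P; exists j, i; rewrite !inE /= Dj Dz zd !eqxx.
    rewrite cD count_map => /leq_trans /(_ _)/negP.
    rewrite (@eq_count _ _ (pred1 d)) => [|y]; last first.
      by rewrite /= (inj_eq (@complexI _)).
    by move=> /(_ 1%N c1).
  have := orth f u; rewrite fu [X in rc X]mxE rmorph0 (bigD1 i) //= big1 => [|j ji].
    rewrite addr0 => /eqP; rewrite mulf_eq0 conjC_eq0 => /orP[/eqP//|wi].
    case/eqP: un0; have cu0 : cf u = 0.
      apply/matrixP => k j; rewrite ord1 [RHS]mxE.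
      by have [->|/wj//] := eqVneq j i; apply/eqP.
    have : map_mx rc u = 0 by rewrite -[LHS]mulmx1 -PP' mulmxA -/(cf u) cu0 mul0mx.
    move=> /matrixP ru; apply/matrixP => k j; apply: (@complexI F).
    by have := ru k j; rewrite !mxE rmorph0.
  by rewrite wj // conjC0 mulr0.
pose r X i := complex.Re `|cf X 0 i|.
have rE X i : `|cf X 0 i| = rc (r X i) by rewrite /r normc_def.
have rsum X : \sum_i r X i ^+ 2 = (X *m X^T) 0 0.
  apply: (@complexI F); rewrite rmorph_sum -orth; apply: eq_bigr => i _.
  by rewrite rmorphXn /= -rE normCK.
have : `|rc ((f *m A *m g^T) 0 0)| <= rc (lambda * \sum_i r f i * r g i).
  rewrite form mulr_sumr rmorph_sum; apply: le_trans (ler_norm_sum _ _ _) _.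
  apply: ler_sum => i _; rewrite normrM norm_conjC !rmorphM /= mulrA -!rE.
  by rewrite ler_wpM2r.
rewrite normc_def /= expr0n addr0 sqrtr_sqr lecR => h.
rewrite -real_normK ?num_real // -!rsum.
apply: le_trans (_ : (lambda * \sum_i r f i * r g i) ^+ 2 <= _).
  by rewrite lerXn2r // nnegrE ?normr_ge0 //; exact: le_trans h.
rewrite exprMn; apply: ler_wpM2l; first exact: sqr_ge0.
exact: sum_Cauchy_Schwarz.
Qed.

End SymmetricSpectrum.

(** All row sums equal d, so replacing [f] by its mean-free part [f'] removes exactly the term d/n
    times the two sums. Now [f'] is orthogonal to the constant eigenvector, and centring does not
    increase the norm. *)
Lemma ndl_form_bound (R : realType) n d (lambda : R) (T : finType) (e : rel T) :
  ndl_graph n d lambda e -> (1 < n)%N -> forall f g : T -> R,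
  `| \sum_u \sum_v (e u v)%:R * f u * g v
     - d%:R / n%:R * (\sum_u f u) * (\sum_v g v) | <=
  lambda * (Num.sqrt (\sum_u f u ^+ 2) * Num.sqrt (\sum_v g v ^+ 2)).
Proof.
case=> cT [symE irrE] reg [s [[sorts chs] s0 lE]] n1 f g.
have l0 : 0 <= lambda by rewrite lE le_max normr_ge0.
have szs : size s = n.
  have := size_char_poly (adjacency R e).
  by rewrite chs size_prod_XsubC cT => -[].
have nn0 : n%:R != 0 :> R by rewrite pnatr_eq0 -lt0n; apply: leq_trans n1.
pose mf := (\sum_u f u) / n%:R; pose f' u := f u - mf.
have sum_f' : \sum_u f' u = 0.
  by rewrite sumrB sumr_const cT -mulr_natr /mf divfK // subrr.
have degE v : \sum_u (e u v)%:R = d%:R :> R.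
  rewrite -(reg v) -sum1_card natr_sum [RHS]big_mkcond /=.
  by apply: eq_bigr => u _; rewrite inE symE; case: (e v u).
have -> : \sum_u \sum_v (e u v)%:R * f u * g v
     - d%:R / n%:R * (\sum_u f u) * (\sum_v g v) =
     \sum_u \sum_v (e u v)%:R * f' u * g v.
  have -> : d%:R / n%:R * (\sum_u f u) * (\sum_v g v) =
     \sum_u \sum_v (e u v)%:R * mf * g v.
    rewrite exchange_big mulr_sumr /=; apply: eq_bigr => v _.
    by rewrite -mulr_suml -mulr_suml degE /mf; ring.
  rewrite -sumrB; apply: eq_bigr => u _; rewrite -sumrB; apply: eq_bigr => v _.
  by rewrite /f'; ring.
pose rv (h : T -> R) := \row_(i < #|T|) h (enum_val i).
have rvE (h k : T -> R) : (rv h *m (rv k)^T) 0 0 = \sum_u h u * k u.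
  rewrite mxE (reindex (@enum_val T predT)) /=; last first.
    exact/onW_bij/enum_val_bij.
  by apply: eq_bigr => i _; rewrite !mxE.
have Asym : (adjacency R e)^T = adjacency R e.
  by apply/matrixP => i j; rewrite !mxE symE.
have uA : rv (fun=> 1) *m adjacency R e = d%:R *: rv (fun=> 1).
  apply/matrixP => k j; rewrite mxE [RHS]mxE !mxE mulr1 -(degE (enum_val j)).
  rewrite [RHS](reindex (@enum_val T predT)) /=; last exact/onW_bij/enum_val_bij.
  by apply: eq_bigr => i _; rewrite !mxE mul1r.
have u0 : rv (fun=> 1) != 0.
  apply/eqP => /matrixP.
  have i0 : 'I_#|T| by rewrite cT; exists 0%N; apply: leq_trans n1.
  by move=> /(_ 0 i0); rewrite !mxE => /eqP; rewrite oner_eq0.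
(* The list is sorted, so every entry after the head lies between the second and the last one and is
   bounded by [lambda]. If d recurs in the tail it is itself bounded by [lambda]; otherwise it is
   simple. *)
have hs z : z \in s -> `|z| <= lambda \/ z = d%:R /\ (count_mem (d%:R) s <= 1)%N.
  move: sorts s0 lE szs; case: s {chs} => [|s0 s] //= sorts -> lE szs.
  have sl y : y \in s -> `|y| <= lambda.
    move=> ys.
    case: s sorts lE szs ys => [|s1 s] //= /andP[s10 sorts] lE szs ys.
    have y1 : y <= s1.
      have /(order_path_min (@ge_trans _ _)) /allP sa := sorts.
      by move: ys; rewrite inE => /predU1P[->//|/sa].
    have yl : last s1 s <= y.
      move: ys sorts {lE szs y1 s10}; elim: s s1 y => [|s2 s IH] s1 y /=.
        by rewrite inE => /eqP ->.
      rewrite inE => /predU1P[->|ys] /andP[s21 st]; last exact: IH.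
      by apply: le_trans s21; apply: IH => //; rewrite mem_head.
    have -> : lambda = Num.max `|s1| `|last s1 s|.
      by rewrite lE -szs /= (last_nth 0).
    rewrite le_max; case: (lerP 0 y) => y0.
      by rewrite (ger0_norm y0) (le_trans y1 (ler_norm _)).
    rewrite (ltr0_norm y0); apply/orP; right.
    by rewrite -normrN (le_trans _ (ler_norm _)) // lerN2.
  rewrite inE => /predU1P[->|/sl]; last by left.
  have [ds|dns] := boolP (d%:R \in s); first by left; exact: sl.
  by right; rewrite eqxx (count_memPn dns).
have key fu := @symmetric_form_bound _ _ _ _ Asym chs _ _ _ u0 uA l0 hs (rv f') (rv g) fu.
have fu : rv f' *m (rv (fun=> 1))^T = 0.
  apply/matrixP => i j; rewrite !ord1 rvE [RHS]mxE -[RHS]sum_f'.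
  by apply: eq_bigr => v _; rewrite mulr1.
have {key}:= key fu; rewrite !rvE.
have -> : (rv f' *m adjacency R e *m (rv g)^T) 0 0 =
  \sum_u \sum_v (e u v)%:R * f' u * g v.
  rewrite exchange_big mxE [RHS](reindex (@enum_val T predT)) /=; last first.
    exact/onW_bij/enum_val_bij.
  apply: eq_bigr => j _; rewrite !mxE mulr_suml.
  rewrite [RHS](reindex (@enum_val T predT)) /=; last exact/onW_bij/enum_val_bij.
  by apply: eq_bigr => i _; rewrite !mxE; ring.
set X := \sum_u \sum_v _ => key.
have f'f : \sum_u f' u * f' u <= \sum_u f u ^+ 2.
  have -> : \sum_u f' u * f' u = \sum_u f u ^+ 2 - mf ^+ 2 * n%:R.
    have -> : \sum_u f' u * f' u = \sum_u (f u ^+ 2 - 2 * mf * f' u - mf ^+ 2).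
      by apply: eq_bigr => u _; rewrite /f'; ring.
    rewrite sumrB sumrB -mulr_sumr sum_f' sumr_const cT -mulr_natr; ring.
  by rewrite lerBlDr lerDl mulr_ge0 ?sqr_ge0.
have g0 : 0 <= \sum_u g u ^+ 2 by apply: sumr_ge0 => u _; exact: sqr_ge0.
have f0 : 0 <= \sum_u f u ^+ 2 by apply: sumr_ge0 => u _; exact: sqr_ge0.
have XE : `|X| = Num.sqrt (X ^+ 2) by rewrite sqrtr_sqr.
have -> : lambda = Num.sqrt (lambda ^+ 2) by rewrite sqrtr_sqr ger0_norm.
rewrite XE -sqrtrM // -sqrtrM ?sqr_ge0 //; apply: ler_wsqrtr.
apply: le_trans key _; apply: ler_wpM2l; first exact: sqr_ge0.
rewrite [\sum_u g u * g u](eq_bigr (fun u => g u ^+ 2)) //.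
exact: ler_wpM2r.
Qed.

End SpectralMixing.

(** * Random vertex subsets and concentration *)

Section ProductMeasure.
Variables (R : realType) (T : finType).
Implicit Types (p : R) (F : {set T} -> R) (S : {set T}).

Definition weight p S : R := \prod_(v : T) (if v \in S then p else 1 - p).
Definition Ex p F : R := \sum_(S : {set T}) weight p S * F S.
Definition Pr p (E : pred {set T}) : R := Ex p (fun S => (E S)%:R).

Lemma site_probE p (E : {set T} -> Prop) :
  site_prob p E = Pr p (fun S => `[< E S >]).
Proof.
rewrite /site_prob big_mkcond; apply: eq_bigr => S _ /=.
by case: asboolP; rewrite ?mulr1 ?mulr0.
Qed.

Lemma Ex_prod p (a b : T -> R) :
  Ex p (fun S => \prod_v (if v \in S then a v else b v)) =
  \prod_v (p * a v + (1 - p) * b v).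
Proof.
rewrite bigA_distr; apply: eq_bigr => S _; rewrite -big_split /=.
by apply: eq_bigr => v _; case: ifP.
Qed.

Lemma weight_ge0 p S : 0 <= p <= 1 -> 0 <= weight p S.
Proof.
move=> /andP[p0 p1]; apply: prodr_ge0 => v _.
by case: ifP => // _; rewrite subr_ge0.
Qed.

Lemma Ex_le p F1 F2 : 0 <= p <= 1 -> (forall S, F1 S <= F2 S) ->
  Ex p F1 <= Ex p F2.
Proof. by move=> p01 h; apply: ler_sum => S _; rewrite ler_wpM2l ?weight_ge0. Qed.

Lemma eq_Ex p F1 F2 : F1 =1 F2 -> Ex p F1 = Ex p F2.
Proof. by move=> h; apply: eq_bigr => S _; rewrite h. Qed.

Lemma ExD p F1 F2 : Ex p (fun S => F1 S + F2 S) = Ex p F1 + Ex p F2.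
Proof. by rewrite -big_split; apply: eq_bigr => S _; rewrite mulrDr. Qed.

Lemma ExZ p a F : Ex p (fun S => a * F S) = a * Ex p F.
Proof. by rewrite mulr_sumr; apply: eq_bigr => S _; rewrite mulrCA. Qed.

Lemma ExN p F : Ex p (fun S => - F S) = - Ex p F.
Proof. by rewrite -sumrN; apply: eq_bigr => S _; rewrite mulrN. Qed.

Lemma ExB p F1 F2 : Ex p (fun S => F1 S - F2 S) = Ex p F1 - Ex p F2.
Proof. by rewrite ExD ExN. Qed.

Lemma Ex_sum p (I : Type) (r : seq I) (P : pred I) (F : I -> {set T} -> R) :
  Ex p (fun S => \sum_(i <- r | P i) F i S) = \sum_(i <- r | P i) Ex p (F i).
Proof. by rewrite exchange_big; apply: eq_bigr => S _; rewrite mulr_sumr. Qed.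

Lemma Ex_cst p a : Ex p (fun=> a) = a.
Proof.
have -> : Ex p (fun=> a) = a * Ex p (fun=> 1).
  by rewrite -ExZ; apply: eq_Ex => S; rewrite mulr1.
have -> : Ex p (fun=> 1) = Ex p (fun S => \prod_v (if v \in S then 1 else 1)).
  by apply: eq_Ex => S; rewrite big1 // => v _; case: ifP.
by rewrite Ex_prod big1 ?mulr1 // => v _; ring.
Qed.

Lemma Ex_ge0 p F : 0 <= p <= 1 -> (forall S, 0 <= F S) -> 0 <= Ex p F.
Proof. by move=> p01 h; rewrite -(Ex_cst p 0); apply: Ex_le. Qed.

Lemma Ex_le_cst p F a : 0 <= p <= 1 -> (forall S, F S <= a) -> Ex p F <= a.
Proof. by move=> p01 h; rewrite -(Ex_cst p a); apply: Ex_le. Qed.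

Lemma Pr_le p (E1 E2 : pred {set T}) : 0 <= p <= 1 ->
  (forall S, E1 S -> E2 S) -> Pr p E1 <= Pr p E2.
Proof.
by move=> p01 h; apply: Ex_le => // S; move: (h S); case: (E1 S) => [->|_].
Qed.

Lemma Pr_ge0 p E : 0 <= p <= 1 -> 0 <= Pr p E.
Proof. by move=> p01; apply: Ex_ge0. Qed.

Lemma Pr_le1 p E : 0 <= p <= 1 -> Pr p E <= 1.
Proof. by move=> p01; apply: Ex_le_cst => // S; case: (E S). Qed.

Lemma PrU p (E1 E2 : pred {set T}) : 0 <= p <= 1 ->
  Pr p (fun S => E1 S || E2 S) <= Pr p E1 + Pr p E2.
Proof.
move=> p01; rewrite -ExD; apply: Ex_le => // S.
by case: (E1 S); case: (E2 S); rewrite ?addr0 ?add0r // lerDl.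
Qed.

Lemma PrC p E : Pr p (fun S => ~~ E S) = 1 - Pr p E.
Proof.
rewrite -[X in X - _](Ex_cst p 1) -ExB; apply: eq_Ex => S.
by case: (E S); rewrite ?subrr ?subr0.
Qed.

Lemma Ex_eq_indicators p F :
  Ex p F = \sum_X F X * Ex p (fun S => (S == X)%:R).
Proof.
under eq_bigr do rewrite -ExZ; rewrite -Ex_sum; apply: eq_Ex => S.
rewrite (bigD1 S) //= eqxx mulr1 big1 ?addr0 // => X /negPf XS.
by rewrite eq_sym XS mulr0.
Qed.

Lemma set_eq_prod (X Y : {set T}) :
  (X == Y)%:R = \prod_v ((v \in X) == (v \in Y))%:R :> R.
Proof.
have [->|XY] := eqVneq X Y; first by rewrite big1 // => v _; rewrite eqxx.
case: (boolP [exists v, (v \in X) != (v \in Y)]) => [/existsP[v hv]|].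
  by rewrite (bigD1 v) //= (negPf hv) mul0r.
rewrite negb_exists => /forallP h; case/eqP: XY; apply/setP => v.
by have := h v; rewrite negbK => /eqP.
Qed.

(* The combined set is a fresh random set as soon as each vertex is kept with
   probability p: this covers both sprinkling and resampling. *)
Lemma Ex_combine p1 p2 p (h : T -> bool -> bool -> bool) F :
  (forall v, p1 * (p2 * (h v true true)%:R + (1 - p2) * (h v true false)%:R)
    + (1 - p1) * (p2 * (h v false true)%:R + (1 - p2) * (h v false false)%:R)
    = p) ->
  Ex p1 (fun S1 => Ex p2 (fun S2 => F [set v | h v (v \in S1) (v \in S2)])) =
  Ex p F.
Proof.
move=> hp; pose G (S1 S2 : {set T}) := [set v | h v (v \in S1) (v \in S2)].
transitivity (\sum_X F X * Ex p1 (fun S1 => Ex p2 (fun S2 => (G S1 S2 == X)%:R))).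
  under [RHS]eq_bigr do rewrite -ExZ; rewrite -Ex_sum; apply: eq_Ex => S1.
  under [RHS]eq_bigr do rewrite -ExZ; rewrite -Ex_sum; apply: eq_Ex => S2.
  rewrite (bigD1 (G S1 S2)) //= eqxx mulr1 big1 ?addr0 // => X /negPf XS.
  by rewrite eq_sym XS mulr0.
rewrite [RHS]Ex_eq_indicators; apply: eq_bigr => X _; congr (_ * _).
pose g v b1 b2 : R := (h v b1 b2 == (v \in X))%:R.
have E2 S1 : Ex p2 (fun S2 => (G S1 S2 == X)%:R) =
    \prod_v (if v \in S1 then p2 * g v true true + (1 - p2) * g v true false
             else p2 * g v false true + (1 - p2) * g v false false).
  transitivity (\prod_v (p2 * g v (v \in S1) true + (1 - p2) * g v (v \in S1) false)).
    rewrite -Ex_prod; apply: eq_Ex => S2; rewrite set_eq_prod.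
    by apply: eq_bigr => v _; rewrite inE /g; case: (v \in S2).
  by apply: eq_bigr => v _; case: (v \in S1).
rewrite (eq_Ex _ E2) Ex_prod.
transitivity (\prod_v (p * (true == (v \in X))%:R + (1 - p) * (false == (v \in X))%:R)).
  apply: eq_bigr => v _; rewrite -(hp v) /g.
  by case: (v \in X); case: (h v true true); case: (h v true false);
    case: (h v false true); case: (h v false false); rewrite /=; ring.
rewrite -Ex_prod; apply: eq_Ex => S; rewrite set_eq_prod.
by apply: eq_bigr => v _; case: (v \in S).
Qed.

Lemma Ex_sprinkle p1 p2 F :
  Ex p1 (fun S1 => Ex p2 (fun S2 => F (S1 :|: S2))) = Ex (p1 + p2 - p1 * p2) F.
Proof.
rewrite -(@Ex_combine p1 p2 (p1 + p2 - p1 * p2) (fun _ b1 b2 => b1 || b2) F) /=; last first.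
  by move=> v; ring.
by apply: eq_Ex => S1; apply: eq_Ex => S2; congr F; apply/setP => v; rewrite !inE.
Qed.

(** This replaces conditioning: the trace on [M] is revealed first, and everything outside [M] is
    read from an independent sample. *)
Lemma Ex_resample p (M : {set T}) F :
  Ex p (fun S1 => Ex p (fun S2 => F ((S1 :&: M) :|: (S2 :\: M)))) = Ex p F.
Proof.
rewrite -[RHS](@Ex_combine p p p (fun v b1 b2 => if v \in M then b1 else b2)); last first.
  by move=> v; case: (v \in M) => /=; ring.
apply: eq_Ex => S1; apply: eq_Ex => S2; congr F.
by apply/setP => v; rewrite !inE; case: (v \in M); rewrite ?andbT ?andbF ?orbF.
Qed.

Lemma Ex_mem p v a b : Ex p (fun S => if v \in S then a else b) = p * a + (1 - p) * b.
Proof.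
have -> : Ex p (fun S => if v \in S then a else b) =
   Ex p (fun S => \prod_u (if u \in S then if u == v then a else 1
                           else if u == v then b else 1)).
  apply: eq_Ex => S; rewrite (bigD1 v) //= eqxx big1 ?mulr1 // => u /negPf ->.
  by case: ifP.
rewrite Ex_prod (bigD1 v) //= eqxx big1 ?mulr1 // => u /negPf ->; ring.
Qed.

Lemma Ex_split p v (U : {set T}) F : v \notin U ->
  Ex p (fun S => F (S :&: (v |: U))) =
  p * Ex p (fun S => F (v |: (S :&: U))) + (1 - p) * Ex p (fun S => F (S :&: U)).
Proof.
move=> vU; rewrite -(Ex_resample p [set v] (fun S => F (S :&: (v |: U)))).
transitivity (Ex p (fun S1 => if v \in S1 then Ex p (fun S => F (v |: (S :&: U)))
    else Ex p (fun S => F (S :&: U)))); last by rewrite Ex_mem.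
apply: eq_Ex => S1.
case: ifP => vS; apply: eq_Ex => S2; congr F; apply/setP => u; rewrite !inE.
  have [->|uv] := eqVneq u v; first by rewrite vS.
  by rewrite andbF /= .
have [->|uv] := eqVneq u v; first by rewrite vS (negPf vU) !andbF.
by rewrite andbF /=.
Qed.

Lemma Pr_sub p (A : {set T}) : Pr p (fun S => A \subset S) = p ^+ #|A|.
Proof.
transitivity (Ex p (fun S => \prod_v (if v \in S then 1 else (v \notin A)%:R))).
  apply: eq_Ex => S; case: (boolP (A \subset S)) => AS.
    rewrite big1 // => v _; case: ifP => // vS.
    by case: (boolP (v \in A)) => // /(subsetP AS); rewrite vS.
  case/subsetPn: AS => v vA vS.
  by rewrite (bigD1 v) //= (negPf vS) vA mul0r.
rewrite Ex_prod (bigID (mem A)) /= [X in _ * X]big1 => [|v vA]; last first.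
  by rewrite (vA : v \notin A) /=; ring.
rewrite [LHS]mulr1 -prodr_const; apply: eq_bigr => v vA.
by rewrite vA /=; ring.
Qed.

Lemma Pr_mem p v : Pr p (fun S => v \in S) = p.
Proof.
rewrite -[RHS]expr1 -(cards1 v) -Pr_sub; apply: eq_Ex => S.
by rewrite sub1set.
Qed.

Lemma Ex_pow_card p (M : {set T}) (q : R) :
  Ex p (fun S => q ^+ #|S :&: M|) = (p * q + (1 - p)) ^+ #|M|.
Proof.
transitivity (Ex p (fun S => \prod_v (if v \in S then if v \in M then q else 1 else 1))).
  apply: eq_Ex => S; rewrite -prodr_const big_mkcond /=.
  by apply: eq_bigr => v _; rewrite inE; case: (v \in S).
rewrite Ex_prod (bigID (mem M)) /= [X in _ * X]big1 => [|v /negPf vM]; last first.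
  by rewrite vM; ring.
rewrite mulr1 (eq_bigr (fun=> p * q + (1 - p))) ?prodr_const // => v vM.
by rewrite vM mulr1.
Qed.

Lemma card_sum_mem (S M : {set T}) : #|S :&: M|%:R = \sum_(v in M) (v \in S)%:R :> R.
Proof.
rewrite -sum1_card natr_sum [RHS]big_mkcond [LHS]big_mkcond /=.
by apply: eq_bigr => v _; rewrite inE; case: (v \in S); case: (v \in M).
Qed.

Lemma Ex_cardI p (M : {set T}) : Ex p (fun S => #|S :&: M|%:R) = p * #|M|%:R.
Proof.
rewrite (eq_Ex _ (fun S => card_sum_mem S M)) Ex_sum.
rewrite (eq_bigr (fun=> p)) => [|v _]; last exact: Pr_mem.
by rewrite sumr_const mulr_natr.
Qed.

Lemma Ex_cardI_sqr p (M : {set T}) : 0 <= p <= 1 ->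
  Ex p (fun S => #|S :&: M|%:R ^+ 2) <= (p * #|M|%:R) ^+ 2 + p * #|M|%:R.
Proof.
move=> /andP[p0 p1].
have -> : Ex p (fun S => #|S :&: M|%:R ^+ 2) =
    \sum_(u in M) \sum_(v in M) Pr p (fun S => [set u; v] \subset S).
  under [RHS]eq_bigr do rewrite -Ex_sum; rewrite -Ex_sum; apply: eq_Ex => S.
  rewrite expr2 card_sum_mem mulr_suml; apply: eq_bigr => u _.
  rewrite mulr_sumr; apply: eq_bigr => v _.
  by rewrite subUset !sub1set; case: (u \in S); rewrite ?mul1r ?mul0r.
have -> : (p * #|M|%:R) ^+ 2 + p * #|M|%:R =
   \sum_(u in M) \sum_(v in M) (p ^+ 2 + (u == v)%:R * p).
  have sM u : u \in M -> \sum_(v in M) (p ^+ 2 + (u == v)%:R * p) = p ^+ 2 * #|M|%:R + p.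
    move=> uM; rewrite big_split /= sumr_const mulr_natr (bigD1 u) //= eqxx mul1r.
    by rewrite big1 ?addr0 // => v /andP[_ /negPf vu]; rewrite eq_sym vu mul0r.
  rewrite (eq_bigr _ sM) sumr_const -mulr_natr; ring.
apply: ler_sum => u _; apply: ler_sum => v _; rewrite Pr_sub cards2.
by case: eqP => _ /=; rewrite ?expr1 ?mul1r ?mul0r ?addr0 // lerDr sqr_ge0.
Qed.

Lemma Pr_disjoint p (M : {set T}) : Pr p (fun S => [disjoint S & M]) = (1 - p) ^+ #|M|.
Proof.
rewrite -[1 - p]add0r -[X in X + _](mulr0 p) -Ex_pow_card; apply: eq_Ex => S.
by rewrite expr0n cards_eq0 setI_eq0.
Qed.

(** Squaring 1 - x/2 <= exp(-x/2) gives exp(x) (1 - x/2)^2 <= 1, and the quadratic polynomial times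
    (1 - x/2)^2 is at least 1. No lower bound on [x] is imposed, so the estimate serves both
    signs. *)
Lemma expR_le_quad (x : R) : x <= 1 -> expR x <= 1 + x + 2 * x ^+ 2.
Proof.
move=> x1; have h := expR_ge1Dx (- (x / 2)).
have a0 := expR_gt0 (x / 2).
have ab : expR (x / 2) * expR (- (x / 2)) = 1 by rewrite expRxMexpNx_1.
have -> : expR x = expR (x / 2) ^+ 2 by rewrite expr2 -expRD; congr expR; lra.
set a := expR (x / 2) in a0 ab *; set b := expR _ in h ab.
have y0 : 1 / 2 <= 1 - x / 2 by lra.
have ay : a * (1 - x / 2) <= 1 by rewrite -[leRHS]ab ler_wpM2l // ltW.
have ay2 : a ^+ 2 * (1 - x / 2) ^+ 2 <= 1.
  by rewrite -exprMn expr_le1 // mulr_ge0 // ?ltW //; lra.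
have Q : 1 <= (1 + x + 2 * x ^+ 2) * (1 - x / 2) ^+ 2.
  have -> : (1 + x + 2 * x ^+ 2) * (1 - x / 2) ^+ 2 =
    1 + (x ^+ 2 / 4) * ((1 - x) * (5 - 2 * x)) by field.
  rewrite lerDl; apply: mulr_ge0; first by rewrite mulr_ge0 ?sqr_ge0 // invr_ge0.
  by apply: mulr_ge0; lra.
have y2 : 0 < (1 - x / 2) ^+ 2 by rewrite exprn_gt0 //; lra.
by rewrite -(ler_pM2r y2); exact: le_trans Q.
Qed.

Definition lipschitz (L : R) F :=
  forall v S, v \notin S -> `|F (v |: S) - F S| <= L.

(** Vertices are revealed one at a time. The two conditional means differ by at most L, so one
    vertex contributes a factor 1 + p (D + 2 D^2) <= exp(p D + 2 p D^2). The variance proxy is |U| p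
    L^2, not the |U| L^2 of bounded differences; with p near 1/d this makes the scale n/d instead of
    n. *)
Lemma lipschitz_mgf p (L t : R) F (U : {set T}) : 0 <= p <= 1 -> `|t| * L <= 1 ->
  lipschitz L F ->
  Ex p (fun S => expR (t * F (S :&: U))) <=
  expR (t * Ex p (fun S => F (S :&: U)) + 2 * (#|U|%:R * p) * (t * L) ^+ 2).
Proof.
move=> p01 tL; have /andP[p0 p1] := p01.
move cU : #|U| => m; elim: m F U cU => [|m IH] F U cU lipF.
  move/eqP: cU; rewrite cards_eq0 => /eqP ->.
  rewrite (@eq_Ex p _ (fun=> expR (t * F set0))) => [|S]; last by rewrite setI0.
  rewrite (@eq_Ex p (fun S => F (S :&: set0)) (fun=> F set0)) => [|S]; last by rewrite setI0.
  by rewrite !Ex_cst mul0r mulr0 mul0r addr0.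
have [v vU] : exists v, v \in U by apply/card_gt0P; rewrite cU.
have [U' vU' UE] : exists2 U' : {set T}, v \notin U' & U = v |: U'.
  by exists (U :\ v); rewrite ?setD1K // !inE eqxx.
have cU' : #|U'| = m by move: cU; rewrite UE cardsU1 vU' => -[].
have lip1 : lipschitz L (fun S => F (v |: S)).
  move=> u S uS; rewrite setUCA.
  have [uv|uv] := boolP (u \in v |: S); last exact: lipF.
  have -> : u |: (v |: S) = v |: S by apply/setUidPr; rewrite sub1set.
  by rewrite subrr normr0 (le_trans _ (lipF v set0 _)) ?inE.
have I1 := IH _ U' cU' lip1; have I0 := IH _ U' cU' lipF.
rewrite UE !(Ex_split _ _ vU') (Ex_split p (fun S => expR (t * F S)) vU') /=.
move: I1 I0; set A1 := Ex p (fun S => F (v |: S :&: U')).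
set A0 := Ex p (fun S => F (S :&: U')).
set B := 2 * (m%:R * p) * (t * L) ^+ 2 => I1 I0.
have dA : `|A1 - A0| <= L.
  rewrite -ExB ler_norml; apply/andP; split.
    rewrite -(Ex_cst p (- L)); apply: Ex_le => // S.
    by have := lipF v (S :&: U'); rewrite inE (negPf vU') andbF ler_norml => /(_ isT)/andP[].
  apply: Ex_le_cst => // S.
  by have := lipF v (S :&: U'); rewrite inE (negPf vU') andbF ler_norml => /(_ isT)/andP[].
pose D := t * (A1 - A0).
have Dle : `|D| <= `|t| * L by rewrite normrM ler_wpM2l.
have D1 : D <= 1 by apply: le_trans (ler_norm _) (le_trans Dle tL).
have D2 : D ^+ 2 <= (t * L) ^+ 2.
  have L0 : 0 <= L by apply: le_trans dA.
  rewrite -real_normK ?num_real // -[leRHS]real_normK ?num_real //.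
  by rewrite lerXn2r ?nnegrE // [`|t * L|]normrM (ger0_norm L0).
apply: le_trans (_ : expR (t * A0 + B) * (1 + p * (D + 2 * D ^+ 2)) <= _).
  apply: le_trans (lerD (ler_wpM2l p0 I1) (ler_wpM2l _ I0)) _; first by rewrite subr_ge0.
  have -> : t * A1 + B = (t * A0 + B) + D by rewrite /D; ring.
  rewrite expRD; have := expR_le_quad D1; have := expR_ge0 (t * A0 + B).
  set X := expR (t * A0 + B); set Y := expR D => X0 hY.
  have -> : p * (X * Y) + (1 - p) * X = X * (1 + p * (Y - 1)) by ring.
  by apply: ler_wpM2l => //; rewrite lerD2l ler_wpM2l //; lra.
apply: le_trans (ler_wpM2l (expR_ge0 _) (expR_ge1Dx _)) _.
rewrite -expRD ler_expR /B /D -[m.+1%:R]natr1.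
have -> : t * (p * A1 + (1 - p) * A0) = t * A0 + p * (t * (A1 - A0)) by ring.
rewrite -/D; have := ler_wpM2l p0 D2; lra.
Qed.

Lemma lipschitz_upper_tail p (L V t : R) F : 0 <= p <= 1 -> 0 < L -> 0 < V ->
  #|T|%:R * p <= V -> 0 <= t <= 4 * V * L -> lipschitz L F ->
  Pr p (fun S => Ex p F + t <= F S) <= expR (- (t ^+ 2 / (8 * V * L ^+ 2))).
Proof.
move=> p01 L0 V0 TV /andP[t0 tV] lipF.
(* The minimiser of - s t + 2 V (s L)^2; the assumption t <= 4 V L is exactly s L <= 1. *)
pose s := t / (4 * V * L ^+ 2).
have VL : 0 < 4 * V * L ^+ 2 by rewrite !mulr_gt0 ?exprn_gt0.
have s0 : 0 <= s by rewrite divr_ge0 // ltW.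
have sL : `|s| * L <= 1.
  rewrite ger0_norm // /s mulrAC ler_pdivrMr // mul1r expr2 !mulrA.
  by rewrite ler_pM2r.
have := lipschitz_mgf setT p01 sL lipF.
rewrite (@eq_Ex p _ (fun S => expR (s * F S))) => [|S]; last by rewrite setIT.
rewrite (@eq_Ex p (fun S => F (S :&: setT)) F) => [|S]; last by rewrite setIT.
rewrite cardsT => mgf.
have st : s * t - 2 * V * (s * L) ^+ 2 = t ^+ 2 / (8 * V * L ^+ 2).
  by rewrite /s; field; rewrite !lt0r_neq0.
apply: le_trans (_ : Ex p (fun S => expR (- s * (Ex p F + t)) * expR (s * F S)) <= _).
  apply: Ex_le => // S; case: (boolP (Ex p F + t <= F S)) => h; last by rewrite mulr_ge0 ?expR_ge0.
  rewrite -expRD -[leLHS]expR0 ler_expR mulNr addrC subr_ge0.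
  exact: ler_wpM2l.
rewrite ExZ; apply: le_trans (ler_wpM2l (expR_ge0 _) mgf) _.
rewrite -expRD ler_expR -st.
have : 2 * (#|T|%:R * p) * (s * L) ^+ 2 <= 2 * V * (s * L) ^+ 2.
  by rewrite ler_wpM2r ?sqr_ge0 // ler_wpM2l.
lra.
Qed.

Lemma lipschitz_lower_tail p (L V t : R) F : 0 <= p <= 1 -> 0 < L -> 0 < V ->
  #|T|%:R * p <= V -> 0 <= t <= 4 * V * L -> lipschitz L F ->
  Pr p (fun S => F S <= Ex p F - t) <= expR (- (t ^+ 2 / (8 * V * L ^+ 2))).
Proof.
move=> p01 L0 V0 TV tV lipF.
have lipN : lipschitz L (fun S => - F S).
  by move=> v S vS; rewrite -opprD normrN; exact: lipF.
apply: le_trans (lipschitz_upper_tail p01 L0 V0 TV tV lipN).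
by apply: Pr_le => // S; rewrite ExN => h; lra.
Qed.

Section Extension.
Variables (G : pred {set T}) (F : {set T} -> R) (L : R).
Hypotheses (G0 : G set0) (downG : forall v S, G (v |: S) -> G S).
Hypotheses (L0 : 0 <= L).
Hypothesis lipFG :
  forall v S, v \notin S -> G (v |: S) -> `|F (v |: S) - F S| <= L.

Let dist (S S' : {set T}) : R := (#|S :\: S'| + #|S' :\: S|)%:R.

Lemma lipschitz_chain S S' : G S -> S' \subset S ->
  `|F S - F S'| <= L * #|S :\: S'|%:R.
Proof.
move cS : #|S :\: S'| => m; elim: m S cS => [|m IH] S cS GS sub.
  move/eqP: (cS); rewrite cards_eq0 setD_eq0 => sub'.
  by rewrite (_ : S' = S) ?subrr ?normr0 ?mulr_ge0 //; apply/eqP; rewrite eqEsubset sub.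
have [v vS] : exists v, v \in S :\: S' by apply/card_gt0P; rewrite cS.
move: (vS); rewrite inE => /andP[vS' vS1].
have cS' : #|(S :\ v) :\: S'| = m.
  move: cS; rewrite (cardsD1 v) vS => -[<-]; congr #|pred_of_set _|.
  by apply/setP => u; rewrite !inE; case: (u == v); rewrite ?andbF.
have GSv : G (v |: (S :\ v)) by rewrite setD1K.
have := IH _ cS' (downG GSv); rewrite subsetD1 sub vS' => /(_ isT) I.
have := @lipFG v (S :\ v); rewrite !inE eqxx => /(_ isT GSv); rewrite setD1K // => h.
have -> : F S - F S' = (F S - F (S :\ v)) + (F (S :\ v) - F S') by ring.
apply: le_trans (ler_normD _ _) _; apply: le_trans (lerD h I) _.
by rewrite -natr1 mulrDr mulr1 addrC.
Qed.

(** The route from [S] to [S'] goes through their intersection, hence stays in the down-closed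
    family [G]. *)
Lemma lipschitz_G S S' : G S -> G S' -> F S <= F S' + L * dist S S'.
Proof.
move=> GS GS'.
have h1 := lipschitz_chain GS (subsetIl S S').
have h2 := lipschitz_chain GS' (subsetIr S S').
have e1 : S :\: S :&: S' = S :\: S' by apply/setP => u; rewrite !inE; case: (u \in S); rewrite ?andbF.
have e2 : S' :\: S :&: S' = S' :\: S.
  by apply/setP => u; rewrite !inE; case: (u \in S'); rewrite ?andbF ?andbT.
move: h1 h2; rewrite e1 e2 /dist natrD mulrDr !ler_norml => /andP[_ h1] /andP[h2 _].
lra.
Qed.

(** McShane extension for the Hamming distance: F'(S) is the minimum over S' in [G] of F(S') + L
    dist(S, S'). The last clause bounds F' from both sides outside [G], which is needed to compare
    the means of F and F'. *)
Lemma lipschitz_extension : exists F' : {set T} -> R,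
  [/\ lipschitz L F', (forall S, G S -> F' S = F S) &
      forall S, F' S <= F set0 + L * #|S|%:R /\
                exists2 S', G S' & F S' <= F' S].
Proof.
pose best S := [arg min_(S' < set0 | G S') (F S' + L * dist S S')]%O.
pose F' S := F (best S) + L * dist S (best S).
have bestP S : G (best S) /\ forall S', G S' -> F' S <= F S' + L * dist S S'.
  by rewrite /F' /best; case: arg_minP.
have distv v S S' : dist (v |: S) S' <= dist S S' + 1 /\ dist S S' <= dist (v |: S) S' + 1.
  rewrite /dist !natr1 !ler_nat.
  have c (A B : {set T}) : A \subset v |: B -> (#|A| <= #|B| + 1)%N.
    by move/subset_leq_card/leq_trans; apply; rewrite cardsU1 addnC leq_add2l leq_b1.
  have d1 : (#|(v |: S) :\: S'| <= #|S :\: S'| + 1)%N.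
    by apply: c; apply/fintype.subsetP => u; rewrite !inE; case: (u == v); case: (u \in S').
  have d2 : (#|S' :\: (v |: S)| <= #|S' :\: S|)%N.
    by apply: subset_leq_card; apply/fintype.subsetP => u; rewrite !inE; case: (u == v).
  have d3 : (#|S :\: S'| <= #|(v |: S) :\: S'|)%N.
    by apply: subset_leq_card; apply/fintype.subsetP => u; rewrite !inE; case: (u == v); case: (u \in S').
  have d4 : (#|S' :\: S| <= #|S' :\: (v |: S)| + 1)%N.
    by apply: c; apply/fintype.subsetP => u; rewrite !inE; case: (u == v).
  by split; lia.
exists F'; split=> [v S vS|S GS|S].
- have [g1 b1] := bestP S; have [g2 b2] := bestP (v |: S).
  have [dv1 _] := distv v S (best S); have [_ dv2] := distv v S (best (v |: S)).
  have := b1 _ g2; have := b2 _ g1; rewrite ler_norml.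
  have := ler_wpM2l L0 dv1; have := ler_wpM2l L0 dv2; rewrite /F'; lra.
- have [g1 b1] := bestP S; apply/eqP; rewrite eq_le lipschitz_G // andbT.
  by have := b1 _ GS; rewrite /dist setDv cards0 mulr0 addr0.
- have [g1 b1] := bestP S; split.
    by have := b1 _ G0; rewrite /dist setD0 set0D cards0 addn0.
  by exists (best S) => //; rewrite /F' lerDl mulr_ge0.
Qed.
End Extension.

Lemma Ex_card_sqr p : 0 <= p <= 1 ->
  Ex p (fun S => #|S|%:R ^+ 2) <= (p * #|T|%:R) ^+ 2 + p * #|T|%:R.
Proof.
move=> p01; have := Ex_cardI_sqr [set: T] p01; rewrite cardsT.
by rewrite (@eq_Ex p _ (fun S => #|S|%:R ^+ 2)) => // S; rewrite setIT.
Qed.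

(** Below [Y] the cardinality is at most [Y], above it at most |S|^2 / Y; the first case is paid by
    Pr(E), the second by the second moment. *)
Lemma Ex_card_truncated p (E : pred {set T}) (Y : R) : 0 <= p <= 1 -> 0 < Y ->
  Ex p (fun S => #|S|%:R * (E S)%:R) <=
  ((p * #|T|%:R) ^+ 2 + p * #|T|%:R) / Y + Y * Pr p E.
Proof.
move=> p01 Y0.
apply: le_trans (_ : Ex p (fun S => Y^-1 * #|S|%:R ^+ 2 + Y * (E S)%:R) <= _).
  apply: Ex_le => // S; set k : R := #|S|%:R.
  have k0 : 0 <= k by [].
  case: (E S); rewrite ?mulr0 ?mulr1 ?addr0; last by rewrite mulr_ge0 ?invr_ge0 ?sqr_ge0 // ltW.
  have [kY|Yk] := leP k Y; first by rewrite (le_trans kY) // lerDr mulr_ge0 ?invr_ge0 ?sqr_ge0 // ltW.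
  apply: le_trans (_ : Y^-1 * k ^+ 2 <= _); last by rewrite lerDl ltW.
  by rewrite mulrC ler_pdivlMr // expr2 ler_wpM2l // ltW.
rewrite ExD !ExZ lerD2r mulrC ler_wpM2r ?invr_ge0 ?(ltW Y0) //.
exact: Ex_card_sqr.
Qed.

(** The tails are taken for the extension of [F] from [G]. Both functions lie between 0 and L |S|,
    so their means differ by at most L E[|S|; not G] <= t/2. The other half of [t] is left for the
    deviation, which turns the constant 8 into 32. *)
Lemma truncated_lipschitz_tails (G : pred {set T}) p (L V t : R) F :
  0 <= p <= 1 -> G set0 -> (forall v S, G (v |: S) -> G S) ->
  1 <= L -> 0 < V -> #|T|%:R * p <= V -> 0 <= t <= 8 * V * L ->
  (forall S, 0 <= F S <= #|S|%:R) ->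
  (forall v S, v \notin S -> G (v |: S) -> `|F (v |: S) - F S| <= L) ->
  L * Ex p (fun S => #|S|%:R * (~~ G S)%:R) <= t / 2 ->
  Pr p (fun S => Ex p F + t <= F S) <=
    Pr p (fun S => ~~ G S) + expR (- (t ^+ 2 / (32 * V * L ^+ 2))) /\
  Pr p (fun S => F S <= Ex p F - t) <=
    Pr p (fun S => ~~ G S) + expR (- (t ^+ 2 / (32 * V * L ^+ 2))).
Proof.
move=> p01 G0 dG L1 V0 TV /andP[t0 tV] Fb lipF small.
have L0 : 0 < L by lra.
have [F' [lipF' F'E F'b]] := lipschitz_extension G0 dG (ltW L0) lipF.
have F0 : F set0 = 0.
  by apply/eqP; rewrite eq_le; have := Fb set0; rewrite cards0 => /andP[-> ->].
have F'0 S : 0 <= F' S <= L * #|S|%:R.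
  have [h [S' _ h']] := F'b S; rewrite F0 add0r in h; rewrite h andbT.
  by apply: le_trans h'; have /andP[] := Fb S'.
have dE : `|Ex p F' - Ex p F| <= t / 2.
  apply: le_trans small; rewrite -ExZ -ExB.
  have dS S : `|F' S - F S| <= L * (#|S|%:R * (~~ G S)%:R).
    case: (boolP (G S)) => [/F'E ->|_]; first by rewrite subrr normr0 !mulr0.
    rewrite mulr1 ler_norml.
    have /andP[a1 a2] := F'0 S; have /andP[b1 b2] := Fb S.
    have : #|S|%:R <= L * #|S|%:R by rewrite ler_peMl.
    by move=> h; apply/andP; split; lra.
  rewrite ler_norml -ExN; apply/andP; split; apply: Ex_le => // S;
    by have := dS S; rewrite ler_norml => /andP[].
have tV' : 0 <= t / 2 <= 4 * V * L by apply/andP; split; lra.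
have eE : (t / 2) ^+ 2 / (8 * V * L ^+ 2) = t ^+ 2 / (32 * V * L ^+ 2).
  by field; rewrite !lt0r_neq0.
move: dE; rewrite ler_norml => /andP[dE1 dE2].
split.
  apply: le_trans (_ : Pr p (fun S => ~~ G S || (Ex p F' + t / 2 <= F' S)) <= _).
    apply: Pr_le => // S h; case: (boolP (G S)) => //= GS; rewrite F'E //; lra.
  apply: le_trans (PrU _ _ p01) _; rewrite lerD2l -eE.
  exact: lipschitz_upper_tail.
apply: le_trans (_ : Pr p (fun S => ~~ G S || (F' S <= Ex p F' - t / 2)) <= _).
  apply: Pr_le => // S h; case: (boolP (G S)) => //= GS; rewrite F'E //; lra.
apply: le_trans (PrU _ _ p01) _; rewrite lerD2l -eE.
exact: lipschitz_lower_tail.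
Qed.

End ProductMeasure.

(** * Exploration and branching processes *)

Section Reach.
Variables (T : finType) (e : rel T).
Implicit Types (A Y S U : {set T}).

Definition nb (v : T) : {set T} := [set u | e v u].

(** State of an exploration: [A] holds the active vertices and [Y] the retained vertices not yet
    discovered. *)
Definition reach A Y : {set T} :=
  [set u | [exists a in A, connect (induced e (A :|: Y)) a u]].

Lemma connect_closed (r : rel T) (P : pred T) x y :
  (forall u v, P u -> r u v -> P v) -> P x -> connect r x y -> P y.
Proof.
move=> hP Px /connectP[s + ->] {y}; elim: s x Px => //= y s IH x Px /andP[xy].
by apply: IH; exact: hP xy.
Qed.

Lemma induced_mono S S' : S \subset S' ->
  subrel (connect (induced e S)) (connect (induced e S')).
Proof.
move=> SS; apply: connect_sub => u v /and3P[uS vS uv]; apply: connect1.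
by rewrite /induced /= !(subsetP SS).
Qed.

Lemma reach_id A Y a : a \in A -> a \in reach A Y.
Proof. by move=> aA; rewrite inE; apply/existsP; exists a; rewrite aA connect0. Qed.

Lemma reach_sub A Y : reach A Y \subset A :|: Y.
Proof.
apply/subsetP => u; rewrite inE => /existsP[a /andP[aA]].
apply: (connect_closed (P := mem (A :|: Y))); last by rewrite /= inE aA.
by move=> x y _ /and3P[].
Qed.

Lemma reach_next A Y u v : u \in reach A Y -> v \in A :|: Y -> e u v ->
  v \in reach A Y.
Proof.
move=> uR vAY uv; have uAY := subsetP (reach_sub A Y) u uR.
move: uR; rewrite !inE => /existsP[a /andP[aA au]].
apply/existsP; exists a; rewrite aA; apply: connect_trans au (connect1 _).
by rewrite /induced /= uAY vAY.
Qed.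

Lemma reach_closed A Y (P : {set T}) : A \subset P ->
  (forall u v, u \in P -> v \in A :|: Y -> e u v -> v \in P) ->
  reach A Y \subset P.
Proof.
move=> AP hP; apply/subsetP => u; rewrite inE => /existsP[a /andP[aA]].
apply: (connect_closed (P := mem P)); last exact: (subsetP AP).
by move=> x y /= xP /and3P[_ yAY xy]; exact: hP xy.
Qed.

(* Processing the active vertex [a] discovers its neighbours in [Y]. *)
Lemma card_reach_step A Y a : irreflexive e -> a \in A -> [disjoint A & Y] ->
  #|reach A Y| = #|reach ((A :\ a) :|: (Y :&: nb a)) (Y :\: nb a)|.+1.
Proof.
move=> irr aA dAY; set A' := _ :|: _; set Y' := _ :\: _.
have aY : a \notin Y by rewrite (disjointFr dAY aA).
have AYE : A :|: Y = a |: (A' :|: Y').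
  apply/setP => u; rewrite !inE; have [->|ua] := eqVneq u a; first by rewrite aA.
  by case: (u \in A); case: (u \in Y); case: (e a u).
have aA'Y' : a \notin A' :|: Y' by rewrite !inE eqxx (negPf aY) irr.
have -> : reach A Y = a |: reach A' Y'.
  apply/eqP; rewrite eqEsubset; apply/andP; split.
    apply: reach_closed => [|u v].
      apply/subsetP => u uA; rewrite in_setU1; have [//|ua] := eqVneq u a.
      by apply: reach_id; rewrite !inE ua uA.
    rewrite AYE !in_setU1 => uR /predU1P[->|vA'Y'] uv; first by rewrite eqxx.
    apply/orP; right; case/predU1P: uR => [ua|uR]; last exact: reach_next uv.
    apply: reach_id; move: uv vA'Y'; rewrite ua !inE => ->.
    by rewrite /= orbF andbT.
  rewrite subUset sub1set reach_id //=; apply: reach_closed => [|u v uR vA'Y' uv].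
    apply/subsetP => u; rewrite in_setU => /orP[|].
      by rewrite inE => /andP[_ uA]; exact: reach_id.
    rewrite in_setI [u \in nb a]inE => /andP[uY uN]; have aR := reach_id Y aA.
    by apply: (reach_next aR _ uN); rewrite inE uY orbT.
  by apply: (reach_next uR _ uv); rewrite AYE in_setU1 vA'Y' orbT.
rewrite cardsU1; suff -> : a \notin reach A' Y' by [].
by apply: contra aA'Y'; exact: (subsetP (reach_sub A' Y')).
Qed.

Lemma reach0 Y : reach set0 Y = set0.
Proof.
by apply/setP => u; rewrite !inE; apply/negbTE; rewrite negb_exists; apply/forallP => a; rewrite inE.
Qed.

Lemma component_reach S v : v \in S -> component e S v = reach [set v] (S :\ v).
Proof.
move=> vS; have SE : [set v] :|: (S :\ v) = S by rewrite setD1K.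
apply/setP => u; rewrite !inE SE; apply/idP/idP.
  by case/andP=> _ vu; apply/existsP; exists v; rewrite inE eqxx.
case/existsP => a /andP[]; rewrite inE => /eqP -> vu; rewrite vu andbT.
by apply: (connect_closed (P := mem S)) vu => // x y _ /and3P[].
Qed.

End Reach.

Section GaltonWatson.
Variable R : realType.
Implicit Types (p : R) (g : nat -> R).

(** One potential child: [iter d (coin p) g a] is the expectation of g(a + Bin(d, p)). *)
Definition coin p g (a : nat) : R := p * g a.+1 + (1 - p) * g a.

(* Probability that a branching walk with Bin(d, p) offspring started from
   [a] individuals processes at least [k] of them. *)
Fixpoint gw p (d k a : nat) : R :=
  if k isn't k'.+1 then 1 else
  if a isn't a'.+1 then 0 else iter d (coin p) (gw p d k') a'.

Lemma coin_mono p g1 g2 : 0 <= p <= 1 -> (forall a, g1 a <= g2 a) ->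
  forall a, coin p g1 a <= coin p g2 a.
Proof.
by move=> /andP[p0 p1] h a; rewrite /coin lerD // ler_wpM2l ?subr_ge0.
Qed.

Lemma iter_coin_mono p m g1 g2 : 0 <= p <= 1 -> (forall a, g1 a <= g2 a) ->
  forall a, iter m (coin p) g1 a <= iter m (coin p) g2 a.
Proof. by move=> p01 h; elim: m => //= m IH; exact: coin_mono. Qed.

Lemma coin_nondecr p g : 0 <= p <= 1 -> (forall a, g a <= g a.+1) ->
  forall a, coin p g a <= coin p g a.+1.
Proof.
by move=> /andP[p0 p1] h a; rewrite /coin lerD // ler_wpM2l ?subr_ge0.
Qed.

Lemma iter_coin_nondecr p m g : 0 <= p <= 1 -> (forall a, g a <= g a.+1) ->
  forall a, iter m (coin p) g a <= iter m (coin p) g a.+1.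
Proof. by move=> p01 h; elim: m => //= m IH; exact: coin_nondecr. Qed.

Lemma le_iter_coin p m d g : 0 <= p <= 1 -> (forall a, g a <= g a.+1) ->
  (m <= d)%N -> forall a, iter m (coin p) g a <= iter d (coin p) g a.
Proof.
move=> p01 h; elim: d => [|d IH]; first by rewrite leqn0 => /eqP ->.
rewrite leq_eqVlt => /predU1P[-> //|md a]; apply: le_trans (IH _ _) _ => //=.
have := iter_coin_nondecr d p01 h a; rewrite /coin; set x := iter _ _ _ _.
set y := iter _ _ _ _ => xy; have /andP[p0 p1] := p01.
have := ler_wpM2l p0 xy; lra.
Qed.

Lemma iter_coin_ge0 p m g : 0 <= p <= 1 -> (forall a, 0 <= g a) ->
  forall a, 0 <= iter m (coin p) g a.
Proof.
move=> p01 h; elim: m => //= m IH a; have /andP[p0 p1] := p01.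
by rewrite /coin addr_ge0 // mulr_ge0 // subr_ge0.
Qed.

Lemma gw_ge0 p d k a : 0 <= p <= 1 -> 0 <= gw p d k a.
Proof.
move=> p01; elim: k a => [|k IH] [|a] //=; exact: iter_coin_ge0.
Qed.

Lemma gw_nondecr p d k a : 0 <= p <= 1 -> gw p d k a <= gw p d k a.+1.
Proof.
move=> p01; elim: k a => [|k IH] [|a] //=.
  by apply: iter_coin_ge0 => // a; exact: gw_ge0.
exact: iter_coin_nondecr.
Qed.

Lemma iter_coin_exp p m (q r c : R) a :
  iter m (coin p) (fun a => 1 - q ^+ a + c * r ^+ a) a =
  1 - (p * q + (1 - p)) ^+ m * q ^+ a + c * ((p * r + (1 - p)) ^+ m * r ^+ a).
Proof.
elim: m a => [|m IH] a; first by rewrite !expr0 !mul1r.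
by rewrite iterS /coin !IH !exprS; ring.
Qed.

(** With f the offspring generating function, q <= f(q) makes 1 - q^a a supersolution of the
    recursion. It can fall short at the finite horizon k = 0; the correction w^k r^a repairs this
    and, since f(r) <= w r, decays by [w] with each processed individual. Thus it pays for the walks
    that die out after more than k steps. *)
Lemma gw_le p d (q r w : R) : 0 <= p <= 1 -> 0 <= q <= r -> 0 <= w ->
  q <= (p * q + (1 - p)) ^+ d -> (p * r + (1 - p)) ^+ d <= w * r ->
  forall k a, gw p d k a <= 1 - q ^+ a + w ^+ k * r ^+ a.
Proof.
move=> p01 /andP[q0 qr] w0 hq hr; elim=> [|k IH] a.
  have : q ^+ a <= r ^+ a by rewrite lerXn2r // nnegrE // (le_trans q0).
  by rewrite /= expr0 mul1r; lra.
case: a => [|a] /=; first by rewrite !expr0 subrr add0r mulr1 exprn_ge0.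
apply: le_trans (iter_coin_mono d p01 IH a) _; rewrite iter_coin_exp.
have r0 : 0 <= r by exact: le_trans qr.
have := ler_wpM2r (exprn_ge0 a q0) hq.
have := ler_wpM2l (exprn_ge0 k w0) (ler_wpM2r (exprn_ge0 a r0) hr).
rewrite !exprS; lra.
Qed.

End GaltonWatson.

Section Exploration.
Variables (R : realType) (T : finType) (e : rel T) (d : nat) (p : R).
Hypotheses (irrE : irreflexive e) (reg : regular e d).
Hypothesis p01 : 0 <= p <= 1.
Implicit Types (A P U S : {set T}).

Lemma Ex_reach_step A U a k : a \in A -> [disjoint A & U] ->
  Pr p (fun S => (k < #|reach e A (S :&: U)|)%N) =
  Ex p (fun S1 => Pr p (fun S2 => (k <=
    #|reach e ((A :\ a) :|: (S1 :&: (U :&: nb e a))) (S2 :&: (U :\: nb e a))|)%N)).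
Proof.
move=> aA dAU; rewrite /Pr -(Ex_resample p (U :&: nb e a)).
apply: eq_Ex => S1; apply: eq_Ex => S2; congr (nat_of_bool _)%:R.
rewrite (@card_reach_step _ _ _ _ a) //; last first.
  by apply: disjointWr dAU; exact: subsetIr.
rewrite ltnS; congr (_ <= #|pred_of_set (reach e (_ :|: _) _)|)%N.
  by apply/setP => u; rewrite !inE; case: (u \in S1); case: (u \in S2); case: (u \in U); case: (e a u).
by apply/setP => u; rewrite !inE; case: (u \in S1); case: (u \in S2); case: (u \in U); case: (e a u).
Qed.

Lemma Ex_card_coin (M : {set T}) g a :
  Ex p (fun S => g (a + #|S :&: M|)%N) = iter #|M| (coin p) g a.
Proof.
move cM : #|M| => m; elim: m M cM a => [|m IH] M cM a.
  move/eqP: cM; rewrite cards_eq0 => /eqP ->.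
  rewrite (@eq_Ex _ _ p _ (fun=> g a)) ?Ex_cst // => S.
  by rewrite setI0 cards0 addn0.
have [v vM] : exists v, v \in M by apply/card_gt0P; rewrite cM.
have [M' vM' ME] : exists2 M' : {set T}, v \notin M' & M = v |: M'.
  by exists (M :\ v); rewrite ?setD1K // !inE eqxx.
have cM' : #|M'| = m by move: cM; rewrite ME cardsU1 vM' => -[].
rewrite ME (Ex_split p (fun S => g (a + #|S|)%N) vM') /= /coin -!(IH _ cM').
congr (_ * _ + _); apply: eq_Ex => S.
by rewrite cardsU1 inE (negPf vM') andbF addnA addn1.
Qed.

(** A processed vertex has at most d undiscovered neighbours. As [gw] is nondecreasing in the number
    of active individuals, topping their number up to d only weakens the bound. *)
Lemma reach_upper k A U : [disjoint A & U] ->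
  Pr p (fun S => (k <= #|reach e A (S :&: U)|)%N) <= gw p d k #|A|.
Proof.
elim: k A U => [|k IH] A U dAU; first exact: Pr_le1.
have [->|[a aA]] := set_0Vmem A.
  rewrite cards0 /= -(Ex_cst T p 0); apply: Ex_le => // S.
  by rewrite reach0 cards0.
rewrite (Ex_reach_step _ aA dAU) (cardsD1 a) aA /=.
apply: le_trans (_ : Ex p (fun S => gw p d k (#|A :\ a| + #|S :&: (U :&: nb e a)|)%N) <= _).
  apply: Ex_le => // S1; apply: le_trans (IH _ _ _) _.
    rewrite disjoints_subset; apply/subsetP => u; rewrite !inE.
    case/orP=> [/andP[ua uA]|/and3P[_ _ ->]] //.
    by rewrite (disjointFr dAU uA) andbF.
  suff -> : #|A :\ a :|: S1 :&: (U :&: nb e a)| = (#|A :\ a| + #|S1 :&: (U :&: nb e a)|)%N by [].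
  rewrite cardsU (_ : (A :\ a) :&: _ = set0) ?cards0 ?subn0 //.
  apply/setP => u; rewrite !inE; apply/negP => /andP[/andP[_ uA] /and3P[_ uU _]].
  by rewrite (disjointFr dAU uA) in uU.
rewrite Ex_card_coin; apply: le_iter_coin => // [a'|]; first exact: gw_nondecr.
by rewrite -(reg a) -/(nb e a) subset_leq_card // subsetIr.
Qed.

Section Lower.
Variables (bad : rel T) (b g q m : R) (K : nat) (v0 : T).
Hypothesis bad_sym : symmetric bad.
Hypothesis bad_card : forall u, #|[set v | bad u v]|%:R <= b.
Hypothesis good_codeg :
  forall u v, u != v -> ~~ bad u v -> #|nb e u :&: nb e v|%:R <= g.
Hypotheses (g0 : 0 <= g) (mE : m <= d%:R - 1 - K%:R * g) (q01 : 0 <= q <= 1).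
Hypothesis qE : forall j : nat, m <= j%:R -> (p * q + (1 - p)) ^+ j <= q.
Hypothesis pd : p * d%:R <= 2.

Definition bad_set (D : {set T}) : {set T} := [set w | [exists x in D, bad x w]].

Lemma b_ge0 : 0 <= b. Proof. exact: le_trans (bad_card v0). Qed.

Lemma card_bad_setU U D X :
  #|U :&: bad_set (D :|: X)|%:R <= #|U :&: bad_set D|%:R + b * #|X|%:R.
Proof.
have sub : U :&: bad_set (D :|: X) \subset
    (U :&: bad_set D) :|: \bigcup_(x in X) [set v | bad x v].
  apply/subsetP => w; rewrite !inE => /andP[->] /existsP[x /andP[]].
  rewrite inE => /orP[xD|xX] xw.
    by apply/orP; left; apply/existsP; exists x; rewrite xD.
  by apply/orP; right; apply/bigcupP; exists x; rewrite ?inE.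
apply: le_trans (_ : (#|U :&: bad_set D| + \sum_(x in X) #|[set v | bad x v]|)%:R <= _).
  rewrite ler_nat (leq_trans (subset_leq_card sub)) //.
  rewrite (leq_trans (leq_card_setU _ _)) // leq_add2l.
  elim/big_rec2: _ => [|x B n _ h]; first by rewrite cards0.
  by rewrite (leq_trans (leq_card_setU _ _)) // leq_add2l.
rewrite natrD lerD2l natr_sum.
apply: le_trans (ler_sum _ (fun x _ => bad_card x)) _.
by rewrite sumr_const mulr_natr.
Qed.

(** The ways in which newly discovered vertices [X] can spoil the absence of bad pairs: with the
    vertices [D] found before, or among themselves. *)
Definition bad_batch (D X : {set T}) :=
  ~~ [disjoint X & bad_set D] ||
  [exists x in X, exists y in X, (x != y) && bad x y].

Lemma Pr_bad_batch D (M : {set T}) : p * #|M|%:R <= 2 ->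
  Pr p (fun S => bad_batch D (S :&: M)) <= p * #|M :&: bad_set D|%:R + 2 * p * b.
Proof.
have /andP[p0 p1] := p01 => pM.
pose pairs S : R := \sum_(x in M) \sum_(y in M | (x != y) && bad x y)
   ([set x; y] \subset S)%:R.
apply: le_trans (_ : Ex p (fun S => #|S :&: (M :&: bad_set D)|%:R + pairs S) <= _).
  apply: Ex_le => // S; rewrite /bad_batch.
  have pairs0 : 0 <= pairs S by apply: sumr_ge0 => x _; apply: sumr_ge0.
  case: (boolP [disjoint S :&: M & bad_set D]) => /= [_|].
    case: existsP => [[x /andP[xSM /existsP[y /and3P[ySM xy bxy]]]]|_]; last first.
      by rewrite addr_ge0.
    apply: le_trans (_ : pairs S <= _); last by rewrite lerDr.
    move: xSM ySM; rewrite !inE => /andP[xS xM] /andP[yS yM].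
    rewrite /pairs (bigD1 x) //= (bigD1 y) /=; last by rewrite yM xy bxy.
    rewrite subUset !sub1set xS yS /= -addrA lerDl addr_ge0 //.
      by apply: sumr_ge0.
    by apply: sumr_ge0 => z _; apply: sumr_ge0.
  rewrite -setI_eq0 -setIA => /set0Pn[x xI].
  apply: le_trans (_ : #|S :&: (M :&: bad_set D)|%:R <= _); last by rewrite lerDl.
  by rewrite ler1n; apply/card_gt0P; exists x.
rewrite ExD Ex_cardI lerD2l /pairs Ex_sum.
apply: le_trans (_ : \sum_(x in M) p ^+ 2 * b <= _).
  apply: ler_sum => x xM; rewrite Ex_sum.
  apply: le_trans (_ : \sum_(y in [set v | bad x v]) p ^+ 2 <= _).
    rewrite [leRHS](bigID (fun y => (y \in M) && (x != y))) /=.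
    apply: le_trans (_ : \sum_(y in [set v | bad x v] | (y \in M) && (x != y)) p ^+ 2 <= _); last first.
      by rewrite lerDl; apply: sumr_ge0 => y _; exact: sqr_ge0.
    rewrite [leLHS](eq_bigl (fun y => (y \in [set v | bad x v]) && ((y \in M) && (x != y)))); last first.
      by move=> y; rewrite !inE; case: (y \in M); case: (x != y); case: (bad x y).
    apply: ler_sum => y /and3P[_ _ xy].
    by rewrite [leLHS](Pr_sub p [set x; y]) cards2 xy.
  by rewrite sumr_const -mulr_natr mulrC [leRHS]mulrC ler_wpM2r ?sqr_ge0.
rewrite sumr_const -[leLHS]mulr_natr.
have -> : p ^+ 2 * b * #|M|%:R = p * b * (p * #|M|%:R) by ring.
have := ler_wpM2l (mulr_ge0 p0 b_ge0) pM; lra.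
Qed.

(* [P] are the processed, [A] the active and [U] the unexplored vertices. Non-bad pairs have
   at most [g] common neighbours, so an active vertex keeps at least [m] unexplored ones. *)
Lemma reach_lower_invariant k P A U : [disjoint A & U] -> [disjoint P & U] ->
  [disjoint P & A] -> {in P :|: A &, forall u v, u != v -> ~~ bad u v} ->
  (forall w, w \notin U -> w = v0 \/ exists2 x, x \in P & e x w) ->
  (#|P| + k <= K)%N ->
  1 - q ^+ #|A| - p * (#|U :&: bad_set (P :|: A)|%:R + 4 * k%:R * b) <=
  Pr p (fun S => (k <= #|reach e A (S :&: U)|)%N).
Proof.
have /andP[p0 p1] := p01; have /andP[q0 q1] := q01; have b0 := b_ge0.
elim: k P A U => [|k IH] P A U dAU dPU dPA good cover cP.
  rewrite (_ : Pr _ _ = 1); last exact: Ex_cst.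
  have : 0 <= q ^+ #|A| by rewrite exprn_ge0.
  have : 0 <= p * (#|U :&: bad_set (P :|: A)|%:R + 4 * 0 * b).
    by rewrite mulr_ge0 // addr_ge0 // mulr0 mul0r.
  by lra.
have [A0|[a aA]] := set_0Vmem A.
  apply: le_trans (Pr_ge0 _ p01); rewrite A0 cards0 expr0 subrr sub0r oppr_le0.
  by rewrite mulr_ge0 // addr_ge0 // mulr_ge0 // mulr_ge0.
rewrite (Ex_reach_step _ aA dAU); set M := U :&: nb e a; set U' := U :\: nb e a.
set D := P :|: A; pose X S := S :&: M.
have Mle : p * #|M|%:R <= 2.
  apply: le_trans pd; rewrite ler_wpM2l // ler_nat -(reg a).
  by apply: subset_leq_card; exact: subsetIr.
(* A neighbour of [a] that is no longer unexplored is [v0], which costs the 1 in [m], or a neighbour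
   of one of at most K processed vertices, each sharing at most g neighbours with [a]. *)
have Mge : m <= #|M|%:R.
  have sub : nb e a \subset M :|: (v0 |: \bigcup_(x in P) (nb e a :&: nb e x)).
    apply/subsetP => w wa; rewrite !inE; have wa' : e a w by rewrite inE in wa.
    rewrite wa' andbT; case: (boolP (w \in U)) => //= wU.
    case: (cover w wU) => [->|[x xP xw]]; first by rewrite eqxx.
    by apply/orP; right; apply/bigcupP; exists x; rewrite // !inE wa' xw.
  have := subset_leq_card sub; rewrite {1}/nb reg => h.
  have {}h : (d <= #|M| + (1 + \sum_(x in P) #|nb e a :&: nb e x|))%N.
    apply: (leq_trans h); rewrite (leq_trans (leq_card_setU _ _)) // leq_add2l.
    rewrite (leq_trans (leq_card_setU _ _)) // cards1 leq_add2l.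
    elim/big_rec2: _ => [|x B n _ hB]; first by rewrite cards0.
    by rewrite (leq_trans (leq_card_setU _ _)) // leq_add2l.
  have : (\sum_(x in P) #|nb e a :&: nb e x|)%:R <= K%:R * g.
    rewrite natr_sum; apply: le_trans (_ : \sum_(x in P) g <= _).
      apply: ler_sum => x xP; apply: good_codeg.
        by apply: contraTneq xP => <-; rewrite (disjointFl dPA aA).
      apply: good; rewrite ?inE ?aA ?xP ?orbT //.
      by apply: contraTneq xP => <-; rewrite (disjointFl dPA aA).
    rewrite sumr_const -(mulr_natl g) ler_wpM2r // ler_nat.
    by apply: leq_trans cP; exact: leq_addr.
  move: h; move: (\sum_(x in P) _)%N => s + hs; rewrite -(ler_nat R) !natrD.
  move: hs mE; set y := K%:R * g; lra.
(* Subtracting the indicator of a bad batch makes the inequality trivial for such batches; for all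
   others the induction hypothesis applies. *)
have step S1 : 1 - q ^+ #|A :\ a| * q ^+ #|X S1|
     - p * (#|U' :&: bad_set D|%:R + b * #|X S1|%:R + 4 * k%:R * b)
     - (bad_batch D (X S1))%:R <=
   Pr p (fun S2 => (k <= #|reach e (A :\ a :|: X S1) (S2 :&: U')|)%N).
  case: (boolP (bad_batch D (X S1))) => [_|].
    apply: le_trans (Pr_ge0 _ p01).
    have : 0 <= q ^+ #|A :\ a| * q ^+ #|X S1| by rewrite mulr_ge0 // exprn_ge0.
    have : 0 <= p * (#|U' :&: bad_set D|%:R + b * #|X S1|%:R + 4 * k%:R * b).
      by rewrite mulr_ge0 // !addr_ge0 // mulr_ge0 // mulr_ge0.
    by rewrite [true%:R]mulr1n; lra.
  rewrite negb_or negbK [false%:R]mulr0n => /andP[XD /existsPn Xpair].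
  have XM x : x \in X S1 -> x \in U /\ e a x.
    by rewrite /X !inE => /and3P[_ -> ->].
  have DX : (a |: P) :|: (A :\ a :|: X S1) = D :|: X S1.
    apply/setP => u; rewrite !inE; have [->|ua] := eqVneq u a; first by rewrite aA orbT.
    by rewrite /= !orbA.
  have aX : a \notin X S1.
    by apply/negP => /XM[aU _]; rewrite (disjointFr dAU aA) in aU.
  have := IH (a |: P) (A :\ a :|: X S1) U'.
  rewrite DX.
  have -> : #|A :\ a :|: X S1| = (#|A :\ a| + #|X S1|)%N.
    rewrite cardsU (_ : (A :\ a) :&: _ = set0) ?cards0 ?subn0 //.
    apply/setP => u; rewrite in_setI in_set0; apply/negP => /andP[].
    by rewrite !inE => /andP[_ uA] /and3P[_ uU _]; rewrite (disjointFr dAU uA) in uU.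
  rewrite exprD => H; rewrite subr0.
  have {H}H := H _ _ _ _ _ _; apply: le_trans (H _ _ _ _ _ _).
  - rewrite lerD2l lerN2 ler_wpM2l // lerD2r; exact: card_bad_setU.
  - rewrite disjoints_subset; apply/subsetP => u; rewrite !inE.
    case/orP=> [/andP[_ uA]|/and3P[_ _ ->]] //.
    by rewrite (disjointFr dAU uA) andbF.
  - rewrite disjoints_subset; apply/subsetP => u; rewrite !inE.
    case/predU1P=> [->|uP]; first by rewrite (disjointFr dAU aA) andbF.
    by rewrite (disjointFr dPU uP) andbF.
  - rewrite disjoints_subset; apply/subsetP => u; rewrite !inE.
    case/predU1P=> [->|uP].
      by rewrite eqxx /= (disjointFr dAU aA) /= andbF.
    by rewrite (disjointFr dPA uP) (disjointFr dPU uP) /= !andbF.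
  - have cross x y : x \in D -> y \in X S1 -> ~~ bad x y.
      move=> xD yX; apply: contraTN yX => xy.
      by rewrite (disjointFl XD) // inE; apply/existsP; exists x; rewrite xD.
    move=> u v; rewrite !in_setU -!in_setU => uDX vDX uv.
    move: uDX vDX; rewrite in_setU [v \in _]in_setU => /orP[uD|uX] /orP[vD|vX].
    + exact: good.
    + exact: cross.
    + by rewrite bad_sym; exact: cross.
    + have := Xpair u; rewrite uX /= => /existsPn/(_ v).
      by rewrite vX uv.
  - move=> w; rewrite !inE negb_and negbK => /orP[aw|wU].
      by right; exists a; rewrite ?inE ?eqxx.
    by case: (cover w wU) => [|[x xP xw]]; [left|right; exists x; rewrite ?inE ?xP ?orbT].
  - by rewrite (leq_trans _ cP) // cardsU1 (disjointFl dPA aA) add1n addSnnS.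
apply: le_trans (Ex_le p01 step).
(* Averaging over the batch turns q^|X| into (p q + 1 - p)^|M| <= q. The error grows by 4 p b per
   step: 2 p b for bad pairs inside the batch and 2 p b for new vertices entering the bad set, as p
   |M| <= 2. Bad vertices of [M] leave the unexplored set and are charged once. *)
rewrite !ExB !Ex_cst !ExZ !ExD !Ex_cst ExZ Ex_pow_card Ex_cardI.
have Pb := Pr_bad_batch D Mle; rewrite /Pr -/(X _) in Pb.
have qM := qE Mge.
have := ler_wpM2l (exprn_ge0 #|A :\ a| q0) qM.
have -> : q ^+ #|A| = q ^+ #|A :\ a| * q by rewrite (cardsD1 a A) aA add1n exprSr.
have UE : #|U :&: bad_set D|%:R = #|U' :&: bad_set D|%:R + #|M :&: bad_set D|%:R :> R.
  rewrite -natrD addnC -(cardsID (nb e a)); congr (_ + _)%:R; apply: eq_card => u;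
    rewrite !inE; by case: (u \in U); case: (e a u); rewrite /= ?andbT ?andbF.
have pbM := ler_wpM2l (mulr_ge0 p0 b0) Mle.
rewrite UE -natr1; lra.
Qed.

Lemma reach_lower :
  1 - q - p * ((1 + 4 * K%:R) * b) <=
  Pr p (fun S => (K <= #|reach e [set v0] (S :&: [set~ v0])|)%N).
Proof.
have /andP[p0 p1] := p01; have b0 := b_ge0.
apply: le_trans (@reach_lower_invariant K set0 [set v0] [set~ v0] _ _ _ _ _ _).
- rewrite cards1 expr1 set0U lerD2l lerN2 ler_wpM2l // [leRHS]mulrDl mul1r lerD2r.
  apply: le_trans (bad_card v0); rewrite ler_nat subset_leq_card //.
  apply/subsetP => w; rewrite !inE => /andP[_ /existsP[x /andP[]]].
  by rewrite inE => /eqP ->.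
- by rewrite disjoints_subset setCK.
- by rewrite disjoints_subset sub0set.
- by rewrite disjoints_subset sub0set.
- by move=> u v; rewrite set0U !inE => /eqP -> /eqP ->; rewrite eqxx.
- by move=> w; rewrite !inE negbK => /eqP; left.
- by rewrite cards0.
Qed.

End Lower.
End Exploration.

(** * Short cycles, degrees and component counts *)

Section Walks.
Variables (R : realType) (T : finType) (e : rel T).
Hypothesis symE : symmetric e.

Definition walk_op (h : T -> R) (u : T) : R := \sum_w (e u w)%:R * h w.

Lemma walk_op_adj (f h : T -> R) :
  \sum_u f u * walk_op h u = \sum_u walk_op f u * h u.
Proof.
rewrite /walk_op; under eq_bigr do rewrite mulr_sumr.
under [RHS]eq_bigr do rewrite mulr_suml; rewrite exchange_big.
apply: eq_bigr => u _; apply: eq_bigr => w _; rewrite symE; ring.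
Qed.

Lemma iter_walk_op_adj r (f h : T -> R) :
  \sum_u f u * iter r walk_op h u = \sum_u iter r walk_op f u * h u.
Proof.
elim: r f h => //= r IH f h; rewrite walk_op_adj IH; apply: eq_bigr => u _.
by rewrite -iterSr.
Qed.

Lemma walk_countS r (h : T -> R) u :
  \sum_(c : r.+1.-tuple T) (path e u c)%:R * h (last u c) =
  \sum_w (e u w)%:R * \sum_(c : r.-tuple T) (path e w c)%:R * h (last w c).
Proof.
under [RHS]eq_bigr do rewrite mulr_sumr.
rewrite pair_big /= (reindex (fun x : T * r.-tuple T => [tuple of x.1 :: x.2])) /=.
  by apply: eq_bigr => -[w c] _ /=; rewrite -mulnb natrM mulrA.
exists (fun c : r.+1.-tuple T => (thead c, [tuple of behead c])) => [[w c] _|c _] /=.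
  by rewrite theadE; congr (_, _); apply: val_inj.
by rewrite [c in RHS]tuple_eta; apply: val_inj.
Qed.

Lemma walk_countE r (h : T -> R) u :
  \sum_(c : r.-tuple T) (path e u c)%:R * h (last u c) = iter r walk_op h u.
Proof.
elim: r u => [|r IH] u.
  rewrite (bigD1 [tuple]) //= mul1r big1 ?addr0 // => c; by rewrite tuple0.
by rewrite walk_countS /= /walk_op; apply: eq_bigr => w _; rewrite IH.
Qed.

Variables (d : nat) (lambda : R).
Hypothesis reg : regular e d.
Hypotheses (l0 : 0 <= lambda) (d0 : (0 < d)%N).
Hypothesis mix : forall f g : T -> R,
  `| \sum_u \sum_v (e u v)%:R * f u * g v
     - d%:R / #|T|%:R * (\sum_u f u) * (\sum_v g v) | <=
  lambda * (Num.sqrt (\sum_u f u ^+ 2) * Num.sqrt (\sum_v g v ^+ 2)).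

Lemma sum_adj u : \sum_w (e u w)%:R = d%:R :> R.
Proof.
rewrite -(reg u) -sum1_card natr_sum [RHS]big_mkcond /=.
by apply: eq_bigr => w _; rewrite inE; case: (e u w).
Qed.

Lemma sum_walk_op (f : T -> R) : \sum_u walk_op f u = d%:R * \sum_u f u.
Proof.
rewrite /walk_op exchange_big mulr_sumr; apply: eq_bigr => w _ /=.
by rewrite -mulr_suml; under eq_bigr do rewrite symE; rewrite sum_adj.
Qed.

Lemma walk_op_le (f : T -> R) M : (forall u, f u <= M) -> forall u, walk_op f u <= d%:R * M.
Proof.
move=> fM u; rewrite -(sum_adj u) mulr_suml; apply: ler_sum => w _.
by rewrite ler_wpM2l.
Qed.

Lemma walk_op_ge0 (f : T -> R) : (forall u, 0 <= f u) -> forall u, 0 <= walk_op f u.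
Proof. by move=> f0 u; apply: sumr_ge0 => w _; rewrite mulr_ge0. Qed.

(** The closed walks have length r + 3. They form the adjacency form applied to [f], the counts of
    (r+1)-step walks from [u], and [h], the neighbourhood of [u]. Mixing gives the main term; in the
    error, |f|^2 <= max f * sum f <= d^r d^(r+1) and |h|^2 = d. *)
Lemma closed_walks_le r u :
  \sum_(c : r.+2.-tuple T) (path e u c)%:R * (e (last u c) u)%:R <=
  d%:R ^+ r.+2 * (d%:R / #|T|%:R + lambda / d%:R) :> R.
Proof.
have dn0 : (d%:R : R) != 0 by rewrite pnatr_eq0 -lt0n.
have Tn0 : (#|T|%:R : R) != 0 by rewrite pnatr_eq0 -lt0n; apply/card_gt0P; exists u.
pose h w : R := (e w u)%:R; pose i w : R := (w == u)%:R.
rewrite (walk_countE r.+2 h).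
pose f := iter r.+1 walk_op i.
have -> : iter r.+2 walk_op h u = \sum_v \sum_w (e v w)%:R * f v * h w.
  transitivity (\sum_v i v * iter r.+1 walk_op (walk_op h) v).
    rewrite (bigD1 u) //= /i eqxx mul1r big1 ?addr0 => [|v /negPf ->]; last by rewrite mul0r.
    by rewrite -iterSr.
  rewrite iter_walk_op_adj; apply: eq_bigr => v _; rewrite mulr_sumr.
  by apply: eq_bigr => w _; rewrite -/f; ring.
have i0 v : 0 <= i v by [].
have sumi : \sum_v i v = 1.
  by rewrite (bigD1 u) //= /i eqxx big1 ?addr0 // => v /negPf ->.
have fb m : [/\ forall v, 0 <= iter m.+1 walk_op i v,
    \sum_v iter m.+1 walk_op i v = d%:R ^+ m.+1 &
    forall v, iter m.+1 walk_op i v <= d%:R ^+ m].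
  elim: m => [|m [h0 hs hm]]; split.
  - exact: walk_op_ge0.
  - by rewrite /= sum_walk_op sumi mulr1.
  - move=> v; rewrite /= /walk_op (bigD1 u) //= /i eqxx mulr1 big1 ?addr0.
      by case: (e v u).
    by move=> w /negPf ->; rewrite mulr0.
  - by move=> v; rewrite iterS; exact: walk_op_ge0.
  - by rewrite iterS sum_walk_op hs -exprS.
  - by move=> v; rewrite iterS exprS; exact: walk_op_le.
have [f0 fs fm] := fb r; rewrite -/f in f0 fs fm.
have hs : \sum_w h w = d%:R by rewrite -(sum_adj u); apply: eq_bigr => w _; rewrite /h symE.
have h2 : \sum_w h w ^+ 2 = d%:R.
  by rewrite -hs; apply: eq_bigr => w _; rewrite /h; case: (e w u); rewrite ?expr1n ?expr0n.
have f2 : \sum_v f v ^+ 2 <= d%:R ^+ r * d%:R ^+ r.+1.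
  rewrite -fs mulr_sumr; apply: ler_sum => v _; rewrite expr2 ler_wpM2r //.
have := mix f h; rewrite fs hs h2 => /ler_normlP[_].
rewrite lerBlDr => /le_trans; apply.
have -> : d%:R ^+ r.+2 * (d%:R / #|T|%:R + lambda / d%:R) =
   lambda * d%:R ^+ r.+1 + d%:R / #|T|%:R * d%:R ^+ r.+1 * d%:R.
  by rewrite !exprS; field; rewrite dn0 Tn0.
rewrite lerD2r ler_wpM2l // -sqrtrM; last by apply: sumr_ge0 => v _; exact: sqr_ge0.
have -> : d%:R ^+ r.+1 = Num.sqrt ((d%:R ^+ r.+1) ^+ 2) :> R.
  by rewrite sqrtr_sqr ger0_norm // exprn_ge0.
apply: ler_wsqrtr; apply: le_trans (ler_wpM2r (ler0n _ _) f2) _.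
by rewrite -mulrA -exprSr -exprD -exprM; rewrite le_eqVlt; apply/orP; left; apply/eqP; congr (_ ^+ _); lia.
Qed.

End Walks.

Section Counting.
Variables (R : realType) (T : finType) (e : rel T).
Hypotheses (symE : symmetric e) (irrE : irreflexive e).
Implicit Types (S C : {set T}).

Lemma induced_sym S : symmetric (induced e S).
Proof. by move=> u v; rewrite /induced /= symE andbCA. Qed.

Lemma component_id S v : v \in S -> v \in component e S v.
Proof. by move=> vS; rewrite inE vS connect0. Qed.

Lemma component_sub S v : component e S v \subset S.
Proof. by apply/subsetP => u; rewrite inE => /andP[]. Qed.

Lemma component_eq S v w : w \in component e S v -> component e S w = component e S v.
Proof.
rewrite inE => /andP[wS vw]; apply/setP => u; rewrite !inE.
by rewrite -(same_connect (sym_connect_sym (@induced_sym S)) vw).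
Qed.

Lemma component_next S v u w : u \in component e S v -> w \in S -> e u w ->
  w \in component e S v.
Proof.
rewrite !inE => /andP[uS vu] wS uw; rewrite wS.
by apply: connect_trans vu (connect1 _); rewrite /induced /= uS wS.
Qed.

Lemma component_closed S v C : v \in C ->
  (forall u w, u \in C -> w \in S -> e u w -> w \in C) -> component e S v \subset C.
Proof.
move=> vC hC; apply/subsetP => u; rewrite inE => /andP[_].
by apply: (connect_closed (P := mem C)) => // x y /= xC /and3P[_ yS xy]; exact: hC xy.
Qed.

Lemma component_mono S S' v : S \subset S' -> component e S v \subset component e S' v.
Proof.
move=> SS; apply/subsetP => u; rewrite !inE => /andP[uS vu].
by rewrite (subsetP SS) //= (induced_mono SS).
Qed.

(** The count is over vertices, not components, so that its expectation is a sum over single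
    vertices. *)
Definition ncomp (Q : pred {set T}) S : nat := #|[set v in S | Q (component e S v)]|.

Lemma card_component_preim S w k :
  (#|[set v in S | (w \in component e S v) && (#|component e S v| <= k)]| <= k)%N.
Proof.
set V := [set v in S | _]; have [->|[v vV]] := set_0Vmem V; first by rewrite cards0.
move: (vV); rewrite inE => /and3P[vS wv ck]; apply: leq_trans ck.
apply: subset_leq_card; apply/subsetP => u; rewrite inE => /and3P[uS wu _].
by rewrite -(component_eq wv) (component_eq wu) component_id.
Qed.

(** Only components adjacent to [v] change. A gain lies in the new component of [v], which matters
    only if it has at most k vertices; a loss lies in one of at most M old components of at most k
    vertices. *)
Lemma ncomp_lipschitz (Q : pred {set T}) k M S v : (forall C, Q C -> (#|C| <= k)%N) ->
  v \notin S -> (#|nb e v :&: S| <= M)%N ->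
  (ncomp Q (v |: S) <= ncomp Q S + k)%N /\ (ncomp Q S <= ncomp Q (v |: S) + M * k)%N.
Proof.
move=> Qk vS degv.
have same u : u \in S -> [disjoint component e S u & nb e v] ->
    component e (v |: S) u = component e S u.
  move=> uS dis; apply/eqP; rewrite eqEsubset; apply/andP; split; last first.
    by apply: component_mono; rewrite subsetUr.
  apply: component_closed; first exact: component_id.
  move=> x y xC; rewrite in_setU1 => /predU1P[->|yS] xy; last exact: component_next xy.
  by have := disjointFr dis xC; rewrite inE symE xy.
have touch u : u \in S -> ~~ [disjoint component e S u & nb e v] ->
    v \in component e (v |: S) u.
  move=> uS; rewrite -setI_eq0 => /set0Pn[x]; rewrite in_setI [x \in nb _ _]inE => /andP[xC vx].
  apply: (component_next (u := x)); rewrite ?setU11 // 1?symE //.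
  by apply: (subsetP (component_mono _ _)) xC; rewrite subsetUr.
split.
  pose W := [set u in v |: S | (v \in component e (v |: S) u) &&
                         (#|component e (v |: S) u| <= k)%N].
  rewrite (leq_trans _ (_ : #|[set u in S | Q (component e S u)]| + #|W| <= _)%N) //; last first.
    by rewrite leq_add2l; exact: card_component_preim.
  rewrite (leq_trans _ (leq_card_setU _ _)) // subset_leq_card //; apply/subsetP => u.
  rewrite inE => /andP[uvS Qu]; rewrite in_setU.
  case: (boolP (v \in component e (v |: S) u)) => vu.
    by apply/orP; right; rewrite inE uvS vu Qk.
  have uS : u \in S.
    by move: uvS; rewrite in_setU1 => /predU1P[uv|//]; rewrite uv component_id ?setU11 in vu.
  apply/orP; left; rewrite inE uS /= -same //.
  by apply: contraNT vu; exact: touch.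
pose W w := [set u in S | (w \in component e S u) && (#|component e S u| <= k)%N].
rewrite (leq_trans _ (_ : #|[set u in v |: S | Q (component e (v |: S) u)]| +
    \sum_(w in nb e v :&: S) #|W w| <= _)%N) //; last first.
  rewrite leq_add2l (@leq_trans (\sum_(w in nb e v :&: S) k)) //.
    by apply: leq_sum => w _; exact: card_component_preim.
  by rewrite sum_nat_const leq_mul2r degv orbT.
apply: (@leq_trans #|[set u in v |: S | Q (component e (v |: S) u)] :|:
   \bigcup_(w in nb e v :&: S) W w|).
  apply: subset_leq_card; apply/subsetP => u.
  rewrite inE => /andP[uS Qu]; rewrite in_setU.
  case: (boolP [disjoint component e S u & nb e v]) => dis.
    by apply/orP; left; rewrite inE in_setU1 uS orbT same.
  apply/orP; right; move: dis; rewrite -setI_eq0 => /set0Pn[x].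
  rewrite in_setI => /andP[xC xv]; apply/bigcupP; exists x.
    by rewrite in_setI xv (subsetP (component_sub _ _) _ xC).
  by rewrite inE uS xC Qk.
rewrite (leq_trans (leq_card_setU _ _)) // leq_add2l.
elim/big_rec2: _ => [|x B n _ hB]; first by rewrite cards0.
by rewrite (leq_trans (leq_card_setU _ _)) // leq_add2l.
Qed.

Definition max_deg (M : nat) S := [forall u in S, #|nb e u :&: S| <= M]%N.

Lemma max_deg0 M : max_deg M set0.
Proof. by apply/forall_inP => u; rewrite inE. Qed.

Lemma max_deg_down M v S : max_deg M (v |: S) -> max_deg M S.
Proof.
move/forall_inP => h; apply/forall_inP => u uS.
apply: leq_trans (h u _); last by rewrite in_setU1 uS orbT.
by rewrite subset_leq_card // setIS // subsetUr.
Qed.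

Lemma ncomp_max_deg_lipschitz (Q : pred {set T}) k M v S : (forall C, Q C -> (#|C| <= k)%N) ->
  v \notin S -> max_deg M (v |: S) ->
  `|(ncomp Q (v |: S))%:R - (ncomp Q S)%:R| <= (M.+1 * k)%:R :> R.
Proof.
move=> Qk vS /forall_inP /(_ v); rewrite setU11 => /(_ isT) deg.
have deg' : (#|nb e v :&: S| <= M)%N.
  by apply: leq_trans deg; rewrite subset_leq_card // setIS // subsetUr.
have [h1 h2] := ncomp_lipschitz Qk vS deg'.
have -> : (M.+1 * k)%:R = M%:R * k%:R + k%:R :> R by rewrite mulSn natrD natrM addrC.
move: h1 h2; rewrite -!(ler_nat R) !natrD natrM ler_norml => h1 h2.
have k0 : 0 <= k%:R :> R by [].
have Mk0 : 0 <= M%:R * k%:R :> R by [].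
by apply/andP; split; lra.
Qed.

Variables (d : nat) (p : R).
Hypotheses (reg : regular e d) (p01 : 0 <= p <= 1).

(** First moment of the retained stars with M + 1 leaves. *)
Lemma Pr_max_deg M :
  Pr p (fun S => ~~ max_deg M S) <=
  #|T|%:R * p * ((p * d%:R) ^+ M.+1 / M.+1`!%:R).
Proof.
have /andP[p0 p1] := p01.
pose B u := [set C : {set T} | (C \subset nb e u) && (#|C| == M.+1)].
have cB u : #|B u| = 'C(d, M.+1) by rewrite cards_draws /nb reg.
apply: le_trans (_ : Ex p (fun S => \sum_u \sum_(C in B u) ((u |: C) \subset S)%:R) <= _).
  apply: Ex_le => // S; case: (boolP (max_deg M S)) => /= [_|].
    by apply: sumr_ge0 => u _; apply: sumr_ge0.
  rewrite negb_forall => /existsP[u]; rewrite negb_imply -ltnNge => /andP[uS deg].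
  have [C] : exists C, C \in [set C : {set T} | (C \subset nb e u :&: S) && (#|C| == M.+1)].
    by apply/card_gt0P; rewrite cards_draws bin_gt0.
  rewrite inE subsetI => /andP[/andP[Cu CS] cC].
  rewrite (bigD1 u) //= (bigD1 C) /=; last by rewrite inE Cu.
  rewrite subUset sub1set uS CS -addrA lerDl addr_ge0 //; first exact: sumr_ge0.
  by apply: sumr_ge0 => w _; apply: sumr_ge0.
rewrite Ex_sum; under eq_bigr do rewrite Ex_sum.
apply: le_trans (_ : \sum_(u : T) 'C(d, M.+1)%:R * p ^+ M.+2 <= _).
  apply: ler_sum => u _; rewrite -(cB u) mulrC mulr_natr -sumr_const.
  apply: ler_sum => C; rewrite inE => /andP[/subsetP Cu /eqP cC].
  rewrite [leLHS](Pr_sub p (u |: C)) cardsU1 cC (_ : u \notin C) //.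
  by apply/negP => /Cu; rewrite inE irrE.
rewrite sumr_const -(mulr_natl (_ * _)) -mulrA ler_wpM2l //.
have f0 : 0 < M.+1`!%:R :> R by rewrite ltr0n fact_gt0.
rewrite exprMn [p ^+ M.+2]exprS.
have : 'C(d, M.+1)%:R <= d%:R ^+ M.+1 / M.+1`!%:R :> R.
  rewrite ler_pdivlMr // -natrM bin_ffact -natrX ler_nat.
  elim: (M.+1) => // j IH; rewrite ffactnSr expnSr leq_mul // leq_subr //.
move/(ler_wpM2r (mulr_ge0 p0 (exprn_ge0 M.+1 p0))); lra.
Qed.

Definition cyclic_small k S :=
  ncomp (fun C => (#|C| <= k)%N && ~~ `[< acyclic_in e C >]) S.

(** Each counted vertex is charged to a cycle u :: c in its component, and a cycle receives at most
    k charges. The cycle has r + 3 vertices, hence the range r < k - 2. *)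
Lemma cyclic_small_le k S : ((cyclic_small k S)%:R : R) <=
  k%:R * \sum_(r < k - 2) \sum_u \sum_(c : r.+2.-tuple T)
    (ucycleb e (u :: c) && ([set x in u :: c] \subset S))%:R.
Proof.
pose W u := [set v in S | (u \in component e S v) && (#|component e S v| <= k)%N].
pose I (r : 'I_(k - 2)) u (c : r.+2.-tuple T) : nat :=
  (ucycleb e (u :: c) && ([set x in u :: c] \subset S)).
rewrite (_ : \sum_(r < k - 2) _ = (\sum_(r < k - 2) \sum_u \sum_(c : r.+2.-tuple T) I r u c)%:R :> R); last first.
  rewrite natr_sum; apply: eq_bigr => r _; rewrite natr_sum.
  by apply: eq_bigr => u _; rewrite natr_sum.
rewrite -natrM ler_nat.
apply: (@leq_trans (\sum_(r < k - 2) \sum_u \sum_(c : r.+2.-tuple T) I r u c * #|W u|)); last first.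
  rewrite big_distrr /=; apply: leq_sum => r _; rewrite big_distrr /=.
  apply: leq_sum => u _; rewrite big_distrr /=; apply: leq_sum => c _.
  by rewrite mulnC leq_mul2r card_component_preim orbT.
apply: (@leq_trans #|\bigcup_(r < k - 2) \bigcup_u \bigcup_(c : r.+2.-tuple T | I r u c != 0%N) W u|).
  apply: subset_leq_card; apply/subsetP => v; rewrite inE => /and3P[vS ck].
  move/asboolPn => /existsNP[s] /not_implyP[s3] /contrapT us.
  case: s s3 us => // u s s3 /andP[cs us].
  have sC : {subset u :: s <= component e S v}.
    have hC x y : x \in component e S v -> induced e (component e S v) x y -> y \in component e S v.
      by move=> _ /and3P[].
    move: cs; rewrite /= rcons_path => /andP[pu lu].
    have uC : u \in component e S v by case/and3P: lu.
    move=> x; rewrite inE => /predU1P[->//|xs].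
    elim: s u xs pu uC {s3 us lu} => //= y s IH u; rewrite inE.
    move=> /predU1P[->|xs] /andP[uy pu] uC; first exact: hC uy.
    by apply: IH xs pu _; exact: hC uy.
  have sz : (size (u :: s) <= k)%N.
    apply: leq_trans ck; rewrite -(card_uniqP us); apply: subset_leq_card.
    by apply/subsetP => x; exact: sC.
  have rk : ((size s).-2 < k - 2)%N by move: s3 sz; rewrite /=; lia.
  have szs : size s == (size s).-2.+2 by move: s3; rewrite /=; case: (s) => [|? []].
  apply/bigcupP; exists (Ordinal rk) => //; apply/bigcupP; exists u => //.
  apply/bigcupP; exists (Tuple szs) => /=.
    rewrite /I eqb0 negbK /=; apply/andP; split.
      rewrite /ucycleb us andbT; apply: sub_path cs => x y /and3P[] //.
    by apply/subsetP => x; rewrite inE => /sC; exact: (subsetP (component_sub _ _)).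
  by rewrite inE vS ck andbT; apply: sC; rewrite mem_head.
have bigcup_le (J : finType) (P : pred J) (F : J -> {set T}) (b : J -> nat) :
    (forall j, P j -> (#|F j| <= b j)%N) ->
    (#|\bigcup_(j | P j) F j| <= \sum_(j | P j) b j)%N.
  move=> h; elim/big_rec2: _ => [|j B m Pj hB]; first by rewrite cards0.
  by rewrite (leq_trans (leq_card_setU _ _)) // leq_add // h.
apply: (bigcup_le) => r _; apply: (bigcup_le) => u _.
rewrite [leqRHS](bigID (fun c => I r u c == 0%N)) /= [X in (X + _)%N]big1 => [|c /eqP ->//].
rewrite add0n; apply: (bigcup_le) => c; rewrite -lt0n => Ic.
by rewrite leq_pmull.
Qed.

Variable lambda : R.
Hypotheses (l0 : 0 <= lambda) (d0 : (0 < d)%N).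
Hypothesis mix : forall f g : T -> R,
  `| \sum_u \sum_v (e u v)%:R * f u * g v
     - d%:R / #|T|%:R * (\sum_u f u) * (\sum_v g v) | <=
  lambda * (Num.sqrt (\sum_u f u ^+ 2) * Num.sqrt (\sum_v g v ^+ 2)).

(** A cycle on r + 3 vertices survives with probability p^(r+3), so each length contributes at most
    (p d)^(r+3) (1 + N lambda/d), where N = |T|/d. One factor k counts the lengths, the other the
    charges per cycle. *)
Lemma Ex_cyclic_small (c : R) k : p * d%:R <= c -> 1 <= c ->
  Ex p (fun S => (cyclic_small k S)%:R) <=
  k%:R ^+ 2 * c ^+ k * (1 + #|T|%:R / d%:R * (lambda / d%:R)).
Proof.
have /andP[p0 p1] := p01 => pc c1.
have dn0 : (d%:R : R) != 0 by rewrite pnatr_eq0 -lt0n.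
apply: le_trans (Ex_le p01 (cyclic_small_le k)) _.
rewrite ExZ Ex_sum; set Z := 1 + _.
have Z0 : 0 <= Z by rewrite addr_ge0 // mulr_ge0 // divr_ge0.
rewrite expr2 -!mulrA ler_wpM2l //.
apply: le_trans (_ : \sum_(r < k - 2) c ^+ k * Z <= _); last first.
  rewrite sumr_const card_ord -(mulr_natl (_ * _)) ler_wpM2r ?mulr_ge0 ?exprn_ge0 //.
    by rewrite (le_trans _ c1).
  by rewrite ler_nat leq_subr.
apply: ler_sum => r _; rewrite Ex_sum.
apply: le_trans (_ : \sum_(u : T) p ^+ r.+3 * (d%:R ^+ r.+2 * (d%:R / #|T|%:R + lambda / d%:R)) <= _).
  apply: ler_sum => u _.
  apply: le_trans (ler_wpM2l (exprn_ge0 _ p0) (closed_walks_le symE reg l0 d0 mix r u)).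
  rewrite Ex_sum mulr_sumr; apply: ler_sum => s _.
  case: (boolP (ucycleb e (u :: s))) => us; last first.
    rewrite (@eq_Ex _ _ p _ (fun=> 0)) // Ex_cst; apply: mulr_ge0 => //.
    exact: exprn_ge0.
  move: us => /andP[cs us].
  rewrite [leLHS](Pr_sub p [set x in u :: s]) cardsE (card_uniqP us) /= size_tuple.
  move: cs; rewrite /= rcons_path => /andP[-> ->].
  by rewrite !mulr1.
rewrite sumr_const -(mulr_natl (_ * _)).
have [T0|T0] := eqVneq (#|T|%:R : R) 0.
  by rewrite T0 mul0r mulr_ge0 // exprn_ge0 // (le_trans _ c1).
have -> : #|T|%:R * (p ^+ r.+3 * (d%:R ^+ r.+2 * (d%:R / #|T|%:R + lambda / d%:R))) =
   (p * d%:R) ^+ r.+3 * Z.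
  rewrite exprMn [d%:R ^+ r.+3]exprS /Z; field; by rewrite T0 dn0.
rewrite ler_wpM2r //; apply: le_trans (_ : c ^+ r.+3 <= _).
  by rewrite lerXn2r // nnegrE ?mulr_ge0 // (le_trans _ c1).
by rewrite ler_weXn2l //; have := ltn_ord r; lia.
Qed.

(** Measures the edge ends lost when the number of neighbours in [S] is capped at M at every vertex.
    It is a single Lipschitz function of [S], so it concentrates. *)
Definition excess (M : R) S : R := \sum_w Num.max 0 (#|nb e w :&: S|%:R - M).

Lemma excess_lipschitz M : lipschitz d%:R (excess M).
Proof.
move=> v S vS; rewrite /excess -sumrB.
apply: le_trans (ler_norm_sum _ _ _) _.
apply: le_trans (_ : \sum_w (e v w)%:R <= _); last by rewrite (sum_adj R reg).
apply: ler_sum => w _; case: (boolP (e v w)) => vw.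
  have c1 : (#|nb e w :&: S| <= #|nb e w :&: (v |: S)|)%N.
    by rewrite subset_leq_card // setIS // subsetUr.
  have c2 : (#|nb e w :&: (v |: S)| <= #|nb e w :&: S| + 1)%N.
    rewrite (leq_trans (_ : _ <= #|v |: (nb e w :&: S)|)%N) //.
      by apply: subset_leq_card; apply/subsetP => x; rewrite !inE; case: (x == v); rewrite ?andbT.
    by rewrite cardsU1 addnC leq_add2l leq_b1.
  move: c1 c2; rewrite -!(ler_nat R) natrD ler_norml.
  move: (#|_ :&: (v |: S)|%:R : R) (#|_ :&: S|%:R : R) => x y xy yx.
  rewrite [true%:R]mulr1n !maxEle.
  by case: (leP 0 (x - M)) => ?; case: (leP 0 (y - M)) => ?; apply/andP; split; lra.
rewrite (_ : nb e w :&: (v |: S) = nb e w :&: S) ?subrr ?normr0 //.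
apply/setP => x; rewrite !inE; have [->|//] := eqVneq x v.
by rewrite symE (negPf vw).
Qed.

(** Uses max(0, y - M) <= y^2 / (4 M) and the second moment, at most 2^2 + 2, of a binomial variable
    of mean at most 2. *)
Lemma Ex_excess (M : R) : 0 < M -> p * d%:R <= 2 ->
  Ex p (excess M) <= #|T|%:R * (2 / M).
Proof.
have /andP[p0 p1] := p01 => M0 pd2.
rewrite /excess Ex_sum; apply: le_trans (_ : \sum_(w : T) 2 / M <= _); last first.
  by rewrite sumr_const -(mulr_natl (_ / _)).
apply: ler_sum => w _.
apply: le_trans (_ : Ex p (fun S => (4 * M)^-1 * #|S :&: nb e w|%:R ^+ 2) <= _).
  apply: Ex_le => // S; rewrite setIC; set x : R := #|_ :&: _|%:R.
  rewrite mulrC ler_pdivlMr ?mulr_gt0 // maxEle.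
  case: (leP 0 (x - M)) => h.
    by have := sqr_ge0 (x - 2 * M); lra.
  by rewrite mul0r sqr_ge0.
rewrite ExZ; have := Ex_cardI_sqr (nb e w) p01; rewrite {2 3}/nb reg => h.
have pd0 : 0 <= p * d%:R by rewrite mulr_ge0.
have : (p * d%:R) ^+ 2 <= 2 ^+ 2 by rewrite lerXn2r // nnegrE.
move=> h2; rewrite mulrC ler_pdivrMr ?mulr_gt0 // (_ : 2 / M * (4 * M) = 8); last first.
  by field; rewrite lt0r_neq0.
lra.
Qed.

Definition nbs (A : {set T}) : {set T} := \bigcup_(a in A) nb e a.

(** Double counting of the edges at [A]: a vertex of [nbs A] receives at most M of them plus its
    excess over [S]. A bound on one quantity, [excess M S], thus yields expansion of all subsets of
    [S] at once, without a union bound over them. *)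
Lemma card_nbs (M : R) (A S : {set T}) : 0 <= M -> A \subset S ->
  d%:R * #|A|%:R <= M * #|nbs A|%:R + excess M S.
Proof.
move=> M0 AS.
have -> : d%:R * #|A|%:R = \sum_w #|nb e w :&: A|%:R :> R.
  transitivity (\sum_w \sum_(a in A) (e a w)%:R : R).
    rewrite exchange_big /= (eq_bigr (fun=> d%:R)) ?sumr_const ?mulr_natr // => a _.
    exact: sum_adj.
  apply: eq_bigr => w _; rewrite -sum1_card natr_sum [RHS]big_mkcond [LHS]big_mkcond /=.
  by apply: eq_bigr => a _; rewrite !inE symE; case: (e w a); case: (a \in A).
have -> : M * #|nbs A|%:R = \sum_w (w \in nbs A)%:R * M.
  rewrite -mulr_suml mulrC -sum1_card natr_sum [X in X * _ = _]big_mkcond /=.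
  by congr (_ * _); apply: eq_bigr => w _; case: (w \in _).
rewrite /excess -big_split; apply: ler_sum => w _ /=.
have : (#|nb e w :&: A| <= #|nb e w :&: S|)%N by rewrite subset_leq_card // setIS.
rewrite -(ler_nat R) => h.
case: (boolP (w \in nbs A)) => wA.
  by rewrite [true%:R]mulr1n mul1r maxEle; case: (leP 0 (_ - M)) => ?; lra.
rewrite mul0r add0r (_ : nb e w :&: A = set0) ?cards0 ?le_max ?lexx //.
apply/setP => a; rewrite !inE; apply: contraNF wA => /andP[wa aA].
by apply/bigcupP; exists a; rewrite // inE symE.
Qed.

End Counting.

(** * Sprinkling *)

Section Mixing.
Variables (R : realType) (T : finType) (e : rel T) (d : nat) (lambda : R).
Hypotheses (symE : symmetric e) (reg : regular e d).
Hypotheses (l0 : 0 <= lambda) (d0 : (0 < d)%N).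
Hypothesis mix : forall f g : T -> R,
  `| \sum_u \sum_v (e u v)%:R * f u * g v
     - d%:R / #|T|%:R * (\sum_u f u) * (\sum_v g v) | <=
  lambda * (Num.sqrt (\sum_u f u ^+ 2) * Num.sqrt (\sum_v g v ^+ 2)).
Implicit Types (A B S X Y : {set T}).

Let n : R := #|T|%:R.
Let dR : R := d%:R.
Let dR0 : 0 < dR. Proof. by rewrite ltr0n. Qed.

Lemma expander_mixing A B :
  `| \sum_(a in A) #|nb e a :&: B|%:R - dR / n * #|A|%:R * #|B|%:R | <=
  lambda * Num.sqrt (#|A|%:R * #|B|%:R).
Proof.
have indE (C : {set T}) : \sum_u (u \in C)%:R = #|C|%:R :> R.
  by rewrite -sum1_card natr_sum [RHS]big_mkcond; apply: eq_bigr => u _; case: (u \in C).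
have ind2 (C : {set T}) : \sum_u (u \in C)%:R ^+ 2 = #|C|%:R :> R.
  by rewrite -indE; apply: eq_bigr => u _; case: (u \in C); rewrite ?expr1n ?expr0n.
have := mix (fun u => (u \in A)%:R) (fun u => (u \in B)%:R).
rewrite !indE !ind2 -sqrtrM //; congr (`| _ - _ | <= _).
rewrite [RHS]big_mkcond; apply: eq_bigr => u _; case: (u \in A); last first.
  by rewrite big1 // => v _; rewrite mulr0 mul0r.
rewrite -indE; apply: eq_bigr => v _; rewrite !inE mulr1.
by case: (e u v); case: (v \in B); rewrite ?mulr1 ?mulr0 ?mul1r ?mul0r.
Qed.

Lemma sqrt_bound (z a b : R) : 0 <= z -> 0 < a -> 0 <= b ->
  a * z <= b * Num.sqrt z -> a ^+ 2 * z <= b ^+ 2.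
Proof.
move=> z0 a0 b0 h.
have [->|zn] := eqVneq z 0; first by rewrite mulr0 sqr_ge0.
have zp : 0 < z by rewrite lt_def zn.
have : (a * z) ^+ 2 <= (b * Num.sqrt z) ^+ 2.
  by rewrite lerXn2r // nnegrE mulr_ge0 ?sqrtr_ge0 // ltW.
rewrite !exprMn sqr_sqrtr // [z ^+ 2]expr2 mulrA; by rewrite ler_pM2r.
Qed.

(** Mixing between a vertex and its neighbourhood: all d edges are present while at most d/2 are
    expected, so lambda is at least sqrt(d)/2. A small ratio lambda/d therefore forces a large
    degree. *)
Lemma degree_le_lambda : (0 < #|T|)%N -> dR / n <= 1 / 2 -> dR <= 4 * lambda ^+ 2.
Proof.
case/card_gt0P => u _ dn; have := expander_mixing [set u] (nb e u).
rewrite big_set1 setIid cards1 !mulr1 !mul1r {1 2 3}/nb reg -/dR => /ler_normlP[_].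
have := ler_wpM2r (ltW dR0) dn => h1 h2.
have : 1 / 2 * dR <= lambda * Num.sqrt dR by lra.
move/(sqrt_bound (ltW dR0) _ l0) => /(_ _); rewrite expr2 => h; have := h _; lra.
Qed.

(** Mixing between the neighbourhood of [u] and the offending vertices: each of these sends more
    than g d edges into it, at least twice the expected number. *)
Lemma card_bad_pairs (g : R) u : 0 < g -> dR / n <= g / 2 ->
  #|[set v | g * dR < #|nb e u :&: nb e v|%:R]|%:R <=
  4 * (lambda / dR) ^+ 2 * dR / g ^+ 2.
Proof.
move=> g0 dn; set B := [set v | _].
have := expander_mixing B (nb e u); rewrite {2 3}/nb reg -/dR => /ler_normlP[_].
have lower : g * dR * #|B|%:R <= \sum_(a in B) #|nb e a :&: nb e u|%:R.
  rewrite mulr_natr -sumr_const; apply: ler_sum => v; rewrite inE setIC; exact: ltW.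
have b0 : 0 <= #|B|%:R :> R by [].
have := ler_wpM2r (mulr_ge0 b0 (ltW dR0)) dn.
move: (#|B|%:R : R) lower b0 => b lower b0 h1 h2.
have : g / 2 * (b * dR) <= lambda * Num.sqrt (b * dR) by lra.
move/(sqrt_bound (mulr_ge0 b0 (ltW dR0)) (divr_gt0 g0 _) l0) => /(_ _) h3.
have {}h3 := h3 (ltr0Sn _ _).
have -> : 4 * (lambda / dR) ^+ 2 * dR / g ^+ 2 = 4 * lambda ^+ 2 / (g ^+ 2 * dR).
  by field; rewrite !lt0r_neq0.
rewrite ler_pdivlMr ?mulr_gt0 ?exprn_gt0 //; move: h3; rewrite exprMn; lra.
Qed.

Lemma card_low_degree X Y : (0 < #|T|)%N ->
  #|[set y in Y | #|nb e y :&: X|%:R < dR / n / 2 * #|X|%:R]|%:R * #|X|%:R <=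
  4 * (lambda / dR) ^+ 2 * n ^+ 2.
Proof.
move=> T0; set Y0 := [set y in Y | _]; have n0 : 0 < n by rewrite ltr0n.
have := expander_mixing Y0 X => /ler_normlP[+ _].
have upper : \sum_(a in Y0) #|nb e a :&: X|%:R <= dR / n / 2 * #|X|%:R * #|Y0|%:R.
  rewrite mulr_natr -sumr_const; apply: ler_sum => v; rewrite inE => /andP[_]; exact: ltW.
have z0 : 0 <= #|Y0|%:R * #|X|%:R :> R by [].
move=> h.
have : dR / n / 2 * (#|Y0|%:R * #|X|%:R) <= lambda * Num.sqrt (#|Y0|%:R * #|X|%:R).
  by move: h upper; set s := Num.sqrt _; lra.
move/(sqrt_bound z0) => /(_ _ l0) h3.
have {}h3 := h3 (divr_gt0 (divr_gt0 dR0 n0) (ltr0Sn _ _)).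
have -> : 4 * (lambda / dR) ^+ 2 * n ^+ 2 = lambda ^+ 2 / (dR / n / 2) ^+ 2.
  by field; rewrite !lt0r_neq0.
by rewrite ler_pdivlMr ?exprn_gt0 ?divr_gt0 // mulrC.
Qed.

Lemma nbs_lipschitz X Y : lipschitz (d%:R : R) (fun S => #|nbs e (S :&: X) :&: Y|%:R).
Proof.
move=> v S vS.
have sub : nbs e (S :&: X) :&: Y \subset nbs e ((v |: S) :&: X) :&: Y.
  apply: setSI; apply/subsetP => w /bigcupP[a]; rewrite !inE => /andP[aS aX] wa.
  by apply/bigcupP; exists a; rewrite !inE ?aS ?aX ?orbT //; rewrite inE in wa.
have sub' : nbs e ((v |: S) :&: X) :&: Y \subset (nbs e (S :&: X) :&: Y) :|: nb e v.
  apply/subsetP => w; rewrite in_setI => /andP[/bigcupP[a]].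
  rewrite in_setI in_setU1 => /andP[/predU1P[->|aS] aX] wa wY; rewrite in_setU ?wa ?orbT //.
  by apply/orP; left; rewrite in_setI wY andbT; apply/bigcupP; exists a; rewrite // in_setI aS.
have c1 := subset_leq_card sub; have c2 := leq_trans (subset_leq_card sub') (leq_card_setU _ _).
rewrite /nb reg in c2.
move: c1 c2; rewrite -!(ler_nat R) natrD ler_norml => c1 c2; apply/andP; split; last by lra.
by have := ltW dR0; rewrite /dR; lra.
Qed.

Section Connect.
Variables (p xi eta : R) (X Y : {set T}).
Hypotheses (p01 : 0 <= p <= 1) (T0 : (0 < #|T|)%N).
Hypotheses (pd : p * dR = eta) (eta0 : 0 < eta) (xi0 : 0 < xi) (ex : eta * xi <= 1 / 2).
Hypotheses (Xxi : xi * n <= #|X|%:R) (Yxi : xi * n <= #|Y|%:R).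
Hypothesis dx : 8 * (lambda / dR) ^+ 2 <= xi ^+ 2.

(** All but xi n/2 vertices of [Y] have half the expected degree into [X], hence are adjacent to the
    sample in [X] with probability at least eta xi/4. The mean is therefore at least eta xi^2 n/8,
    twice the threshold, and the lower tail applies with Lipschitz constant d. *)
Lemma Pr_few_second_neighbours :
  Pr p (fun S => #|nbs e (S :&: X) :&: Y|%:R <= eta * xi ^+ 2 / 16 * n) <=
  expR (- ((eta * xi ^+ 2 / 16) ^+ 2 * (n / dR) / (8 * eta))).
Proof.
have n0 : 0 < n by rewrite ltr0n.
have /andP[p0 p1] := p01.
set z := eta * xi ^+ 2 / 16.
have z0 : 0 <= z by rewrite !mulr_ge0 ?invr_ge0 ?sqr_ge0 // ltW.
pose F S : R := #|nbs e (S :&: X) :&: Y|%:R.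
pose Y0 := [set y in Y | #|nb e y :&: X|%:R < dR / n / 2 * #|X|%:R].
have Y0le : #|Y0|%:R <= xi * n / 2.
  have h := card_low_degree X Y T0; rewrite -/Y0 in h.
  have hn := ler_wpM2r (sqr_ge0 n) dx.
  have h1 : #|Y0|%:R * (xi * n) <= #|Y0|%:R * #|X|%:R by rewrite ler_wpM2l.
  have xn : 0 < xi * n by rewrite mulr_gt0.
  rewrite -(ler_pM2r xn); move: h h1 hn; rewrite expr2; set l2 := (lambda / dR) ^+ 2.
  lra.
have EF : 2 * (z * n) <= Ex p F.
  have FE S : F S = \sum_(y in Y) (~~ [disjoint S & nb e y :&: X])%:R.
    rewrite /F -sum1_card natr_sum [LHS]big_mkcond [RHS]big_mkcond /=.
    apply: eq_bigr => y _; rewrite in_setI; case: (y \in Y); rewrite ?andbF ?andbT //.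
    suff -> : (y \in nbs e (S :&: X)) = ~~ [disjoint S & nb e y :&: X] by case: disjoint.
    rewrite -setI_eq0; apply/bigcupP/set0Pn => [[a]|[a]].
      by rewrite !inE => /andP[aS aX] ay; exists a; rewrite !inE aS aX symE ay.
    by rewrite !inE => /and3P[aS ya aX]; exists a; rewrite !inE ?aS ?aX // symE.
  rewrite (eq_Ex _ FE) Ex_sum (bigID (mem Y0)) /=.
  apply: le_trans (_ : \sum_(y in Y | y \notin Y0) eta * xi / 4 <= _).
    have cY : (#|Y|%:R : R) - #|Y0|%:R <= #|Y :\: Y0|%:R.
      rewrite lerBlDr -natrD ler_nat -(cardsID Y0 Y) addnC leq_add2l.
      by rewrite subset_leq_card // subsetIr.
    rewrite (eq_bigl (mem (Y :\: Y0))) => [|y]; last by rewrite !inE andbC.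
    rewrite sumr_const -[leRHS]mulr_natr.
    have e0 : 0 <= eta * xi / 4 by rewrite !mulr_ge0 ?invr_ge0 // ltW.
    apply: le_trans (_ : eta * xi / 4 * (xi * n / 2) <= _); last first.
      apply: ler_wpM2l => //; move: cY Y0le Yxi.
      by move: (#|Y :\: Y0|%:R : R) (#|Y0|%:R : R) (#|Y|%:R : R) => a b c; lra.
    by rewrite /z expr2 le_eqVlt; apply/orP; left; apply/eqP; field.
  apply: le_trans (_ : \sum_(y in Y | y \notin Y0) Pr p (fun S => ~~ [disjoint S & nb e y :&: X]) <= _); last first.
    by rewrite lerDr; apply: sumr_ge0 => y _; exact: Pr_ge0.
  apply: ler_sum => y /andP[yY]; rewrite inE yY /= -leNgt => deg.
  rewrite PrC Pr_disjoint; set m := #|_|.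
  have s1 : eta * xi / 2 <= p * m%:R.
    apply: le_trans (ler_wpM2l p0 deg).
    have := ler_wpM2l (mulr_ge0 p0 (divr_ge0 (divr_ge0 (ltW dR0) (ltW n0)) (ler0n _ 2))) Xxi.
    rewrite !mulrA; apply: le_trans; rewrite -pd le_eqVlt; apply/orP; left; apply/eqP.
    by field; rewrite lt0r_neq0.
  have : (1 - p) ^+ m <= expR (- (eta * xi / 2)).
    apply: le_trans (_ : expR (- p) ^+ m <= _).
      by rewrite lerXn2r ?nnegrE ?expR_ge0 ?subr_ge0 // expR_ge1Dx.
    by rewrite -expRM_natl ler_expR mulrN lerN2 [m%:R * _]mulrC.
  have ex0 : 0 <= eta * xi by rewrite mulr_ge0 // ltW.
  have : expR (- (eta * xi / 2)) <= 1 - (eta * xi / 2) + 2 * (eta * xi / 2) ^+ 2.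
    by rewrite -[X in _ <= _ + 2 * X]sqrrN; apply: expR_le_quad; lra.
  have : (eta * xi / 2) ^+ 2 <= (eta * xi / 2) * (1 / 4).
    rewrite -subr_ge0.
    have -> : eta * xi / 2 * (1 / 4) - (eta * xi / 2) ^+ 2 =
      eta * xi * (1 / 2 - eta * xi) / 4 by field.
    by apply: divr_ge0 => //; apply: mulr_ge0 => //; rewrite subr_ge0.
  lra.
have V0 : 0 < eta * (n / dR) by rewrite mulr_gt0 // divr_gt0.
have := @lipschitz_lower_tail R T p dR (eta * (n / dR)) (z * n) F p01 dR0 V0 _ _ (nbs_lipschitz X Y).
have -> : (z * n) ^+ 2 / (8 * (eta * (n / dR)) * dR ^+ 2) = z ^+ 2 * (n / dR) / (8 * eta).
  by field; rewrite !lt0r_neq0.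
move=> h; apply: le_trans (h _ _).
- by apply: Pr_le => // S; rewrite -/(F S); lra.
- by rewrite -pd le_eqVlt; apply/orP; left; apply/eqP; rewrite /n; field; rewrite lt0r_neq0.
- rewrite mulr_ge0 ?(ltW n0) //=.
  have -> : 4 * (eta * (n / dR)) * dR = 4 * eta * n by field; rewrite lt0r_neq0.
  rewrite ler_wpM2r ?(ltW n0) // /z -mulrA mulrC ler_wpM2r ?(ltW eta0) //.
  have xi1 : xi <= 1.
    by rewrite -(ler_pM2r n0) mul1r (le_trans Xxi) // ler_nat max_card.
  have : xi ^+ 2 <= 1 by rewrite expr_le1 // ltW.
  lra.
Qed.

(** The first set is fixed. Either it has few neighbours in [Y], which is the first term, or the
    independent second set must avoid all of these many neighbours, which is the second. *)
Lemma Pr_no_connection :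
  Ex p (fun S3 => Pr p (fun S4 => [disjoint S4 & nbs e (S3 :&: X) :&: Y])) <=
  expR (- ((eta * xi ^+ 2 / 16) ^+ 2 * (n / dR) / (8 * eta))) +
  expR (- (eta * xi ^+ 2 / 16 * (eta * (n / dR)))).
Proof.
have /andP[p0 p1] := p01.
set z := eta * xi ^+ 2 / 16.
apply: le_trans (_ : Ex p (fun S3 => (#|nbs e (S3 :&: X) :&: Y|%:R <= z * n)%R%:R
   + expR (- (z * (eta * (n / dR))))) <= _); last first.
  by rewrite ExD Ex_cst lerD2r; exact: Pr_few_second_neighbours.
apply: Ex_le => // S3; case: (leP _ (z * n)) => /= h.
  by rewrite [true%:R]mulr1n (le_trans (Pr_le1 _ p01)) // lerDl expR_ge0.
rewrite add0r Pr_disjoint; set m := #|_| in h *.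
apply: le_trans (_ : expR (- p) ^+ m <= _).
  by rewrite lerXn2r ?nnegrE ?expR_ge0 ?subr_ge0 // expR_ge1Dx.
rewrite -expRM_natl ler_expR mulrN lerN2.
have -> : z * (eta * (n / dR)) = z * n * p by rewrite -pd; field; rewrite lt0r_neq0.
by rewrite ler_wpM2r // ltW.
Qed.

End Connect.

Lemma trivIset_components S : trivIset (components e S).
Proof.
apply/trivIsetP => _ _ /imsetP[u uS ->] /imsetP[v vS ->]; apply: contraR.
rewrite -setI_eq0 => /set0Pn[w]; rewrite in_setI => /andP[wu wv].
by rewrite -(component_eq symE wu) (component_eq symE wv).
Qed.

Lemma component_in_components S v : v \in S -> component e S v \in components e S.
Proof. by move=> vS; apply/imsetP; exists v. Qed.

Lemma component_of_mem S C v : C \in components e S -> v \in C -> C = component e S v.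
Proof. by case/imsetP => u uS -> vu; rewrite (component_eq symE vu). Qed.

Definition large_components k S := [set C in components e S | (k <= #|C|)%N].

Lemma card_large_components k S : (#|large_components k S| * k <= #|S|)%N.
Proof.
set L := large_components k S.
have tL : trivIset L.
  by apply: trivIsetS (trivIset_components S); apply/subsetP => C; rewrite inE => /andP[].
apply: (@leq_trans (\sum_(C in L) #|C|)).
  by rewrite -sum_nat_const; apply: leq_sum => C; rewrite inE => /andP[].
rewrite (eqP tL) subset_leq_card //; apply/subsetP => v /bigcupP[C].
by rewrite inE => /andP[/imsetP[u uS ->] _]; exact: (subsetP (component_sub _ _ _)).
Qed.

Lemma cover_large_components k S :
  cover (large_components k S) = [set v in S | (k <= #|component e S v|)%N].
Proof.
apply/setP => v; rewrite inE; apply/bigcupP/andP => [[C]|[vS kv]].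
  rewrite inE => /andP[CS kC] vC; rewrite -(component_of_mem CS vC) kC.
  by case/imsetP: CS vC => u uS -> /(subsetP (component_sub _ _ _)).
by exists (component e S v); [rewrite inE component_in_components|exact: component_id].
Qed.

Definition adj_closed S (J : {set T}) :=
  forall u v, u \in J -> v \in S -> e u v -> v \in J.

(* A minimal family of components whose trace on [Z] reaches [theta] works. *)
Lemma split_by_components S (Z : {set T}) (theta : R) : Z \subset S ->
  0 < theta -> 3 * theta <= #|Z|%:R ->
  (forall C, C \in components e S -> #|Z :&: C|%:R < #|Z|%:R - theta) ->
  exists2 J : {set T}, adj_closed S J /\ J \subset S &
    theta <= #|Z :&: J|%:R /\ theta <= #|Z :\: J|%:R.
Proof.
move=> ZS th0 th3 small.
have cl (D : {set {set T}}) : D \subset components e S -> adj_closed S (cover D) /\ cover D \subset S.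
  move=> DS; split.
    move=> u v /bigcupP[C CD uC] vS uv; apply/bigcupP; exists C => //.
    rewrite (component_of_mem (subsetP DS _ CD) uC).
    by apply: component_next uv => //; rewrite -(component_of_mem (subsetP DS _ CD) uC).
  apply/subsetP => u /bigcupP[C /(subsetP DS)/imsetP[w wS ->]].
  exact: (subsetP (component_sub _ _ _)).
pose good (D : {set {set T}}) := (D \subset components e S) && (theta <= #|Z :&: cover D|%:R).
have gT : good (components e S).
  rewrite /good subxx /=; have -> : Z :&: cover (components e S) = Z.
    apply/setIidPl/subsetP => v vZ; have vS := subsetP ZS v vZ.
    by apply/bigcupP; exists (component e S v); rewrite ?component_in_components ?component_id.
  by have : 0 <= (#|Z|%:R : R) by []; lra.
have [D0 gD0 minD0] : exists2 D0, good D0 & forall D, good D -> (#|D0| <= #|D|)%N.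
  by case: (arg_minnP (fun D : {set {set T}} => #|D|) gT) => D0 gD0 h; exists D0.
have split (J : {set T}) : #|Z :\: J|%:R = #|Z|%:R - #|Z :&: J|%:R :> R.
  by apply/eqP; rewrite -subr_eq opprK -natrD addnC cardsID.
have [D00|[C CD]] := set_0Vmem D0.
  by move: gD0; rewrite /good D00 /cover big_set0 setI0 cards0 => /andP[_]; lra.
have /andP[D0S gD0'] := gD0; have CS := subsetP D0S _ CD.
have [thC|thC] := leP theta #|Z :&: C|%:R.
  exists C; last by rewrite split; split => //; have := small C CS; lra.
  have := cl [set C]; rewrite sub1set /cover big_set1; exact.
exists (cover D0); first exact: cl.
split; rewrite ?split //.
(* By minimality the trace of D0 without C is below theta, and so is that of C. The trace of D0 is
   thus below 2 theta, and at least theta of the 3 theta remains outside. *)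
have ng : ~~ good (D0 :\ C).
  by apply/negP => /minD0; rewrite [in X in (X <= _)%N](cardsD1 C) CD add1n ltnn.
move: ng; rewrite /good (subset_trans _ D0S) ?subsetDl //= -ltNge => small'.
have : (#|Z :&: cover D0| <= #|Z :&: cover (D0 :\ C)| + #|Z :&: C|)%N.
  rewrite (leq_trans _ (leq_card_setU _ _)) // subset_leq_card // -setIUr setIS //.
  apply/subsetP => v /bigcupP[B BD vB]; rewrite in_setU.
  have [<-|BC] := eqVneq B C; first by rewrite vB orbT.
  by apply/orP; left; apply/bigcupP; exists B; rewrite // !inE BC.
rewrite -(ler_nat R) natrD; lra.
Qed.

Section Merging.
Variables (p xi eta theta : R) (k : nat) (S1 : {set T}).
Hypotheses (p01 : 0 <= p <= 1) (T0 : (0 < #|T|)%N).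
Hypotheses (pd : p * dR = eta) (eta0 : 0 < eta) (xi0 : 0 < xi) (ex : eta * xi <= 1 / 2).
Hypothesis dx : 8 * (lambda / dR) ^+ 2 <= xi ^+ 2.
Hypothesis expand : forall A, A \subset S1 -> theta <= #|A|%:R -> xi * n <= #|nbs e A|%:R.

Let Z := [set v in S1 | (k <= #|component e S1 v|)%N].
Hypotheses (th0 : 0 < theta) (th3 : 3 * theta <= #|Z|%:R).

Definition merged S := [exists C in components e S, #|Z|%:R - theta <= #|Z :&: C|%:R].

(** A failure provides a union J of components of the final graph that splits [Z]. The components of
    [S1] are not cut by J, so the trace of J on [Z] is given by a subfamily I of the large ones. The
    union bound runs over I, a choice made before the sprinkling, and not over J. *)
Lemma Pr_not_merged :
  Ex p (fun S3 => Pr p (fun S4 => ~~ merged (S1 :|: S3 :|: S4))) <=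
  2 ^+ #|large_components k S1| *
  (expR (- ((eta * xi ^+ 2 / 16) ^+ 2 * (n / dR) / (8 * eta))) +
   expR (- (eta * xi ^+ 2 / 16 * (eta * (n / dR))))).
Proof.
set bnd := expR _ + expR _; set L := large_components k S1.
pose A (I : {set {set T}}) := cover I; pose B (I : {set {set T}}) := cover (L :\: I).
pose ok (I : {set {set T}}) := [&& I \subset L, theta <= #|A I|%:R & theta <= #|B I|%:R].
have LS (I : {set {set T}}) : I \subset L -> cover I \subset S1.
  move=> IL; apply/subsetP => u /bigcupP[C /(subsetP IL)]; rewrite inE => /andP[/imsetP[w wS ->] _].
  exact: (subsetP (component_sub _ _ _)).
apply: le_trans (_ : Ex p (fun S3 => Pr p (fun S4 => [exists I, ok I &&
    [disjoint S4 & nbs e (S3 :&: nbs e (A I)) :&: nbs e (B I)]])) <= _).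
  apply: Ex_le => // S3; apply: Pr_le => // S4 nm.
  set S := S1 :|: S3 :|: S4 in nm *.
  have S1S : S1 \subset S by rewrite /S -setUA subsetUl.
  have ZS : Z \subset S.
    by apply: subset_trans S1S; apply/subsetP => v; rewrite inE => /andP[].
  have [|J [Jcl JS] [thA thB]] := split_by_components ZS th0 th3.
    move=> C CS; rewrite ltNge; apply: contra nm => h.
    by apply/existsP; exists C; rewrite CS.
  pose I := [set C in L | C \subset J].
  have dich C : C \in L -> (C \subset J) || [disjoint C & J].
    move=> CL; case: (boolP [disjoint C & J]); rewrite ?orbT // orbF.
    rewrite -setI_eq0 => /set0Pn[u]; rewrite in_setI => /andP[uC uJ].
    move: CL; rewrite inE => /andP[CS _]; rewrite (component_of_mem CS uC).
    apply: component_closed => // x y xJ yS xy; apply: Jcl xy => //.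
    exact: (subsetP S1S).
  have AE : A I = Z :&: J.
    rewrite /Z -cover_large_components -/L; apply/setP => u; rewrite in_setI.
    apply/bigcupP/andP => [[C]|[/bigcupP[C CL uC] uJ]].
      rewrite inE => /andP[CL CJ] uC; split; last exact: (subsetP CJ).
      by apply/bigcupP; exists C.
    exists C => //; rewrite inE CL; case/orP: (dich C CL) => // dis.
    by rewrite (disjointFr dis uC) in uJ.
  have BE : B I = Z :\: J.
    rewrite /Z -cover_large_components -/L; apply/setP => u; rewrite in_setD.
    apply/bigcupP/andP => [[C]|[uJ /bigcupP[C CL uC]]].
      rewrite in_setD [C \in I]inE => /andP[+ CL] uC; rewrite CL andTb => CJ; split.
        by case/orP: (dich C CL) => [CJ'|dis]; [rewrite CJ' in CJ|rewrite (disjointFr dis uC)].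
      by apply/bigcupP; exists C.
    exists C => //; rewrite in_setD [C \in I]inE CL andTb andbT; apply: contra uJ => CJ.
    exact: (subsetP CJ).
  apply/existsP; exists I; rewrite /ok AE BE thA thB; apply/andP; split.
    by rewrite !andbT; apply/subsetP => C; rewrite inE => /andP[].
  (* A path a, w1, w2, b with a in J, w1 in S3 and w2 in S4 would carry membership in J along to b,
     which lies outside J. *)
  rewrite disjoints_subset; apply/subsetP => w2 w2S4; rewrite !inE; apply/negP.
  case/andP=> /bigcupP[w1]; rewrite in_setI => /andP[w1S3 /bigcupP[a aA w1a]] w2w1 /bigcupP[b bB w2b].
  move: aA; rewrite in_setI => /andP[_ aJ]; rewrite !inE in w1a w2w1 w2b.
  have w1J : w1 \in J by apply: Jcl w1a => //; rewrite /S !inE w1S3 orbT.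
  have w2J : w2 \in J by apply: Jcl w2w1 => //; rewrite /S !inE w2S4 orbT.
  move: bB; rewrite in_setD => /andP[bJ bZ]; case/negP: bJ.
  by apply: Jcl w2J _ _; [exact: (subsetP ZS)|rewrite symE].
apply: le_trans (_ : Ex p (fun S3 => \sum_(I | ok I) Pr p (fun S4 =>
    [disjoint S4 & nbs e (S3 :&: nbs e (A I)) :&: nbs e (B I)])) <= _).
  apply: Ex_le => // S3; rewrite -Ex_sum; apply: Ex_le => // S4.
  case: existsP => [[I /andP[okI h]]|_]; last exact: sumr_ge0.
  by rewrite (bigD1 I) //= h [true%:R]mulr1n lerDl sumr_ge0.
rewrite Ex_sum; apply: le_trans (_ : \sum_(I | ok I) bnd <= _).
  apply: ler_sum => I /and3P[IL thA thB]; apply: Pr_no_connection => //.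
    by apply: expand => //; exact: LS.
  by apply: expand => //; apply: LS; rewrite subsetDl.
rewrite sumr_const -(mulr_natl bnd) ler_wpM2r ?addr_ge0 ?expR_ge0 //.
rewrite -natrX ler_nat -card_powerset subset_leq_card //; apply/subsetP => I.
by rewrite inE => /and3P[].
Qed.

End Merging.

End Mixing.

(** * The survival probability *)

Section Analytic.
Variable R : realType.
Implicit Types (eps x y a : R).

(** A lower bound on exp(y) with a quadratic term. Near criticality the linear terms of the fixpoint
    equation almost cancel, so a linear bound would not decide it. *)
Lemma expRN_sqr_le y : 0 <= y -> expR (- y) * (1 + y / 2) ^+ 2 <= 1.
Proof.
move=> y0; have -> : expR (- y) = expR (- (y / 2)) ^+ 2.
  by rewrite expr2 -expRD; congr expR; lra.
have ab : expR (- (y / 2)) * expR (y / 2) = 1 by rewrite mulrC expRxMexpNx_1.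
have h := expR_ge1Dx (y / 2); have E0 := expR_ge0 (- (y / 2)).
rewrite -exprMn expr_le1 ?mulr_ge0 //; last by lra.
by rewrite -[leRHS]ab ler_wpM2l.
Qed.

(** The solution is about 2 eps; the intermediate value theorem is applied between 5/4 eps and 5
    eps. The lower end is kept because later margins rest on [x] exceeding eps by a constant
    factor. *)
Lemma giant_density_exists eps : 0 < eps < 1 / 200 ->
  exists x, [/\ giant_density eps x, 5 / 4 * eps <= x & x <= 5 * eps].
Proof.
move=> /andP[e0 e1]; pose f y : R := (1 + eps) * (1 - expR (- y)) - y.
have cf : continuous f.
  move=> y; apply: cvgB; last exact: cvg_id.
  apply: cvgM; first exact: cvg_cst.
  apply: cvgB; first exact: cvg_cst.
  apply: continuous_comp; last exact: continuous_expR.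
  exact: cvgN.
have fl : 0 <= f (5 / 4 * eps).
  set y := 5 / 4 * eps; have y0 : 0 <= y by rewrite /y; lra.
  have h := expRN_sqr_le y0; have q0 : 0 < (1 + y / 2) ^+ 2 by rewrite exprn_gt0 //; lra.
  rewrite -(pmulr_lge0 _ q0) /f.
  have -> : ((1 + eps) * (1 - expR (- y)) - y) * (1 + y / 2) ^+ 2 =
    (1 + eps) * (1 - expR (- y) * (1 + y / 2) ^+ 2) +
    ((1 + eps) * ((1 + y / 2) ^+ 2 - 1) - y * (1 + y / 2) ^+ 2) by ring.
  apply: addr_ge0; first by apply: mulr_ge0; rewrite ?subr_ge0 //; lra.
  have -> : (1 + eps) * ((1 + y / 2) ^+ 2 - 1) - y * (1 + y / 2) ^+ 2 =
    5 / 4 * eps ^+ 2 * (1 / 16 - 5 / 64 * eps) by rewrite /y; field.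
  apply: mulr_ge0; last by lra.
  by apply: mulr_ge0; [lra|exact: sqr_ge0].
have fr : f (5 * eps) <= 0.
  rewrite /f subr_le0.
  have -> : expR (- (5 * eps)) = expR (- (5 * eps / 2)) ^+ 2.
    by rewrite expr2 -expRD; congr expR; lra.
  have h := expR_ge1Dx (- (5 * eps / 2)).
  have : (1 - 5 * eps / 2) ^+ 2 <= expR (- (5 * eps / 2)) ^+ 2.
    by apply: lerXn2r; rewrite ?nnegrE ?expR_ge0; lra.
  move: (expR _ ^+ 2) => E hE.
  apply: le_trans (_ : (1 + eps) * (1 - (1 - 5 * eps / 2) ^+ 2) <= _).
    by apply: ler_wpM2l; lra.
  rewrite -subr_ge0.
  have -> : 5 * eps - (1 + eps) * (1 - (1 - 5 * eps / 2) ^+ 2) =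
     eps ^+ 2 * (5 / 4 + 25 / 4 * eps) by field.
  by apply: mulr_ge0; [exact: sqr_ge0|lra].
have le : 5 / 4 * eps <= 5 * eps by lra.
have [|x] := @IVT R f _ _ 0 le (continuous_subspaceT cf).
  by rewrite ge_min le_max fl fr orbT.
rewrite in_itv /= => /andP[x1 x2] fx0; exists x; split=> //; split.
  by apply/andP; split; lra.
by apply/eqP; rewrite eq_sym -subr_eq0 -/(f x) fx0.
Qed.

Section Fixpoints.
Variables (eps x a : R).
Hypotheses (e0 : 0 < eps < 1 / 200) (a0 : 0 < a < eps ^+ 4).
Hypotheses (gx : giant_density eps x) (x1 : 5 / 4 * eps <= x) (x2 : x <= 5 * eps).

(** The survival probability of the branching process with Poisson(1 + eps) offspring. About (1 +
    eps) N vertices are retained, and the fraction [rho] of them makes up x N. *)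
Let rho := x / (1 + eps).

Lemma eps_pow4_lt : eps ^+ 4 < eps * (1 / 200) ^+ 3.
Proof.
have /andP[h0 h1] := e0.
have -> : eps ^+ 4 = eps * eps ^+ 3 by rewrite exprS.
by rewrite ltr_pM2l // ltrXn2r // ltW.
Qed.

Lemma alpha_small : a < eps / 200 / 200 / 200 /\ a < 1 / 200 / 200 / 200 / 200.
Proof.
have /andP[h0 h1] := e0; have /andP[_ a1] := a0; have h := eps_pow4_lt.
by split; lra.
Qed.

Lemma rho_bounds : [/\ 6 / 5 * eps <= rho, rho <= 5 * eps & (1 + eps) * rho = x].
Proof.
have /andP[h0 h1] := e0; rewrite /rho; split.
- rewrite ler_pdivlMr; last by lra.
  apply: le_trans x1; have : 0 <= eps * (1 / 200 - eps) by apply: mulr_ge0; lra.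
  lra.
- rewrite ler_pdivrMr; last by lra.
  by apply: le_trans x2 _; apply: ler_peMr; lra.
- by rewrite mulrC divfK // lt0r_neq0 //; lra.
Qed.

Lemma rho_fix : expR (- x) = 1 - rho.
Proof.
have /andP[h0 h1] := e0; case: gx => _ xE.
rewrite /rho {2}xE mulrC mulKf; last by rewrite lt0r_neq0 //; lra.
lra.
Qed.

(* The survival probability is stable under lowering the mean offspring by [a / 4]. *)
Lemma lower_fixpoint (c' : R) : 1 + eps - a / 4 <= c' ->
  expR (- (c' * (rho - 7 / 4 * a))) <= 1 - (rho - 7 / 4 * a).
Proof.
move=> hc; have /andP[h0 h1] := e0; have /andP[a1 _] := a0.
have [a2 a3] := alpha_small; have [r1 r2 r3] := rho_bounds.
(* Here s = 7 D. To first order the gain s (rho - eps) has to beat the loss D rho; since rho - eps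
   >= rho/6, the factor 7 suffices, and the surplus D rho/6 absorbs the quadratic terms. *)
set s := 7 / 4 * a; pose D := a / 4; pose u := (1 + eps) * s + D * rho.
have h_ge0 : 0 <= rho - s by rewrite /s; lra.
have es0 : 0 <= eps * s by apply: mulr_ge0; rewrite /s; lra.
have Dr0 : 0 <= D * rho by apply: mulr_ge0; rewrite /D; lra.
apply: le_trans (_ : expR (- x + u) <= _).
  rewrite ler_expR -r3 /u.
  have := ler_wpM2r h_ge0 hc; have : 0 <= D * s by apply: mulr_ge0; rewrite /D /s; lra.
  rewrite /D; lra.
rewrite expRD rho_fix.
have rho1 : rho <= 1 / 2 by lra.
have u0 : 0 <= u by rewrite /u; rewrite /s in es0 *; lra.
have u8 : u <= 8 * D.
  have : eps * s <= 1 / 200 * s by apply: ler_wpM2r; rewrite /s; lra.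
  have : D * rho <= D * (1 / 2) by apply: ler_wpM2l; rewrite /D; lra.
  rewrite /u /s /D; lra.
have u1 : u <= 1 by rewrite /D in u8; lra.
have uq := expR_le_quad u1.
apply: le_trans (ler_wpM2l (_ : 0 <= 1 - rho) uq) _; first by lra.
have u2 : u ^+ 2 <= 64 * D ^+ 2.
  have : u ^+ 2 <= (8 * D) ^+ 2 by apply: lerXn2r; rewrite ?nnegrE; rewrite /D in u8 *; lra.
  by rewrite exprMn; lra.
have D2 : D ^+ 2 <= D * (eps / 200 / 200).
  by rewrite expr2; apply: ler_wpM2l; rewrite /D; lra.
have De : D * eps <= D * (5 / 6 * rho) by apply: ler_wpM2l; rewrite /D; lra.
have : (1 - rho) * (u + 2 * u ^+ 2) <= s; last by lra.
have -> : (1 - rho) * (u + 2 * u ^+ 2) = (1 - rho) * u + (1 - rho) * (2 * u ^+ 2) by ring.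
have : (1 - rho) * (2 * u ^+ 2) <= 1 * (2 * u ^+ 2).
  by apply: ler_wpM2r; [have := sqr_ge0 u; lra|lra].
have : (1 - rho) * u <= (1 + eps) * s - rho * s + D * rho.
  have -> : (1 - rho) * u = (1 + eps) * s - rho * s + D * rho - rho * eps * s - rho * (D * rho).
    by rewrite /u; ring.
  have : 0 <= rho * eps * s by rewrite -mulrA; apply: mulr_ge0; lra.
  have : 0 <= rho * (D * rho) by apply: mulr_ge0; lra.
  lra.
have es : eps * s = 7 * (D * eps) by rewrite /s /D; field.
have rs : rho * s = 7 * (D * rho) by rewrite /s /D; field.
lra.
Qed.

Lemma one_subr_ge_expR y : 0 <= y <= 1 / 2 -> expR (- (y + 2 * y ^+ 2)) <= 1 - y.
Proof.
move=> /andP[y0 y1].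
have y1' : 0 < 1 - y by lra.
have h := expR_ge1Dx (y / (1 - y)).
have : (1 - y)^-1 <= expR (y / (1 - y)).
  by rewrite [leLHS](_ : _ = 1 + y / (1 - y)) //; field; rewrite lt0r_neq0.
move=> h2; rewrite expRN invf_ple ?posrE ?expR_gt0 //.
apply: le_trans h2 _; rewrite ler_expR ler_pdivrMr //.
have : 0 <= y ^+ 2 * (1 - 2 * y) by apply: mulr_ge0; [exact: sqr_ge0|lra].
rewrite [y ^+ 2]expr2; lra.
Qed.

Lemma upper_fixpoint (p : R) (d : nat) : p * d%:R = 1 + eps -> 0 < p ->
  16 * p <= a ^+ 2 * eps ->
  1 - (rho + a ^+ 2) <= (p * (1 - (rho + a ^+ 2)) + (1 - p)) ^+ d.
Proof.
move=> pd p0 pa; have /andP[h0 h1] := e0; have /andP[a1 _] := a0.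
have [a2 a3] := alpha_small; have [r1 r2 r3] := rho_bounds.
have aa : a ^+ 2 <= a by rewrite expr2; apply: ler_piMl; lra.
have aa0 : 0 < a ^+ 2 by rewrite exprn_gt0.
set s := a ^+ 2; pose h := rho + s.
have hh : 0 <= h <= 1 / 4 by rewrite /h /s; apply/andP; split; lra.
have /andP[hh0 hh1] := hh.
have p1 : p <= 1 / 2.
  have : a ^+ 2 * eps <= 1 * 1 by apply: ler_pM; lra.
  lra.
have ph : 0 <= p * h <= 1 / 2.
  rewrite mulr_ge0 ?(ltW p0) //=.
  by apply: le_trans (ler_wpM2l (ltW p0) hh1) _; lra.
have -> : p * (1 - (rho + s)) + (1 - p) = 1 - p * h by rewrite /h; ring.
apply: le_trans (_ : expR (- (p * h + 2 * (p * h) ^+ 2)) ^+ d <= _); last first.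
  rewrite lerXn2r ?nnegrE ?expR_ge0 //; last exact: one_subr_ge_expR.
  by have /andP[_ ?] := ph; lra.
rewrite -expRM_natl.
have -> : d%:R * - (p * h + 2 * (p * h) ^+ 2) =
   - x + - ((1 + eps) * s + 2 * p * ((1 + eps) * h ^+ 2)).
  by rewrite -r3 -pd /h; ring.
rewrite expRD rho_fix.
set k := (1 + eps) * s + _.
have k1 := expR_ge1Dx (- k).
apply: le_trans (ler_wpM2l (_ : 0 <= 1 - rho) k1); last by lra.
have kle : k <= (1 + eps) * s + 2 * p.
  rewrite /k lerD2l; apply: ler_piMr; first by lra.
  have : h ^+ 2 <= (1 / 4) ^+ 2 by apply: lerXn2r; rewrite ?nnegrE; lra.
  have : 0 <= h ^+ 2 by exact: sqr_ge0.
  move=> H1 H2; apply: le_trans (_ : 2 * h ^+ 2 <= _); last by lra.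
  by apply: ler_wpM2r; lra.
have sr : s * eps <= s * (5 / 6 * rho) by apply: ler_wpM2l; rewrite /s; lra.
have sr0 : 0 <= s * rho by apply: mulr_ge0; rewrite /s; lra.
have : (1 - rho) * k <= (1 - rho) * ((1 + eps) * s + 2 * p) by apply: ler_wpM2l; lra.
have : (1 - rho) * (2 * p) <= 1 * (2 * p) by apply: ler_wpM2r; lra.
have : 0 <= rho * eps * s by rewrite -mulrA; apply: mulr_ge0; [lra|apply: mulr_ge0; rewrite /s; lra].
rewrite /s in sr sr0 pa *; lra.
Qed.

(** Supplies [r] and [w] for [gw_le]. The point 1 - eps is about halfway between the extinction
    probability, near 1 - 2 eps, and 1; there the generating function is below the diagonal by a
    factor near exp(-eps^2/2), of which exp(-eps^2/8) is kept. *)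
Lemma subcritical_fixpoint (p : R) (d : nat) : p * d%:R = 1 + eps -> 0 < p <= 1 ->
  (p * (1 - eps) + (1 - p)) ^+ d <= expR (- (eps ^+ 2 / 8)) * (1 - eps).
Proof.
move=> pd /andP[p0 p1]; have /andP[h0 h1] := e0.
apply: le_trans (_ : expR (- (p * eps)) ^+ d <= _).
  rewrite (_ : p * (1 - eps) + (1 - p) = 1 - p * eps); last by ring.
  rewrite lerXn2r ?nnegrE ?expR_ge0 ?expR_ge1Dx //.
  have : p * eps <= 1 * 1 by apply: ler_pM; lra.
  lra.
rewrite -expRM_natl; pose z := eps + 7 / 8 * eps ^+ 2.
have -> : d%:R * - (p * eps) = - (eps ^+ 2 / 8) + - z.
  have -> : d%:R * - (p * eps) = - (p * d%:R * eps) by ring.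
  by rewrite pd /z; field.
rewrite expRD ler_wpM2l ?expR_ge0 //.
have z0 : 0 <= z by rewrite /z; have := sqr_ge0 eps; lra.
have h := expRN_sqr_le z0.
have q0 : 0 < (1 + z / 2) ^+ 2 by rewrite exprn_gt0 //; lra.
rewrite -(ler_pM2r q0); apply: le_trans h _.
rewrite -subr_ge0.
have -> : (1 - eps) * (1 + z / 2) ^+ 2 - 1 =
   eps ^+ 2 * (1 / 8 + eps * (- 11 / 16 - 63 / 256 * eps - 49 / 256 * eps ^+ 2)) by rewrite /z; field.
apply: mulr_ge0; first exact: sqr_ge0.
have e2 : eps ^+ 2 <= 1.
  by rewrite expr_le1 //; lra.
have : eps * (11 / 16 + 63 / 256 * eps + 49 / 256 * eps ^+ 2) <= 1 / 200 * 2.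
  apply: ler_pM; try lra.
  by have := sqr_ge0 eps; lra.
lra.
Qed.

(** As a < eps^4, the exponent t = eps^2/(8 a) is at least of order a^(-1/2). The term t^6/6! of the
    exponential series is then of order a^-3 and beats a^-2. *)
Lemma extinction_tail (k : nat) : a^-1 < k%:R ->
  expR (- (eps ^+ 2 / 8)) ^+ k <= a ^+ 2.
Proof.
move=> ak; have /andP[h0 h1] := e0; have /andP[a1 a4] := a0; have [_ a3] := alpha_small.
rewrite -expRM_natl; pose t := eps ^+ 2 / 8 / a.
have u0 : 0 <= eps ^+ 2 / 8 by rewrite divr_ge0 ?sqr_ge0.
have t0 : 0 <= t by rewrite divr_ge0 // ltW.
apply: le_trans (_ : expR (- t) <= _).
  by rewrite ler_expR mulrN lerN2 /t mulrC ler_wpM2r // ltW.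
have := @expR_ge1Dxn R t 5 t0 => ht.
have t6 : a ^- 2 <= t ^+ 6 / 6`!%:R.
  rewrite ler_pdivlMr ?ltr0n //.
  have u6 : a ^+ 3 <= (eps ^+ 2) ^+ 6.
    rewrite -exprM (_ : (2 * 6 = 4 * 3)%N) // exprM lerXn2r ?nnegrE ?exprn_ge0 //; lra.
  have -> : t ^+ 6 = (eps ^+ 2) ^+ 6 / (8 ^+ 6 * a ^+ 6).
    by rewrite /t; field; rewrite lt0r_neq0.
  rewrite ler_pdivlMr ?mulr_gt0 ?exprn_gt0 //; apply: le_trans u6.
  have -> : a ^- 2 * 6`!%:R * (8 ^+ 6 * a ^+ 6) = 720 * 8 ^+ 6 * a * a ^+ 3.
    have -> : 6`! = 720%N by [].
    by field; rewrite lt0r_neq0.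
  by apply: ler_piMl; [rewrite exprn_ge0 // ltW|lra].
rewrite expRN -[leRHS]invrK lef_pV2 ?posrE ?expR_gt0 ?invr_gt0 ?exprn_gt0 //.
by apply: le_trans t6 _; apply: le_trans ht; rewrite lerDr.
Qed.

End Fixpoints.
End Analytic.

(** * From vertex counts to the giant component *)

Section Expectations.
Variables (R : realType) (T : finType) (e : rel T).
Hypothesis symE : symmetric e.
Implicit Types (S C : {set T}).

Lemma Ex_ncomp (p : R) (Q : pred {set T}) :
  Ex p (fun S => (ncomp e Q S)%:R) =
  \sum_v p * Pr p (fun S => Q (reach e [set v] (S :&: [set~ v]))).
Proof.
have ncE S : (ncomp e Q S)%:R = \sum_v ((v \in S) && Q (component e S v))%:R :> R.
  rewrite /ncomp -sum1_card natr_sum big_mkcond /=.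
  by apply: eq_bigr => v _; rewrite inE; case: (_ && _).
rewrite (eq_Ex _ ncE) Ex_sum; apply: eq_bigr => v _.
have vC : v \notin [set~ v] by rewrite !inE eqxx.
have vT : v |: [set~ v] = setT by apply/setP => u; rewrite !inE orbN.
have := Ex_split p (fun S => ((v \in S) && Q (component e S v))%:R : R) vC.
rewrite vT (@eq_Ex _ _ p _ (fun S => ((v \in S) && Q (component e S v))%:R)); last first.
  by move=> S; rewrite setIT.
move=> ->; rewrite [X in _ + _ * X](@eq_Ex _ _ p _ (fun=> 0)); last first.
  by move=> S; rewrite !inE eqxx andbF.
rewrite Ex_cst mulr0 addr0; congr (_ * _); apply: eq_Ex => S.
rewrite setU11 /= component_reach ?setU11 //.
congr (nat_of_bool (Q (reach e _ _)))%:R; apply/setP => u; rewrite !inE.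
by case: (u == v); rewrite ?andbF.
Qed.

Lemma component_connected S v : v \in S -> connected_in e (component e S v).
Proof.
move=> vS; split; first by apply/set0Pn; exists v; exact: component_id.
move=> u w uC wC.
have : w \in component e S u by rewrite (component_eq symE uC).
rewrite inE => /andP[_ uw].
pose P y := (y \in component e S v) && connect (induced e (component e S v)) u y.
suff /andP[] : P w by [].
apply: (connect_closed (P := P)) uw; last by rewrite /P uC connect0.
move=> y z /andP[yC uy] /and3P[yS zS yz].
have zC : z \in component e S v by exact: component_next yz.
by rewrite /P zC; apply: connect_trans uy (connect1 _); rewrite /induced /= yC zC.
Qed.

Lemma small_tree_ncomp (alpha : R) k S : k%:R <= alpha^-1 ->
  (ncomp e (fun C => (#|C| <= k)%N) S <=
   ncomp e (fun C => `[< small_tree alpha e C >]) S + cyclic_small e k S)%N.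
Proof.
move=> ka; rewrite (leq_trans _ (leq_card_setU _ _)) // subset_leq_card //.
apply/subsetP => v; rewrite !inE => /andP[vS ck]; rewrite vS ck /=.
case: asboolP => //= h; apply/asboolPn => ac; apply: h; split.
  by split => //; exact: component_connected.
by apply: le_trans ka; rewrite ler_nat.
Qed.

(** Subtracting [C] and the small trees from [S] leaves (3 + 1/10 + 1 + 1/10) a N <= 5 a N
    exceptional vertices. Any other component is a small tree, with at most 1/a <= a N vertices, or
    consists of exceptional vertices, so it is much smaller than [C]. *)
Lemma unique_giant_of_counts (eps x a N : R) (k2 : nat) S1 S C (c := 1 + eps)
    (Z := [set v in S1 | (k2 <= #|component e S1 v|)%N]) :
  0 < eps < 1 / 200 -> 0 < a < eps ^+ 4 -> 5 / 4 * eps <= x -> 0 < N ->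
  a^-1 <= a * N -> S1 \subset S -> C \in components e S ->
  #|Z|%:R - a / 10 * N <= #|Z :&: C|%:R ->
  (x - 3 * a) * N <= #|Z|%:R ->
  #|S|%:R <= (c + a / 10) * N ->
  (c - x - a) * N <= (ncomp e (fun C => `[< small_tree a e C >]) S)%:R ->
  unique_giant 15 x a N e S C /\ #|exceptional a e S C|%:R <= 15 * a * N.
Proof.
move=> e0 a0 x1 N0 aN S1S CS ZC Zx Sc f1; have [a2 _] := alpha_small e0 a0.
have /andP[e1 e2] := e0; have /andP[a1 _] := a0.
have aN0 : 0 < a * N by rewrite mulr_gt0.
have aeN : 10 * (a * N) <= x * N.
  by rewrite mulrA; apply: ler_wpM2r; [exact: ltW|lra].
pose W := [set v in S | `[< small_tree a e (component e S v) >]].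
have f1W : (c - x - a) * N <= #|W|%:R by [].
have ZCC : #|Z :&: C|%:R <= #|C|%:R :> R by rewrite ler_nat subset_leq_card // subsetIr.
have CW : [disjoint C & W].
  rewrite disjoints_subset; apply/subsetP => v vC; rewrite !inE negb_and; apply/orP; right.
  apply/asboolPn => -[_]; rewrite -(component_of_mem symE CS vC) => h.
  by move: h ZCC ZC Zx aN aeN aN0; lra.
have CsubS : C \subset S by case/imsetP: CS => v vS ->; exact: component_sub.
have cards : (#|C| + #|W| + #|exceptional a e S C| = #|S|)%N.
  rewrite -[in RHS](cardsID (C :|: W)); congr addn.
    have -> : S :&: (C :|: W) = C :|: W.
      by apply/setIidPr; rewrite subUset CsubS; apply/subsetP => v; rewrite inE => /andP[].
    by rewrite cardsU (disjoint_setI0 CW) cards0 subn0.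
  apply: eq_card => v; rewrite !inE; case: (v \in S); rewrite /= ?andbF //.
  by rewrite negb_or andbT.
have cardsR : #|C|%:R + #|W|%:R + #|exceptional a e S C|%:R = #|S|%:R :> R.
  by rewrite -!natrD cards.
have exc0 : 0 <= #|exceptional a e S C|%:R :> R by [].
move: cardsR ZCC ZC Zx Sc f1W exc0 aeN; rewrite /c.
set cC : R := #|C|%:R; set cW : R := #|W|%:R; set cE : R := #|exceptional a e S C|%:R.
set cS : R := #|S|%:R; set cZ : R := #|Z|%:R; set cZC : R := #|Z :&: C|%:R.
move=> h1 h2 h3 h4 h5 h6 h7 h8.
have hE : cE <= 5 * (a * N) by lra.
split; last by lra.
split=> // [|C' C'S C'C].
  by rewrite -/cC ler_norml; apply/andP; split; lra.
have small' : #|C'|%:R <= 5 * (a * N).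
  have [v vS C'E] : exists2 v, v \in S & C' = component e S v by case/imsetP: C'S => v; exists v.
  case: (pselect (small_tree a e C')) => [[_ h]|nst]; first by lra.
  apply: le_trans hE; rewrite ler_nat subset_leq_card //; apply/subsetP => u uC'.
  have uE := component_of_mem symE C'S uC'.
  rewrite inE -uE; apply/and3P; split.
  - by move: uC'; rewrite C'E => /(subsetP (component_sub _ _ _)).
  - apply: contra C'C => uC; rewrite (component_of_mem symE CS uC) -uE //.
  - exact/asboolPn.
split; last by lra.
by rewrite -(ltr_nat R) -/cC; lra.
Qed.

End Expectations.

(** * Numerical estimates *)

Section Numeric.
Variable R : realType.
Implicit Types (a l N : R).

Lemma absorb_const (y C : R) m : 0 <= y -> C * y <= 1 -> C * y ^+ m.+1 <= y ^+ m.
Proof. by move=> y0 Cy; rewrite exprS mulrA ler_piMl ?exprn_ge0. Qed.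

Lemma absorb_const_ge (y C : R) m : 0 <= y -> C <= y -> C * y ^+ m <= y ^+ m.+1.
Proof. by move=> y0 Cy; rewrite exprS ler_wpM2r ?exprn_ge0. Qed.

Lemma small_pow a m k : 0 < a < 1 / 200 / 200 / 200 / 200 -> (k <= m)%N -> a ^+ m <= a ^+ k.
Proof. by move=> /andP[a0 a1] km; apply: ler_wiXn2l => //; lra. Qed.

Section Scale.
Variables (a l : R).
Hypotheses (a0 : 0 < a < 1 / 200 / 200 / 200 / 200) (l0 : 0 < l) (al : 2 / l < a).

Lemma al_ge2 : 2 < a * l.
Proof. by rewrite -ltr_pdivrMr. Qed.

Lemma inv_a_le : a^-1 <= l / 2.
Proof.
have /andP[a1 _] := a0; rewrite -[a^-1]mul1r ler_pdivrMr //.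
by have := al_ge2; lra.
Qed.

Lemma l_large : 200 * 200 * 200 * 200 <= l.
Proof.
have /andP[a1 a2] := a0; have := al_ge2.
have : a * l <= 1 / 200 / 200 / 200 / 200 * l by apply: ler_wpM2r; exact: ltW.
lra.
Qed.

Lemma l_ge1 : 1 <= l. Proof. by have := l_large; lra. Qed.

Lemma expR_ge_pow60 : l ^+ 60 <= expR l.
Proof.
have lL := l_large.
have -> : expR l = expR (l / 120) ^+ 120.
  by rewrite -expRM_natl; congr expR; field.
rewrite (_ : 120%N = (2 * 60)%N) // exprM.
apply: lerXn2r; [by rewrite nnegrE ltW|by rewrite nnegrE sqr_ge0|].
have h := expR_ge1Dx (l / (2 * 60)%:R).
have e : ((2 * 60)%:R : R) = 120 by [].
rewrite e in h *.
apply: le_trans (_ : (l / 120) ^+ 2 <= _); last first.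
  by apply: lerXn2r; rewrite ?nnegrE ?expR_ge0; lra.
have -> : (l / 120) ^+ 2 = l * (l / 120 / 120) by field.
by apply: ler_peMr; lra.
Qed.

(** Since a l > 1, every factor [a] costs at most one of the 60 factors [l]. *)
Lemma pow_mul_expR i : (i <= 60)%N -> l ^+ (60 - i) <= a ^+ i * expR l.
Proof.
move=> i60; have /andP[a1 _] := a0.
apply: le_trans (ler_wpM2l (exprn_ge0 i (ltW a1)) expR_ge_pow60).
rewrite -{2}(subnKC i60) exprD mulrA -exprMn ler_peMl ?exprn_ge0 ?(ltW l0) //.
by apply: exprn_ege1; have := al_ge2; lra.
Qed.

Lemma pow_mul_expR_ge (C : R) i j : (j < 60 - i)%N -> (i <= 60)%N -> C <= l ->
  C * l ^+ j <= a ^+ i * expR l.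
Proof.
move=> ij i60 Cl; apply: le_trans (pow_mul_expR i60).
apply: le_trans (absorb_const_ge j (ltW l0) Cl) _.
by apply: ler_weXn2l => //; exact: l_ge1.
Qed.

Lemma expR_sqr_le : expR (- (l ^+ 2 / 2)) <= l ^- 60.
Proof.
have lL := l_large; rewrite expRN lef_pV2 ?posrE ?expR_gt0 ?exprn_gt0 //.
apply: le_trans expR_ge_pow60 _; rewrite ler_expR expr2.
have : l * 2 <= l * l by apply: ler_wpM2l; lra.
lra.
Qed.

(* 2^j / j! <= e^8 / 4^j *)
Lemma factorial_tail (j : nat) : l ^+ 2 < j%:R ->
  2 * expR l * (2 ^+ j / j`!%:R) <= expR (- (l ^+ 2 / 2)).
Proof.
move=> lj; have lL := l_large.
have j0 : (0 < j)%N by rewrite -(ltr_nat R); apply: le_lt_trans lj; exact: sqr_ge0.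
have f0 : 0 < j`!%:R :> R by rewrite ltr0n fact_gt0.
have h8 : 8 ^+ j / j`!%:R <= expR (8 : R).
  have := @expR_ge1Dxn R 8 j.-1 (ler0n _ _); rewrite prednK // => h.
  by apply: le_trans h; rewrite lerDr.
have e4 : expR (1 : R) <= 4 by have := @expR_le_quad R 1 (lexx _); rewrite expr1n; lra.
have e2 : 2 <= expR (1 : R) by have := expR_ge1Dx (1 : R); lra.
have : 2 ^+ j / j`!%:R <= expR 8 * expR (- j%:R) :> R.
  have -> : 2 ^+ j / j`!%:R = (8 ^+ j / j`!%:R) * (4 ^+ j)^-1 :> R.
    have -> : 8 = 2 * 4 :> R by rewrite -natrM.
    rewrite exprMn; field; rewrite !lt0r_neq0 // exprn_gt0 //.
  apply: ler_pM; rewrite ?divr_ge0 ?exprn_ge0 ?invr_ge0 ?exprn_ge0 ?(ltW f0) //.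
  rewrite expRN lef_pV2 ?posrE ?expR_gt0 ?exprn_gt0 //.
  rewrite -[j%:R]mulr1 expRM_natl; apply: lerXn2r => //; rewrite nnegrE ?expR_ge0 //.
move=> h2.
apply: le_trans (ler_wpM2l (mulr_ge0 (ler0n _ 2) (expR_ge0 l)) h2) _.
apply: le_trans (ler_wpM2r (mulr_ge0 (expR_ge0 8) (expR_ge0 _)) (ler_wpM2r (expR_ge0 l) e2)) _.
rewrite -!expRD ler_expR.
have : l * 20 <= l * l by apply: ler_wpM2l; lra.
rewrite expr2 in lj *; lra.
Qed.

End Scale.
End Numeric.

(** * Expectations, tails and assembly at the scale of the theorem *)

Lemma indicator_sub_le (R : realType) (b b1 b2 m : bool) : (~~ b1 -> ~~ b2 -> m -> b) ->
  (~~ b)%:R - b1%:R - b2%:R <= (~~ m)%:R :> R.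
Proof.
rewrite !lerBlDr -!natrD ler_nat.
by case: b; case: b1; case: b2; case: m => //= h; have := h isT isT isT.
Qed.

Lemma expR_union_bound (R : realType) (y w : R) : w <= y ->
  expR (y / 2) * (2 * expR (- y)) <= 2 * expR (- (w / 2)).
Proof. by move=> wy; rewrite mulrCA ler_pM2l // -expRD ler_expR; lra. Qed.

(** The density left for the first round after two sprinklings of density [r]: it solves (1 - q) (1
    - r)^2 = 1 - p. *)
Lemma sprinkle_prob (R : realType) (p r : R) : 0 <= r -> 2 * r <= p -> p < 1 ->
  exists q, [/\ 0 <= q <= 1, p - 2 * r <= q, q <= p &
    (q + r - q * r) + r - (q + r - q * r) * r = p].
Proof.
move=> r0 rp p1; have r1 : 0 < 1 - r by lra.
have r2 : 0 < (1 - r) ^+ 2 by rewrite exprn_gt0.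
have sq : (1 - r) ^+ 2 = 1 - 2 * r + r ^+ 2 by ring.
have rr0 : 0 <= r ^+ 2 by exact: sqr_ge0.
have rr : r ^+ 2 <= r by rewrite expr2; apply: ler_piMr; lra.
have up : 1 - p <= (1 - p) / (1 - r) ^+ 2 by rewrite ler_pdivlMr //; apply: ler_piMr; lra.
have lo : (1 - p) / (1 - r) ^+ 2 <= 1 - p + 2 * r.
  rewrite ler_pdivrMr //.
  have -> : (1 - p + 2 * r) * (1 - r) ^+ 2 =
    1 - p + 2 * (r * (p - 2 * r)) + (1 - p + 2 * r) * r ^+ 2 by ring.
  have : 0 <= r * (p - 2 * r) by apply: mulr_ge0; lra.
  have : 0 <= (1 - p + 2 * r) * r ^+ 2 by apply: mulr_ge0; lra.
  lra.
exists (1 - (1 - p) / (1 - r) ^+ 2); split; [apply/andP; split; lra|lra|lra|].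
by field; rewrite lt0r_neq0.
Qed.

(* Here [l] is ln N. As [a * l > 2] and [l] is huge, N dominates every product of constants
   and at most 59 factors [l] or [a^-1], which absorbs all constants below. *)
Section Estimates.
Variables (R : realType) (T : finType) (e : rel T) (d : nat) (lambda eps x a l : R).
Hypotheses (symE : symmetric e) (irrE : irreflexive e) (reg : regular e d).
Hypotheses (lam0 : 0 <= lambda) (d0 : (0 < d)%N).
Hypothesis mix : forall f g : T -> R,
  `| \sum_u \sum_v (e u v)%:R * f u * g v
     - d%:R / #|T|%:R * (\sum_u f u) * (\sum_v g v) | <=
  lambda * (Num.sqrt (\sum_u f u ^+ 2) * Num.sqrt (\sum_v g v ^+ 2)).
Hypotheses (e0 : 0 < eps < 1 / 200) (a0 : 0 < a < eps ^+ 4).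
Hypotheses (gx : giant_density eps x) (x1 : 5 / 4 * eps <= x) (x2 : x <= 5 * eps).
Hypotheses (l0 : 0 < l) (al : 2 / l < a).
Hypothesis NE : #|T|%:R / d%:R = expR l.
Hypothesis dl : lambda / d%:R <= a ^+ 30.
Hypothesis dlk : forall k : nat, k%:R <= a^-1 -> (1 + eps) ^+ k * (lambda / d%:R) <= a ^+ 30.

Let dR : R := d%:R.
Let N : R := #|T|%:R / dR.
Let rho := x / (1 + eps).

Let a1 : 0 < a < 1 / 200 / 200 / 200 / 200.
Proof. by have [_ h] := alpha_small e0 a0; have /andP[-> _] := a0. Qed.
Let dR0 : 0 < dR. Proof. by rewrite ltr0n. Qed.
Let ap : 0 < a. Proof. by have /andP[] := a0. Qed.
Let N0 : 0 < N. Proof. by rewrite /N NE expR_gt0. Qed.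

Let T0 : (0 < #|T|)%N.
Proof.
rewrite lt0n; apply/negP => /eqP T0; move: N0; rewrite /N T0 mul0r ltxx //.
Qed.

Let nE : #|T|%:R = dR * N. Proof. by rewrite /N mulrC divfK // lt0r_neq0. Qed.

Lemma density_le (C : R) i : (i < 60)%N -> 0 < C <= l -> dR / #|T|%:R <= a ^+ i / C.
Proof.
move=> i60 /andP[C0 Cl].
have -> : dR / #|T|%:R = N^-1 by rewrite /N invf_div.
rewrite ler_pdivlMr // mulrC ler_pdivrMr //.
have := @pow_mul_expR_ge _ a l a1 l0 al C i 0 _ (ltnW i60) Cl.
by rewrite subn_gt0 i60 expr0 mulr1 /N NE; apply.
Qed.

Lemma lambda_sqr_le : (lambda / dR) ^+ 2 <= a ^+ 60.
Proof.
rewrite (_ : 60%N = (30 * 2)%N) // exprM; apply: lerXn2r => //; rewrite nnegrE.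
  by rewrite divr_ge0 // ltW.
by rewrite exprn_ge0 // ltW.
Qed.

Lemma inv_degree_le : dR^-1 <= a ^+ 59.
Proof.
have l1 := l_large a1 l0 al.
have half : dR / #|T|%:R <= 1 / 2.
  by apply: (@density_le 2 0) => //; apply/andP; split; lra.
have h := degree_le_lambda reg lam0 d0 mix T0 half; rewrite -/dR in h.
have : dR^-1 <= 4 * (lambda / dR) ^+ 2.
  rewrite -[leLHS]mul1r ler_pdivrMr // expr_div_n.
  have -> : 4 * (lambda ^+ 2 / dR ^+ 2) * dR = 4 * lambda ^+ 2 / dR by field; rewrite lt0r_neq0.
  by rewrite ler_pdivlMr // mul1r.
move/le_trans; apply; apply: le_trans (_ : 4 * a ^+ 60 <= _).
  by apply: ler_wpM2l => //; exact: lambda_sqr_le.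
by apply: absorb_const; [exact: ltW|have /andP[_ ?] := a1; lra].
Qed.

Lemma reach_large (p : R) (k2 : nat) v : 0 <= p <= 1 ->
  1 + eps - a / 5 <= p * dR -> p * dR <= 1 + eps -> k2%:R * a ^+ 16 <= 2 ->
  rho - 7 / 4 * a - a ^+ 2 <=
  Pr p (fun S => (k2 <= #|reach e [set v] (S :&: [set~ v])|)%N).
Proof.
move=> p01 pd1 pd2 hk2; have /andP[p0 p1] := p01.
have /andP[_ as1] := a1; have /andP[eps0 eps1] := e0.
have [r1 r2 r3] := rho_bounds e0 x1 x2; rewrite -/rho in r1 r2 r3.
have [as2 _] := alpha_small e0 a0; have l1 := l_large a1 l0 al.
pose g := a ^+ 18 * dR; pose bad u w := g < #|nb e u :&: nb e w|%:R.
(* The cutoff a^18 balances two losses. About a^-16 overlaps of size a^18 d remove only 2 a^2 d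
   neighbours, and (lambda/d)^2 <= a^60 still leaves a^24 after division by a^36, so meeting a bad
   pair costs at most 72 a^8 <= a^2. *)
pose b := 4 * (lambda / dR) ^+ 2 * dR / (a ^+ 18) ^+ 2.
pose h := rho - 7 / 4 * a; pose q := 1 - h.
pose m := dR - 1 - k2%:R * g.
have h0 : 0 <= h by rewrite /h; lra.
have h1 : h <= 1 by rewrite /h; lra.
have a16 : 0 <= a ^+ 16 by rewrite exprn_ge0 // ltW.
have a18 : 0 < a ^+ 18 by rewrite exprn_gt0.
have kg : k2%:R * g <= 2 * a ^+ 2 * dR.
  have -> : k2%:R * g = k2%:R * a ^+ 16 * (a ^+ 2 * dR) by rewrite /g [a ^+ 18](exprD a 16 2); ring.
  rewrite -[leRHS]mulrA; apply: ler_wpM2r => //.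
  by rewrite mulr_ge0 ?sqr_ge0 // ltW.
have pm : 1 + eps - a / 4 <= p * m.
  have d1 : p <= 2 * a ^+ 2.
    apply: le_trans (_ : p * dR * dR^-1 <= _); first by rewrite mulfK // lt0r_neq0.
    apply: ler_pM => //; rewrite ?mulr_ge0 ?invr_ge0 ?(ltW dR0) //; first by lra.
    by apply: le_trans inv_degree_le _; exact: small_pow.
  have : p * (k2%:R * g) <= p * (2 * a ^+ 2 * dR) by exact: ler_wpM2l.
  have : p * dR * (2 * a ^+ 2) <= 2 * (2 * a ^+ 2).
    by apply: ler_wpM2r; [rewrite mulr_ge0 ?sqr_ge0|lra].
  have : a ^+ 2 <= a * (1 / 200) by rewrite expr2; apply: ler_wpM2l; [exact: ltW|lra].
  rewrite /m; move: (k2%:R * g) => z; lra.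
apply: le_trans (@reach_lower R T e d p irrE reg p01 bad b g q m k2 v _ _ _ _ (lexx _) _ _ _).
- have -> : 1 - q - p * ((1 + 4 * k2%:R) * b) =
    rho - 7 / 4 * a - p * ((1 + 4 * k2%:R) * b) by rewrite /q /h; ring.
  rewrite lerD2l lerN2.
  have -> : p * ((1 + 4 * k2%:R) * b) =
     (p * dR) * (4 * ((1 + 4 * k2%:R) * ((lambda / dR) ^+ 2 / (a ^+ 18) ^+ 2))).
    by rewrite /b; ring.
  have b1 : (lambda / dR) ^+ 2 / (a ^+ 18) ^+ 2 <= a ^+ 24.
    rewrite ler_pdivrMr ?exprn_gt0 // -exprM -exprD; exact: lambda_sqr_le.
  have k0 : 0 <= 1 + 4 * k2%:R :> R by rewrite addr_ge0.
  have b2 : (1 + 4 * k2%:R) * a ^+ 24 <= 9 * a ^+ 8.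
    have -> : (1 + 4 * k2%:R) * a ^+ 24 = (a ^+ 16 + 4 * (k2%:R * a ^+ 16)) * a ^+ 8.
      by rewrite (exprD a 16 8); ring.
    apply: ler_wpM2r; first by rewrite exprn_ge0 // ltW.
    have : a ^+ 16 <= a ^+ 0 by exact: small_pow.
    rewrite expr0; lra.
  have b3 : (1 + 4 * k2%:R) * ((lambda / dR) ^+ 2 / (a ^+ 18) ^+ 2) <= 9 * a ^+ 8.
    by apply: le_trans b2; exact: ler_wpM2l.
  have b4 : 2 * (4 * (9 * a ^+ 8)) <= a ^+ 2.
    have -> : 2 * (4 * (9 * a ^+ 8)) = 72 * a ^+ 8 by ring.
    apply: le_trans (absorb_const 7 (ltW ap) _) _; first by lra.
    exact: small_pow.
  have Q0 : 0 <= (1 + 4 * k2%:R) * ((lambda / dR) ^+ 2 / (a ^+ 18) ^+ 2).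
    by rewrite mulr_ge0 // divr_ge0 ?sqr_ge0.
  have pd0 : 0 <= p * dR by rewrite mulr_ge0 // ltW.
  move: b3 Q0; set Q := (1 + _) * _ => b3 Q0.
  have pd3 : p * dR <= 2 by lra.
  apply: le_trans b4; apply: (ler_pM pd0 (mulr_ge0 (ler0n _ 4) Q0) pd3).
  exact: ler_wpM2l.
- by move=> u w; rewrite /bad setIC.
- move=> u; apply: card_bad_pairs => //.
  by apply: density_le => //; apply/andP; split; lra.
- by move=> u w _; rewrite -leNgt.
- by rewrite /g mulr_ge0 // ltW.
- by rewrite /q; apply/andP; split; lra.
- move=> j mj; rewrite (_ : p * q + (1 - p) = 1 - p * h); last by rewrite /q; ring.
  have ph1 : p * h <= 1 by rewrite -[leRHS]mulr1; apply: ler_pM.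
  apply: le_trans (_ : expR (- (p * h)) ^+ j <= _).
    by apply: lerXn2r; rewrite ?nnegrE ?subr_ge0 ?expR_ge0 ?expR_ge1Dx.
  rewrite -expRM_natl.
  apply: le_trans (lower_fixpoint e0 a0 gx x1 x2 pm); rewrite -/rho -/h ler_expR.
  rewrite mulrN lerN2 (_ : j%:R * (p * h) = p * h * j%:R); last by ring.
  rewrite (_ : p * m * h = p * h * m); last by ring.
  by apply: ler_wpM2l => //; rewrite mulr_ge0.
- by rewrite -/dR; lra.
Qed.

Lemma expR_half_ge : l ^+ 30 <= expR (l / 2).
Proof.
rewrite -(@ler_pXn2r _ 2) ?nnegrE ?expR_ge0 ?exprn_ge0 ?(ltW l0) //.
rewrite -exprM -expRM_natl (_ : 2 * (l / 2) = l); last by field.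
exact: (expR_ge_pow60 a1 l0 al).
Qed.

(** The two summands use different hypotheses. As k <= 1/a <= l/2, the growth (1 + eps)^k is at most
    sqrt N, which N dominates; in the summand with lambda/d the growth is absorbed by the spectral
    gap. *)
Lemma cyclic_small_bound (k : nat) : k%:R <= a^-1 ->
  k%:R ^+ 2 * (1 + eps) ^+ k * (1 + N * (lambda / dR)) <= a / 4 * N.
Proof.
move=> ka; have /andP[eps0 eps1] := e0; have /andP[_ as1] := a1.
have l1 := l_large a1 l0 al; have al2 := al_ge2 l0 al; have ial := inv_a_le a1 l0 al.
have k0 : 0 <= k%:R :> R by [].
have ck0 : 0 <= (1 + eps) ^+ k by rewrite exprn_ge0 // addr_ge0 // ltW.
have k2l : k%:R ^+ 2 <= l ^+ 2 by apply: lerXn2r; rewrite ?nnegrE; lra.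
have ckE : (1 + eps) ^+ k <= expR (l / 2).
  apply: le_trans (_ : expR eps ^+ k <= _).
    by apply: lerXn2r; rewrite ?nnegrE ?expR_ge0 ?expR_ge1Dx // addr_ge0 // ltW.
  rewrite -expRM_natl ler_expR.
  have : k%:R * eps <= k%:R * 1 by apply: ler_wpM2l; lra.
  lra.
have part1 : k%:R ^+ 2 * (1 + eps) ^+ k <= a / 8 * N.
  apply: le_trans (ler_pM (sqr_ge0 _) ck0 k2l ckE) _.
  have -> : N = expR (l / 2) * expR (l / 2).
    by rewrite -expRD /N NE; congr expR; field.
  rewrite mulrA; apply: ler_wpM2r; first exact: expR_ge0.
  have a8 : 0 <= a / 8 by rewrite divr_ge0 // ltW.
  apply: le_trans (ler_wpM2l a8 expR_half_ge).
  have -> : l ^+ 30 = l * l ^+ 29 by rewrite exprS.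
  rewrite mulrA; apply: le_trans (_ : 2 / 8 * l ^+ 29 <= _); last first.
    by apply: ler_wpM2r; [rewrite exprn_ge0 // ltW|lra].
  have : 8 * l ^+ 2 <= l ^+ 3 by apply: absorb_const_ge; lra.
  have : l ^+ 3 <= l ^+ 29 by apply: ler_weXn2l => //; lra.
  have : 0 <= l ^+ 2 by exact: sqr_ge0.
  lra.
have part2 : k%:R ^+ 2 * ((1 + eps) ^+ k * (lambda / dR)) <= a / 8.
  apply: le_trans (ler_wpM2l (sqr_ge0 _) (dlk ka)) _.
  have -> : k%:R ^+ 2 * a ^+ 30 = (k%:R * a) ^+ 2 * a ^+ 28.
    by rewrite (exprD a 2 28); ring.
  have ka1 : k%:R * a <= 1 by rewrite -ler_pdivlMr // div1r.
  have : (k%:R * a) ^+ 2 <= 1 by rewrite expr_le1 // mulr_ge0 // ltW.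
  move/(ler_wpM2r (exprn_ge0 28 (ltW ap))); rewrite mul1r => /le_trans; apply.
  have : a ^+ 28 <= a ^+ 2 by exact: small_pow.
  have : a ^+ 2 <= a * (1 / 8) by rewrite expr2; apply: ler_wpM2l; [exact: ltW|lra].
  lra.
have := ler_wpM2r (ltW N0) part2.
lra.
Qed.

Lemma Ex_small_trees (p : R) : p * dR = 1 + eps -> 0 < p <= 1 ->
  (1 + eps - x - a / 2) * N <=
  Ex p (fun S => (ncomp e (fun C => `[< small_tree a e C >]) S)%:R).
Proof.
move=> pd p01; have /andP[p0 p1] := p01; have p01' : 0 <= p <= 1 by rewrite ltW.
have /andP[eps0 eps1] := e0; have /andP[_ as1] := a1.
have [r1 r2 r3] := rho_bounds e0 x1 x2; rewrite -/rho in r1 r2 r3.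
have [as2 _] := alpha_small e0 a0.
pose k := Num.truncn (a^-1).
have /andP[kl ku] : k%:R <= a^-1 < k.+1%:R by apply: truncn_itv; rewrite invr_ge0 ltW.
have a2 : a ^+ 2 <= a * (1 / 200) by rewrite expr2; apply: ler_wpM2l; [exact: ltW|lra].
have a20 := sqr_ge0 a.
have main : (1 + eps - x - a / 4) * N <= Ex p (fun S => (ncomp e (fun C => (#|C| <= k)%N) S)%:R).
  (* One a^2 is the shift of the survival fixpoint, the other bounds the walks that die out only
     after k + 1 steps. *)
  rewrite Ex_ncomp; apply: le_trans (_ : \sum_(v : T) p * (1 - rho - 2 * a ^+ 2) <= _).
    rewrite sumr_const -(mulr_natl (p * _)) nE.
    have -> : dR * N * (p * (1 - rho - 2 * a ^+ 2)) = (1 + eps - x - 2 * (1 + eps) * a ^+ 2) * N.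
      have -> : dR * N * (p * (1 - rho - 2 * a ^+ 2)) = p * dR * (1 - rho - 2 * a ^+ 2) * N by ring.
      by rewrite pd -r3; ring.
    apply: ler_wpM2r; first exact: ltW.
    have : eps * a ^+ 2 <= 1 * a ^+ 2 by apply: ler_wpM2r; lra.
    lra.
  apply: ler_sum => v _; apply: ler_wpM2l; first exact: ltW.
  have -> : Pr p (fun S => (#|reach e [set v] (S :&: [set~ v])| <= k)%N) =
      1 - Pr p (fun S => (k.+1 <= #|reach e [set v] (S :&: [set~ v])|)%N).
    by rewrite -PrC; apply: eq_Ex => S; rewrite -leqNgt.
  have dis : [disjoint [set v] & [set~ v]] by rewrite disjoints_subset setCK.
  have up := reach_upper irrE reg p01' k.+1 dis; rewrite cards1 in up.
  have pa : 16 * p <= a ^+ 2 * eps.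
    have : p <= 2 * a ^+ 4.
      apply: le_trans (_ : p * dR * dR^-1 <= _); first by rewrite mulfK // lt0r_neq0.
      apply: ler_pM; rewrite ?pd ?invr_ge0 ?(ltW dR0) //; [lra|lra|].
      by apply: le_trans inv_degree_le _; exact: small_pow.
    have : a ^+ 4 <= a ^+ 2 * (eps * (1 / 200)).
      rewrite (exprD a 2 2); apply: ler_wpM2l => //; apply: le_trans a2 _.
      by apply: ler_wpM2r; lra.
    have : 0 <= a ^+ 2 * eps by rewrite mulr_ge0 // ltW.
    lra.
  pose q := 1 - (rho + a ^+ 2).
  have q0 : 0 <= q <= 1 - eps by apply/andP; rewrite /q; split; lra.
  have := gw_le p01' q0 (expR_ge0 _) (upper_fixpoint e0 a0 gx x1 x2 pd p0 pa)
     (subcritical_fixpoint e0 pd p01) k.+1 1.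
  rewrite !expr1 => gwk; have ext := extinction_tail e0 a0 ku.
  have : expR (- (eps ^+ 2 / 8)) ^+ k.+1 * (1 - eps) <= a ^+ 2 * 1.
    by apply: ler_pM; [rewrite exprn_ge0 // expR_ge0|lra|exact: ext|lra].
  rewrite /q -/rho in gwk *; move: up gwk; set X := gw _ _ _ _; set Y := Pr _ _.
  set Z := _ * (1 - eps); lra.
have cyc := Ex_cyclic_small symE reg p01' lam0 d0 mix k (_ : p * d%:R <= 1 + eps) _.
have {}cyc := cyc _ _; rewrite -/dR in cyc.
have c1 : 1 <= 1 + eps by lra.
have {}cyc := le_trans (cyc (_ : p * dR <= 1 + eps) c1) (cyclic_small_bound kl).
rewrite pd in cyc; have {}cyc := cyc (lexx _).
have : Ex p (fun S => (ncomp e (fun C => (#|C| <= k)%N) S)%:R) <=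
   Ex p (fun S => (ncomp e (fun C => `[< small_tree a e C >]) S)%:R) +
   Ex p (fun S => (cyclic_small e k S)%:R).
  rewrite -ExD; apply: Ex_le => // S; rewrite -natrD ler_nat.
  exact: small_tree_ncomp.
move: main cyc; set X := Ex _ _; set Y := Ex _ _; set Z := Ex _ _; lra.
Qed.

Lemma Ex_small_components (p : R) (k2 : nat) : 0 <= p <= 1 ->
  1 + eps - a / 5 <= p * dR -> p * dR <= 1 + eps -> k2%:R * a ^+ 16 <= 2 ->
  Ex p (fun S => (ncomp e (fun C => (#|C| < k2)%N) S)%:R) <=
  #|T|%:R * p - (x - 2 * a) * N.
Proof.
move=> p01 pd1 pd2 hk2; have /andP[p0 p1] := p01.
have /andP[eps0 eps1] := e0; have /andP[_ as1] := a1.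
have [r1 r2 r3] := rho_bounds e0 x1 x2; rewrite -/rho in r1 r2 r3.
have [as2 _] := alpha_small e0 a0.
have a2 : a ^+ 2 <= a * (1 / 200) by rewrite expr2; apply: ler_wpM2l; [exact: ltW|lra].
have a20 := sqr_ge0 a.
rewrite Ex_ncomp; apply: le_trans (_ : \sum_(v : T) p * (1 - (rho - 7 / 4 * a - a ^+ 2)) <= _).
  apply: ler_sum => v _; apply: ler_wpM2l => //.
  have -> : Pr p (fun S => (#|reach e [set v] (S :&: [set~ v])| < k2)%N) =
      1 - Pr p (fun S => (k2 <= #|reach e [set v] (S :&: [set~ v])|)%N).
    by rewrite -PrC; apply: eq_Ex => S; rewrite -ltnNge.
  by have := reach_large v p01 pd1 pd2 hk2; set X := Pr _ _; lra.
rewrite sumr_const -(mulr_natl (p * _)) nE.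
have -> : dR * N * (p * (1 - (rho - 7 / 4 * a - a ^+ 2))) =
   dR * N * p - p * dR * (rho - 7 / 4 * a - a ^+ 2) * N by ring.
rewrite lerD2l lerN2; apply: ler_wpM2r; first exact: ltW.
have h0 : 0 <= rho - 7 / 4 * a - a ^+ 2 by lra.
apply: le_trans (ler_wpM2r h0 pd1).
have : a * rho <= a * (5 / 200) by apply: ler_wpM2l; [exact: ltW|lra].
have : eps * a <= 1 / 200 * a by apply: ler_wpM2r; [exact: ltW|lra].
have : eps * a ^+ 2 <= 1 * a ^+ 2 by apply: ler_wpM2r; lra.
have : 0 <= a * a ^+ 2 by rewrite mulr_ge0 // ltW.
have : (1 + eps - a / 5) * (rho - 7 / 4 * a - a ^+ 2) =
  x - 7 / 4 * a - 7 / 4 * (eps * a) - a ^+ 2 - eps * a ^+ 2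
  - (a * rho) / 5 + 7 / 20 * a ^+ 2 + (a * a ^+ 2) / 5 by rewrite -r3; field.
move=> ->; lra.
Qed.

Let l1 : 200 * 200 * 200 * 200 <= l. Proof. exact: l_large a1 l0 al. Qed.

(** All deviations are of order a N, or a n for [excess], and after scaling every tail exponent has
    this form; the Lipschitz constants contribute the powers of [l]. *)
Lemma exponent_ge (C : R) j : 0 < C -> C <= l -> (j < 56)%N ->
  l ^+ 2 / 2 <= a ^+ 2 * N / (C * l ^+ j).
Proof.
move=> C0 Cl j56; rewrite ler_pdivlMr ?mulr_gt0 ?exprn_gt0 //.
have h := @pow_mul_expR_ge _ a l a1 l0 al C 2 (j + 2) _ isT Cl; rewrite -NE -/dR -/N in h.
have j58 : (j + 2 < 60 - 2)%N by rewrite -(ltn_add2r 2) in j56.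
apply: le_trans (h j58).
have -> : l ^+ 2 / 2 * (C * l ^+ j) = C * l ^+ (j + 2) / 2 by rewrite exprD; field.
have : 0 <= C * l ^+ (j + 2) by rewrite mulr_ge0 ?exprn_ge0 // ltW.
by set X := C * _; lra.
Qed.

Lemma card_lipschitz : lipschitz (1 : R) (fun S : {set T} => #|S|%:R).
Proof.
move=> v S vS; rewrite cardsU1 vS natrD.
have -> : true%:R + #|S|%:R - #|S|%:R = 1 :> R by rewrite [true%:R]mulr1n; ring.
by rewrite normr1.
Qed.

Section FixedDensity.
Variable p : R.
Hypotheses (p01 : 0 <= p <= 1) (pd : p * dR <= 2).

Lemma mean_le : #|T|%:R * p <= 2 * N.
Proof. by rewrite nE mulrC mulrA; apply: ler_wpM2r => //; exact: ltW. Qed.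

Lemma Ex_card : Ex p (fun S : {set T} => #|S|%:R) = #|T|%:R * p.
Proof.
rewrite mulrC -cardsT -Ex_cardI; apply: eq_Ex => S; by rewrite setIT.
Qed.

Lemma card_upper_tail :
  Pr p (fun S : {set T} => #|T|%:R * p + a / 10 * N <= #|S|%:R) <= expR (- (l ^+ 2 / 2)).
Proof.
have /andP[_ as1] := a1.
have V0 : 0 < 2 * N by rewrite mulr_gt0.
have t0 : 0 <= a / 10 * N <= 4 * (2 * N) * 1.
  rewrite mulr_ge0 ?divr_ge0 ?(ltW ap) ?(ltW N0) //= mulr1 mulrA.
  by apply: ler_wpM2r; [exact: ltW|lra].
have := lipschitz_upper_tail p01 ltr01 V0 mean_le t0 card_lipschitz.
rewrite Ex_card => /le_trans; apply; rewrite ler_expR lerN2.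
have lL := l1; apply: le_trans (@exponent_ge (16 * 100) 0 _ _ _) _; [lra|lra|by []|].
rewrite le_eqVlt; apply/orP; left; apply/eqP; rewrite expr0.
by field; rewrite lt0r_neq0.
Qed.

Lemma card_lower_tail :
  Pr p (fun S : {set T} => #|S|%:R <= #|T|%:R * p - a / 10 * N) <= expR (- (l ^+ 2 / 2)).
Proof.
have /andP[_ as1] := a1.
have V0 : 0 < 2 * N by rewrite mulr_gt0.
have t0 : 0 <= a / 10 * N <= 4 * (2 * N) * 1.
  rewrite mulr_ge0 ?divr_ge0 ?(ltW ap) ?(ltW N0) //= mulr1 mulrA.
  by apply: ler_wpM2r; [exact: ltW|lra].
have := lipschitz_lower_tail p01 ltr01 V0 mean_le t0 card_lipschitz.
rewrite Ex_card => /le_trans; apply; rewrite ler_expR lerN2.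
have lL := l1; apply: le_trans (@exponent_ge (16 * 100) 0 _ _ _) _; [lra|lra|by []|].
rewrite le_eqVlt; apply/orP; left; apply/eqP; rewrite expr0.
by field; rewrite lt0r_neq0.
Qed.

(** The cap 100/a makes the mean at most a n/50. With the deviation it stays below a n/20, half of
    the a n/10 edge ends at a set of a N/10 vertices. *)
Lemma excess_tail :
  Pr p (fun S => a / 20 * #|T|%:R <= excess e (100 / a) S) <= expR (- (l ^+ 2 / 2)).
Proof.
have /andP[_ as1] := a1; have M0 : 0 < 100 / a by rewrite divr_gt0.
have V0 : 0 < 2 * N by rewrite mulr_gt0.
have n0 : 0 <= #|T|%:R :> R by [].
have t0 : 0 <= a / 50 * #|T|%:R <= 4 * (2 * N) * dR.
  rewrite mulr_ge0 ?divr_ge0 ?(ltW ap) //= nE.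
  have -> : 4 * (2 * N) * dR = 8 * (dR * N) by ring.
  by apply: ler_wpM2r; [rewrite mulr_ge0 // ltW|lra].
have := lipschitz_upper_tail p01 dR0 V0 mean_le t0 (excess_lipschitz symE reg (100 / a)).
have EE := Ex_excess reg p01 M0 pd.
move=> h; apply: le_trans (le_trans (Pr_le _ _) h) _ => //.
  move=> S hS; apply: le_trans hS; apply: le_trans (lerD EE (lexx _)) _.
  have -> : #|T|%:R * (2 / (100 / a)) = a / 50 * #|T|%:R by field; rewrite lt0r_neq0.
  have : 0 <= a * #|T|%:R by rewrite mulr_ge0 // ltW.
  set y := #|T|%:R; lra.
rewrite ler_expR lerN2.
have lL := l1; apply: le_trans (@exponent_ge (16 * 50 * 50) 0 _ _ _) _; [lra|lra|by []|].
rewrite le_eqVlt; apply/orP; left; apply/eqP; rewrite expr0 nE.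
by field; rewrite !lt0r_neq0.
Qed.

(** Large enough for the factorial in the star count to bring the failure down to exp(-l^2/2), small
    enough for a Lipschitz constant polynomial in [l]. *)
Let M := Num.truncn (l ^+ 2).

Lemma max_deg_tail : Pr p (fun S => ~~ max_deg e M S) <= expR (- (l ^+ 2 / 2)).
Proof.
have /andP[p0 p1] := p01; have pd0 : 0 <= p * dR by rewrite mulr_ge0 // ltW.
have /andP[_ Ml] : M%:R <= l ^+ 2 < M.+1%:R by apply: truncn_itv; exact: sqr_ge0.
apply: le_trans (Pr_max_deg irrE reg p01 M) _.
apply: le_trans (factorial_tail a1 l0 al Ml); rewrite -NE -/dR -/N.
have f0 : 0 <= M.+1`!%:R^-1 :> R by rewrite invr_ge0.
apply: ler_pM; [by rewrite mulr_ge0| |exact: mean_le|].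
  by rewrite mulr_ge0 // exprn_ge0.
apply: ler_wpM2r => //; apply: lerXn2r; rewrite ?nnegrE //.
Qed.

Variables (Q : pred {set T}) (k : nat).
Hypotheses (Qk : forall C, Q C -> (#|C| <= k)%N) (ka : k%:R * a ^+ 16 <= 2).

Lemma ncomp_tails :
  Pr p (fun S => Ex p (fun S => (ncomp e Q S)%:R) + a / 10 * N <= (ncomp e Q S)%:R) <=
    2 * expR (- (l ^+ 2 / 2)) /\
  Pr p (fun S => (ncomp e Q S)%:R <= Ex p (fun S => (ncomp e Q S)%:R) - a / 10 * N) <=
    2 * expR (- (l ^+ 2 / 2)).
Proof.
have /andP[p0 p1] := p01; have /andP[_ as1] := a1; have al2 := al_ge2 l0 al.
have lL := l1; have lg1 : 1 <= l by lra.
have l18 : 1 <= l ^+ 18 by exact: exprn_ege1.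
have l0' := ltW l0.
have V0 : 0 < 2 * N by rewrite mulr_gt0.
have t0 : 0 <= a / 10 * N <= 8 * (2 * N) * l ^+ 18.
  rewrite mulr_ge0 ?divr_ge0 ?(ltW ap) ?(ltW N0) //=.
  have -> : 8 * (2 * N) * l ^+ 18 = 16 * l ^+ 18 * N by ring.
  by apply: ler_wpM2r; [exact: ltW|lra].
have /andP[Ml _] : M%:R <= l ^+ 2 < M.+1%:R by apply: truncn_itv; exact: sqr_ge0.
(* The cap gives M + 1 <= 2 l^2, and a l > 2 turns k <= 2 a^-16 into a small multiple of l^16. *)
have Lb : (M.+1 * k)%:R <= l ^+ 18 :> R.
  rewrite natrM -natr1.
  have l21 : 1 <= l ^+ 2 by exact: exprn_ege1.
  have kl : k%:R <= 2 * (l ^+ 16 / 16).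
    have a16 : 0 < a ^+ 16 by rewrite exprn_gt0.
    rewrite -(ler_pM2r a16); apply: le_trans ka _.
    have -> : 2 * (l ^+ 16 / 16) * a ^+ 16 = 2 * ((a * l) ^+ 16 / 16) by rewrite exprMn; field.
    have : 2 ^+ 16 <= (a * l) ^+ 16 by apply: lerXn2r; rewrite ?nnegrE; lra.
    have -> : 2 ^+ 16 = 2 ^+ 4 * 2 ^+ 12 :> R by rewrite -exprD.
    have : 1 <= 2 ^+ 12 :> R by apply: exprn_ege1; lra.
    have -> : 2 ^+ 4 = 16 :> R by rewrite -natrX.
    set X := 2 ^+ 12; set Y := (a * l) ^+ 16; lra.
  have M2 : M%:R + 1 <= 2 * l ^+ 2 by lra.
  have M0 : 0 <= M%:R + 1 :> R by rewrite addr_ge0.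
  apply: le_trans (ler_pM M0 (ler0n _ _) M2 kl) _.
  have -> : 2 * l ^+ 2 * (2 * (l ^+ 16 / 16)) = l ^+ 18 / 4 by rewrite (exprD l 2 16); field.
  lra.
have PG := max_deg_tail.
have small : l ^+ 18 * Ex p (fun S : {set T} => #|S|%:R * (~~ max_deg e M S)%:R) <= a / 10 * N / 2.
  (* Truncation at |S| = N l^21 leaves 6 N/l^3 from the second moment and N l^-21 from the rare
     event, both far below a N/20. *)
  have Y0 : 0 < N * l ^+ 21 by rewrite mulr_gt0 ?exprn_gt0.
  have := Ex_card_truncated (fun S => ~~ max_deg e M S) p01 Y0.
  have mp : p * #|T|%:R <= 2 * N by rewrite mulrC mean_le.
  have mp0 : 0 <= p * #|T|%:R by rewrite mulr_ge0.
  have N1 : 1 <= N.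
    by have := expR_ge1Dx l; rewrite /N NE; lra.
  have sq : (p * #|T|%:R) ^+ 2 + p * #|T|%:R <= 6 * N ^+ 2.
    have : (p * #|T|%:R) ^+ 2 <= (2 * N) ^+ 2 by apply: lerXn2r; rewrite ?nnegrE //; lra.
    have : N * 1 <= N * N by apply: ler_wpM2l; lra.
    rewrite exprMn -[N * N]expr2; lra.
  move=> /(ler_wpM2l (exprn_ge0 18 l0')) /le_trans; apply.
  have P60 : Pr p (fun S => ~~ max_deg e M S) <= l ^- 60.
    exact: le_trans PG (expR_sqr_le a1 l0 al).
  apply: le_trans (_ : l ^+ 18 * (6 * N ^+ 2 / (N * l ^+ 21) + N * l ^+ 21 * l ^- 60) <= _).
    apply: ler_wpM2l; first by rewrite exprn_ge0.
    apply: lerD; first by apply: ler_wpM2r; rewrite // invr_ge0 ltW.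
    by apply: ler_wpM2l => //; exact: ltW.
  have ln0 : l != 0 by rewrite lt0r_neq0.
  have Nn0 : N != 0 by rewrite lt0r_neq0.
  have -> : l ^+ 18 * (6 * N ^+ 2 / (N * l ^+ 21) + N * l ^+ 21 * l ^- 60) =
     (6 / l ^+ 3 + l ^- 21) * N.
    rewrite (_ : l ^- 60 = l ^- 21 * l ^- 39); last by rewrite -invfM -exprD.
    rewrite (_ : l ^+ 18 * _ = 6 * (l ^+ 18 / l ^+ 21) * N + l ^- 21 * N * (l ^+ 39 / l ^+ 39)); last first.
      rewrite (exprD l 18 21); field; by rewrite Nn0 ln0.
    rewrite divff ?expf_neq0 // (exprD l 18 3).
    rewrite (_ : l ^+ 18 / _ = l ^- 3); last by field; rewrite ln0.
    by ring.
  rewrite (_ : a / 10 * N / 2 = a / 20 * N); last by field.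
  apply: ler_wpM2r; first exact: ltW.
  have i0 : 0 < l^-1 by rewrite invr_gt0.
  have h21 : l ^- 21 <= l^-1.
    rewrite lef_pV2 ?posrE ?exprn_gt0 // -[leLHS]expr1.
    exact: ler_weXn2l.
  have i1 : l^-1 <= 1 / 200 / 200 / 200.
    rewrite -[leLHS]mul1r ler_pdivrMr //; lra.
  have h3 : 6 / l ^+ 3 <= 6 * (l^-1 * (1 / 200 / 200 / 200)).
    rewrite -exprVn; apply: ler_wpM2l => //.
    rewrite exprS; apply: ler_wpM2l; first exact: ltW.
    apply: le_trans i1; rewrite expr2; apply: ler_piMr; first exact: ltW.
    by rewrite invf_le1.
  have h21' : l ^- 21 <= l^-1 * (1 / 200 / 200 / 200).
    apply: le_trans (_ : l ^- 2 <= _).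
      rewrite lef_pV2 ?posrE ?exprn_gt0 //.
      exact: ler_weXn2l.
    by rewrite -exprVn expr2; apply: ler_wpM2l => //; exact: ltW.
  have ia : l^-1 <= a / 2.
    rewrite -[leLHS]mul1r ler_pdivrMr //; lra.
  lra.
have Fb S : 0 <= ((ncomp e Q S)%:R : R) <= #|S|%:R.
  rewrite ler0n ler_nat subset_leq_card //.
  by apply/subsetP => v; rewrite inE => /andP[].
have lip (v : T) (S : {set T}) : v \notin S -> max_deg e M (v |: S) ->
    `|(ncomp e Q (v |: S))%:R - (ncomp e Q S)%:R| <= l ^+ 18.
  by move=> vS mS; apply: le_trans Lb; exact: ncomp_max_deg_lipschitz.
have := truncated_lipschitz_tails p01 (max_deg0 e M) (@max_deg_down _ e M) l18 V0 mean_le t0 Fb lip small.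
have ex : expR (- ((a / 10 * N) ^+ 2 / (32 * (2 * N) * l ^+ 18 ^+ 2))) <= expR (- (l ^+ 2 / 2)).
  rewrite ler_expR lerN2.
  apply: le_trans (@exponent_ge (64 * 100) 36 _ _ _) _; [lra|lra|by []|].
  rewrite le_eqVlt; apply/orP; left; apply/eqP; rewrite (exprM l 18 2).
  by field; rewrite !lt0r_neq0.
move=> [h1 h2]; split.
  by apply: le_trans h1 _; move: PG ex; set X := expR (- (l ^+ 2 / 2)); lra.
by apply: le_trans h2 _; move: PG ex; set X := expR (- (l ^+ 2 / 2)); lra.
Qed.

End FixedDensity.

(** Sets of a N/10 vertices have at least a^2 n/2000 >= a^3 n neighbours, so xi = a^3. The
    sprinkling exponents are then of order a^13 N and a^8 N, both at least a^14 N, while the at most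
    2 a^16 N large components cost only exp(a^14 N/2) in the union bound. *)
Lemma not_merged_tail (k2 : nat) (S1 : {set T})
    (Z := [set v in S1 | (k2 <= #|component e S1 v|)%N]) (p3 := a / 10 / dR) :
  1 <= k2%:R * a ^+ 16 -> #|S1|%:R <= 2 * N -> excess e (100 / a) S1 <= a / 20 * #|T|%:R ->
  (x - 3 * a) * N <= #|Z|%:R ->
  Ex p3 (fun S3 => Pr p3 (fun S4 => ~~ merged e (a / 10 * N) k2 S1 (S1 :|: S3 :|: S4))) <=
  2 * expR (- (l ^+ 2 / 2)).
Proof.
move=> hk2 S12 exc Zx; have lL := l1; have /andP[_ as1] := a1; have /andP[eps0 eps1] := e0.
have [as2 _] := alpha_small e0 a0.
have d1 : 1 <= dR by rewrite ler1n.
have p301 : 0 <= p3 <= 1.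
  apply/andP; split; first by rewrite /p3 divr_ge0 ?divr_ge0 ?(ltW ap) ?(ltW dR0).
  by rewrite /p3 ler_pdivrMr // mul1r; lra.
have pd3 : p3 * dR = a / 10 by rewrite /p3 divfK // lt0r_neq0.
have eta0 : 0 < a / 10 by rewrite divr_gt0.
have xi0 : 0 < a ^+ 3 by rewrite exprn_gt0.
have a31 : a ^+ 3 <= 1 by apply: exprn_ile1; [exact: ltW|lra].
have ex : a / 10 * a ^+ 3 <= 1 / 2.
  have : a / 10 * a ^+ 3 <= a / 10 * 1 by apply: ler_wpM2l => //; exact: ltW.
  lra.
have dx : 8 * (lambda / dR) ^+ 2 <= (a ^+ 3) ^+ 2.
  rewrite -exprM; apply: le_trans (_ : 8 * a ^+ 60 <= _).
    by apply: ler_wpM2l => //; exact: lambda_sqr_le.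
  apply: le_trans (absorb_const 59 (ltW ap) _) _; first by lra.
  exact: small_pow.
have expand (A : {set T}) : A \subset S1 -> a / 10 * N <= #|A|%:R -> a ^+ 3 * #|T|%:R <= #|nbs e A|%:R.
  move=> AS Ath.
  have M0 : 0 <= 100 / a by rewrite divr_ge0 // ltW.
  have := card_nbs symE reg M0 AS; rewrite -/dR => hn.
  have := ler_wpM2l (ltW dR0) Ath.
  rewrite (_ : dR * (a / 10 * N) = a / 10 * #|T|%:R); last by rewrite nE; ring.
  move=> hA.
  have h2 : a / 20 * #|T|%:R <= 100 / a * #|nbs e A|%:R.
    move: hA hn exc; move: (#|T|%:R : R) (dR * _) (100 / a * _) (excess _ _ _) => y u v w; lra.
  have h3 := ler_wpM2l (_ : 0 <= a / 100) h2.
  have {h3} := h3 (divr_ge0 (ltW ap) (ler0n _ _)).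
  rewrite (_ : a / 100 * (100 / a * #|nbs e A|%:R) = #|nbs e A|%:R); last first.
    by field; rewrite lt0r_neq0.
  apply: le_trans.
  rewrite mulrA; apply: ler_wpM2r => //.
  rewrite (_ : a / 100 * (a / 20) = a ^+ 2 * (1 / 20 / 100)); last by field.
  by rewrite exprSr; apply: ler_wpM2l; [exact: sqr_ge0|lra].
have th0 : 0 < a / 10 * N by rewrite mulr_gt0.
have th3 : 3 * (a / 10 * N) <= #|Z|%:R.
  apply: le_trans Zx; rewrite mulrA; apply: ler_wpM2r; first exact: ltW.
  have x1' := x1; lra.
have := Pr_not_merged symE reg lam0 d0 mix p301 T0 pd3 eta0 xi0 ex dx expand th0 th3.
move/le_trans; apply; rewrite -/dR -/N.
have aN : l ^+ 2 <= a ^+ 14 * N.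
  have := @pow_mul_expR_ge _ a l a1 l0 al 1 14 2 isT isT; rewrite mul1r -NE; apply; lra.
have E1 : a ^+ 14 * N <= (a / 10 * (a ^+ 3) ^+ 2 / 16) ^+ 2 * N / (8 * (a / 10)).
  rewrite (_ : (a / 10 * (a ^+ 3) ^+ 2 / 16) ^+ 2 * N / (8 * (a / 10)) =
    a ^+ 13 / (10 * 16 * 16 * 8) * N); last by field; rewrite lt0r_neq0.
  apply: ler_wpM2r; first exact: ltW.
  rewrite ler_pdivlMr ?mulr_gt0 // mulrC; apply: absorb_const; [exact: ltW|lra].
have E2 : a ^+ 14 * N <= a / 10 * (a ^+ 3) ^+ 2 / 16 * (a / 10 * N).
  rewrite (_ : a / 10 * (a ^+ 3) ^+ 2 / 16 * (a / 10 * N) =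
    a ^+ 8 / (10 * 10 * 16) * N); last by field.
  apply: ler_wpM2r; first exact: ltW.
  rewrite ler_pdivlMr ?mulr_gt0 // mulrC.
  apply: le_trans (absorb_const 13 (ltW ap) _) _; first by lra.
  exact: small_pow.
have mle : #|large_components e k2 S1|%:R <= a ^+ 14 * N / 2.
  have : #|large_components e k2 S1|%:R * k2%:R <= 2 * N.
    by apply: le_trans S12; rewrite -natrM ler_nat card_large_components.
  have a16 : 0 <= a ^+ 16 by rewrite exprn_ge0 // ltW.
  move/(ler_wpM2r a16); move=> h; rewrite -mulrA in h.
  apply: le_trans (ler_peMr (ler0n _ _) hk2) _; apply: le_trans h _.
  rewrite (_ : 2 * N * a ^+ 16 = 4 * a ^+ 16 * N / 2); last by field.
  apply: ler_wpM2r => //; apply: ler_wpM2r; first exact: ltW.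
  apply: le_trans (absorb_const 15 (ltW ap) _) _; first by lra.
  exact: small_pow.
have e2 : 2 <= expR (1 : R) by have := expR_ge1Dx (1 : R); lra.
have pow2 : 2 ^+ #|large_components e k2 S1| <= expR (a ^+ 14 * N / 2).
  apply: le_trans (_ : expR 1 ^+ #|large_components e k2 S1| <= _).
    by apply: lerXn2r; rewrite // nnegrE // expR_ge0.
  by rewrite -expRM_natl mulr1 ler_expR.
apply: le_trans (_ : expR (a ^+ 14 * N / 2) * (2 * expR (- (a ^+ 14 * N))) <= _).
  apply: ler_pM; [by rewrite exprn_ge0|by rewrite addr_ge0 ?expR_ge0|exact: pow2|].
  have dbl (z : R) : 2 * z = z + z by rewrite mulr_natl mulr2n.
  rewrite dbl; apply: lerD; rewrite ler_expR lerN2; [exact: E1|exact: E2].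
exact: expR_union_bound.
Qed.

Lemma card_in_large_components (q : R) (k2 : nat) (S1 : {set T}) : 0 <= q <= 1 ->
  1 + eps - a / 5 <= q * dR -> q * dR <= 1 + eps -> k2%:R * a ^+ 16 <= 2 ->
  #|T|%:R * q - a / 10 * N < #|S1|%:R ->
  (ncomp e (fun C => (#|C| < k2)%N) S1)%:R <
    Ex q (fun S => (ncomp e (fun C => (#|C| < k2)%N) S)%:R) + a / 10 * N ->
  (x - 3 * a) * N <= #|[set v in S1 | (k2 <= #|component e S1 v|)%N]|%:R.
Proof.
move=> q01 qd1 qd2 k22; have := Ex_small_components q01 qd1 qd2 k22; rewrite -/dR -/N.
have -> : #|S1|%:R = #|[set v in S1 | (k2 <= #|component e S1 v|)%N]|%:R +
    (ncomp e (fun C => (#|C| < k2)%N) S1)%:R :> R.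
  rewrite -natrD -(cardsID [set v | (k2 <= #|component e S1 v|)%N] S1).
  congr (_ + _)%:R; apply: eq_card => v; rewrite !inE // -ltnNge andbC //.
have : 0 < a * N by rewrite mulr_gt0.
set Z := [set v in S1 | _]; move: (Ex _ _) ((ncomp _ _ _)%:R) (#|Z|%:R) (#|T|%:R * q).
by move=> y z c t; lra.
Qed.

(** The 10 consists of 5 for a bad first round [S1], 2 for a failed merging, 1 for the size of the
    final set and 2 for its tree count. *)
Lemma giant_probability (p := (1 + eps) / dR) :
  1 - 10 * expR (- (l ^+ 2 / 2)) <=
  Pr p (fun S => `[< exists L, unique_giant 15 x a N e S L /\
                       #|exceptional a e S L|%:R <= 15 * a * N >]).
Proof.
set E : pred {set T} := fun S => _; set del := expR _.
have lL := l1; have lg1 : 1 <= l by lra.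
have ap0 := ltW ap; have N0' := ltW N0; have aN0 : 0 < a * N by rewrite mulr_gt0.
have del0 : 0 <= del by exact: expR_ge0.
have a_le1 : a <= 1 by have /andP[_ ?] := a1; lra.
have c2 : 1 + eps <= 2 by have /andP[_ ?] := e0; lra.
have c0 : 0 < 1 + eps by have /andP[? _] := e0; lra.
have ac : 2 * (a / 10) <= 1 + eps by have /andP[? _] := e0; lra.
have a5 : 1 + eps - 2 * (a / 10) = 1 + eps - a / 5 by field.
have card2 (t s : R) : t <= (1 + eps) * N -> s < t + a / 10 * N -> s <= 2 * N.
  have : a * N <= 1 / 200 * N by apply: ler_wpM2r => //; have /andP[_ ?] := a1; lra.
  have : eps * N <= 1 / 200 * N by apply: ler_wpM2r => //; have /andP[_ ?] := e0; lra.
  move: N0; lra.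
have trees (y z : R) : (1 + eps - x - a / 2) * N <= y -> y - a / 10 * N < z ->
    (1 + eps - x - a) * N <= z by lra.
have total (u v w z : R) : u - w - z <= 7 * del -> w <= del -> z <= 2 * del -> u = 1 - v ->
    1 - 10 * del <= v by lra.
have union4 (u3 u2 u1 w1 w2 w3 w4 : R) : u3 <= w3 + w4 -> u2 <= w2 + u3 -> u1 <= w1 + u2 ->
    w1 <= del -> w2 <= del -> w3 <= 2 * del -> w4 <= del -> u1 <= 5 * del by lra.
have d2 : 2 * dR^-1 < 1.
  apply: le_lt_trans (ler_wpM2l (ler0n _ 2) inv_degree_le) _.
  apply: le_lt_trans (ler_wpM2l (ler0n _ 2) (small_pow a1 (_ : (1 <= 59)%N))) _ => //.
  by rewrite expr1; have /andP[_ ?] := a1; lra.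
have pd : p * dR = 1 + eps by rewrite /p divfK // lt0r_neq0.
have p0 : 0 < p by rewrite /p divr_gt0.
have p1 : p < 1.
  by apply: le_lt_trans d2; rewrite /p; apply: ler_wpM2r => //; rewrite invr_ge0 ltW.
have p01 : 0 < p <= 1 by rewrite p0 ltW.
have p01' : 0 <= p <= 1 by rewrite !ltW.
pose p3 := a / 10 / dR.
have pd3 : p3 * dR = a / 10 by rewrite /p3 divfK // lt0r_neq0.
have p30 : 0 <= p3 by rewrite /p3 !divr_ge0 // ltW.
have p32 : 2 * p3 <= p by rewrite -(ler_pM2r dR0) -mulrA pd3 pd.
have p301 : 0 <= p3 <= 1.
  by rewrite p30 (le_trans _ (ltW p1)) // (le_trans _ p32) // ler_peMl // ler1n.
have [q [q01 pq qp qE]] := sprinkle_prob p30 p32 p1.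
have qd1 : 1 + eps - a / 5 <= q * dR.
  by have := ler_wpM2r (ltW dR0) pq; rewrite mulrBl pd -mulrA pd3 a5.
have qd2 : q * dR <= 1 + eps by rewrite -pd ler_pM2r.
have comb (F : {set T} -> R) :
    Ex q (fun S1 => Ex p3 (fun S3 => Ex p3 (fun S4 => F (S1 :|: S3 :|: S4)))) = Ex p F.
  by rewrite (Ex_sprinkle q p3 (fun S => Ex p3 (fun S4 => F (S :|: S4)))) Ex_sprinkle qE.
pose k := Num.truncn (a^-1).
have /andP[kl ku] : k%:R <= a^-1 < k.+1%:R by apply: truncn_itv; rewrite invr_ge0.
pose st : pred {set T} := fun C => `[< small_tree a e C >].
have stk C : st C -> (#|C| <= k)%N.
  move=> /asboolP[_ h]; rewrite -ltnS -(ltr_nat R); exact: le_lt_trans h ku.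
have a16 : 0 < a ^+ 16 by rewrite exprn_gt0.
have ka : k%:R * a ^+ 16 <= 2.
  have ka1 : k%:R * a <= 1 by rewrite -ler_pdivlMr // div1r.
  rewrite exprS mulrA; apply: le_trans (_ : 1 * 1 <= _); last by rewrite mulr1 ler1n.
  by apply: ler_pM => //; rewrite ?mulr_ge0 ?exprn_ge0 ?exprn_ile1.
pose k2 := (Num.truncn (a ^- 16)).+1.
have /andP[k2l k2u] : (Num.truncn (a ^- 16))%:R <= a ^- 16 < k2%:R.
  by apply: truncn_itv; rewrite invr_ge0 ltW.
have k21 : 1 <= k2%:R * a ^+ 16 by rewrite -ler_pdivrMr // div1r ltW.
have k22 : k2%:R * a ^+ 16 <= 2.
  rewrite /k2 -natr1 mulrDl mul1r (_ : 2 = 1 + 1) //; apply: lerD.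
    by rewrite -ler_pdivlMr // div1r.
  by rewrite exprn_ile1.
pose lt2 : pred {set T} := fun C => (#|C| < k2)%N.
have lt2k C : lt2 C -> (#|C| <= k2)%N by exact: ltnW.
pose nst S : R := (ncomp e st S)%:R; pose nlt S : R := (ncomp e lt2 S)%:R.
pose b1 : pred {set T} := fun S => #|T|%:R * p + a / 10 * N <= #|S|%:R.
pose b2 : pred {set T} := fun S => nst S <= Ex p nst - a / 10 * N.
pose c1 : pred {set T} := fun S => #|T|%:R * q + a / 10 * N <= #|S|%:R.
pose c2' : pred {set T} := fun S => #|S|%:R <= #|T|%:R * q - a / 10 * N.
pose c3 : pred {set T} := fun S => Ex q nlt + a / 10 * N <= nlt S.
pose c4 : pred {set T} := fun S => a / 20 * #|T|%:R <= excess e (100 / a) S.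
pose B : pred {set T} := fun S => [|| c1 S, c2' S, c3 S | c4 S].
have pd2 : p * dR <= 2 by rewrite pd.
have qd3 : q * dR <= 2 by exact: le_trans qd2 c2.
have Pb1 : Pr p b1 <= del by exact: card_upper_tail.
have Pb2 : Pr p b2 <= 2 * del by have [_ h] := ncomp_tails p01' pd2 stk ka; exact: h.
have PB : Pr q B <= 5 * del.
  apply: union4 (PrU c3 c4 q01) (PrU c2' (fun S => c3 S || c4 S) q01)
    (PrU c1 (fun S => [|| c2' S, c3 S | c4 S]) q01) _ _ _ _.
  - exact: card_upper_tail.
  - exact: card_lower_tail.
  - by have [h _] := ncomp_tails q01 qd3 lt2k k22; exact: h.
  - exact: excess_tail.
have key S1 : ~~ B S1 ->
    (forall S3 S4, ~~ b1 (S1 :|: S3 :|: S4) -> ~~ b2 (S1 :|: S3 :|: S4) ->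
      merged e (a / 10 * N) k2 S1 (S1 :|: S3 :|: S4) -> E (S1 :|: S3 :|: S4)) /\
    Ex p3 (fun S3 => Pr p3 (fun S4 => ~~ merged e (a / 10 * N) k2 S1 (S1 :|: S3 :|: S4)))
      <= 2 * del.
  rewrite /B !negb_or -!ltNge => /and4P[nc1 nc2 nc3 nc4].
  have TqN : #|T|%:R * q <= (1 + eps) * N.
    by rewrite (_ : _ * q = q * dR * N); [exact: ler_wpM2r|rewrite nE; ring].
  have Zx := card_in_large_components q01 qd1 qd2 k22 nc2 nc3.
  split; last exact: not_merged_tail k21 (card2 _ _ TqN nc1) (ltW nc4) Zx.
  move=> S3 S4; set S := _ :|: S4; rewrite -!ltNge => nb1 nb2 /existsP[C /andP[CS ZC]].
  apply/asboolP; exists C.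
  apply: (unique_giant_of_counts symE e0 a0 x1 N0 _ _ CS ZC Zx).
  - have := @pow_mul_expR_ge _ a l a1 l0 al 1 2 0 isT isT lg1; rewrite -NE -/dR -/N mul1r expr0 => h.
    by rewrite -(ler_pM2l ap) mulfV ?lt0r_neq0 // mulrA -expr2.
  - by rewrite /S -setUA subsetUl.
  - move: nb1; rewrite (_ : #|T|%:R * p = (1 + eps) * N); last by rewrite nE -pd; ring.
    by rewrite -mulrDl; exact: ltW.
  - exact: trees (Ex_small_trees pd p01) nb2.
(* The events [b1] and [b2] concern the final set and are not independent of the first round.
   Subtracting their indicators inside the expectation avoids conditioning on them. *)
have main : Ex p (fun S => (~~ E S)%:R - (b1 S)%:R - (b2 S)%:R) <= 7 * del.
  rewrite -comb; apply: le_trans (_ : Ex q (fun S1 => (B S1)%:R + 2 * del) <= _); last first.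
    rewrite ExD Ex_cst (_ : 7 * del = 5 * del + 2 * del); last by ring.
    by rewrite lerD2r.
  apply: Ex_le => // S1; case: (boolP (B S1)) => [_|/key[k1 k2']].
    apply: Ex_le_cst => // S3; apply: Ex_le_cst => // S4.
    apply: le_trans (@indicator_sub_le _ _ _ _ false _) _ => //.
    by rewrite lerDl mulr_ge0.
  rewrite [false%:R]mulr0n add0r; apply: le_trans k2'.
  apply: Ex_le => // S3; apply: Ex_le => // S4; apply: indicator_sub_le; exact: k1.
rewrite !ExB in main.
exact: total main Pb1 Pb2 (PrC p E).
Qed.

End Estimates.

(** * From the stated hypotheses and failure probability to the estimates *)

Section SpectralGap.
Variables (R : realType) (a : R).
Hypothesis a0 : 0 < a < 1 / 200 / 200 / 200 / 200.

Lemma ln_small : ln a <= -1.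
Proof.
have /andP[a1 a2] := a0.
rewrite -[leRHS]expRK ler_ln ?posrE ?expR_gt0 //.
have e4 : expR (1 : R) <= 4 by have := @expR_le_quad R 1 (lexx _); rewrite expr1n; lra.
rewrite expRN; apply: le_trans (_ : 4^-1 <= _); first by lra.
by rewrite lef_pV2 ?posrE ?expR_gt0.
Qed.

Lemma inv_small : 60 <= a^-1.
Proof. by have /andP[a1 a2] := a0; rewrite -[leRHS]mul1r ler_pdivlMr //; lra. Qed.

(** One of the two factors a^(1/a) is at most exp(-1/a) and cancels the growth (1 + eps)^k <=
    exp(1/a); the other is at most a^60, hence at most a^30. *)
Lemma powR_mul_growth_le (eps y : R) (k : nat) : 0 < eps < 1 / 200 -> 0 <= y ->
  y <= a `^ (2 / a) -> k%:R <= a^-1 -> (1 + eps) ^+ k * y <= a ^+ 30.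
Proof.
move=> /andP[eps0 eps1] y0 ya ka; have /andP[a1 _] := a0.
have la := ln_small; have ia := inv_small.
have pE : a `^ (2 / a) = expR (2 / a * ln a) by rewrite /powR gt_eqF.
have aE : a ^+ 30 = expR (30 * ln a) by rewrite expRM_natl lnK.
have ck : (1 + eps) ^+ k <= expR (a^-1).
  apply: le_trans (_ : expR eps ^+ k <= _).
    by apply: lerXn2r; rewrite ?nnegrE ?expR_ge0 ?expR_ge1Dx // addr_ge0 // ltW.
  rewrite -expRM_natl ler_expR; apply: le_trans ka; apply: ler_piMr => //; lra.
apply: le_trans (ler_pM _ y0 ck ya) _; first by rewrite exprn_ge0 // addr_ge0 // ltW.
rewrite pE aE -expRD ler_expR.
have h1 : a^-1 * ln a <= a^-1 * -1 by apply: ler_wpM2l => //; lra.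
have h2 : a^-1 * ln a <= 60 * ln a by apply: ler_wnM2r => //; lra.
move: h1 h2; rewrite (_ : 2 / a * ln a = 2 * (a^-1 * ln a)); last by rewrite mulrA.
set u := a^-1 * ln a; lra.
Qed.

End SpectralGap.

(** With l = ln N the target is exp(-(l ln l)/4), much weaker than exp(-l^2/2): half of the exponent
    swallows the 10, and ln l <= l handles the rest. *)
Lemma failure_le (R : realType) (l : R) : 200 <= l ->
  10 * expR (- (l ^+ 2 / 2)) <= expR l `^ (- (1 / 4 * ln l)).
Proof.
move=> l1; have l0 : 0 < l by lra.
have lnl : ln l <= l.
  rewrite -[leRHS]expRK ler_ln ?posrE ?expR_gt0 //.
  by have := expR_ge1Dx l; lra.
rewrite /powR gt_eqF ?expR_gt0 // expRK.
have e10 : 10 <= expR (l ^+ 2 / 4).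
  have := expR_ge1Dx (l ^+ 2 / 4).
  have : l * 200 <= l * l by apply: ler_wpM2l; lra.
  rewrite expr2; lra.
apply: le_trans (ler_wpM2r (expR_ge0 _) e10) _; rewrite -expRD ler_expR.
have : ln l * l <= l * l by apply: ler_wpM2r; lra.
rewrite expr2; lra.
Qed.

Local Open Scope classical_set_scope.

Theorem theorem3 (R : realType) :
  exists K eps0 : R, [/\ 0 < K, 0 < eps0 &
  forall eps : R, 0 < eps < eps0 ->
  exists x beta : R, [/\ giant_density eps x, 0 < beta &
  forall d : nat -> nat,
    (forall n : nat, (3 <= d n)%N) ->
    ((d n)%:R / n%:R : R) @[n --> \oo] --> (0 : R) ->
  \forall n \near \oo,
  forall (alpha lambda : R) (T : finType) (e : rel T),
    let N : R := n%:R / (d n)%:R in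
    let p : R := (1 + eps) / (d n)%:R in
    2 / ln N < alpha < eps ^+ 4 ->
    ndl_graph n (d n) lambda e ->
    lambda / (d n)%:R <= alpha `^ (2 / alpha) ->
    1 - N `^ (- (beta * ln (ln N))) <=
      site_prob p (fun S : {set T} =>
        exists L : {set T},
          unique_giant K x alpha N e S L /\
          #|exceptional alpha e S L|%:R <= 15 * alpha * N) ]].
Proof.
exists 15, (1 / 200); split => [||eps e0]; [lra|lra|].
have [x [gx x1 x2]] := giant_density_exists e0.
exists x, (1 / 4); split; [exact: gx|lra|].
move=> d d3 dn0.
(* This gives N > 4 and thus ln N > 0. How large ln N is comes from the window 2/ln N < alpha <
   eps^4. *)
have near_small : \forall n \near \oo, (d n)%:R / n%:R < 1 / 4 :> R.
  have q0 : 0 < 1 / 4 :> R by lra.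
  by apply: filterS (cvgr_lt (0 : R) dn0 _ q0) => n.
have near_pos : \forall n \near \oo, (0 < n)%N by exists 1%N.
apply: filterS2 near_small near_pos => n dn n0 a lambda T e.
have D3 := d3 n; move: (d n) D3 dn => D D3 dn.
set N := n%:R / D%:R; set p := (1 + eps) / D%:R => /andP[al ae] G lamd.
have D0 : 0 < D%:R :> R by rewrite ltr0n; exact: leq_trans D3.
have n0R : 0 < n%:R :> R by rewrite ltr0n.
have N4 : 4 < N.
  rewrite /N ltr_pdivlMr //; move: dn; rewrite ltr_pdivrMr //; lra.
have Np : 0 < N by lra.
have l0 : 0 < ln N by apply: ln_gt0; lra.
have a0 : 0 < a by apply: lt_trans al; rewrite divr_gt0.
have a0e : 0 < a < eps ^+ 4 by rewrite a0.
have [_ asm] := alpha_small e0 a0e.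
have a1 : 0 < a < 1 / 200 / 200 / 200 / 200 by rewrite a0.
have n1 : (1 < n)%N.
  rewrite -(ltr_nat R); move: N4; rewrite /N ltr_pdivlMr //.
  have : 3 <= D%:R :> R by rewrite ler_nat.
  lra.
have mix := ndl_form_bound G n1.
have [Tn [symE irrE] reg [s [_ _ lamE]]] := G.
have lam0 : 0 <= lambda by rewrite lamE le_max normr_ge0.
have y0 : 0 <= lambda / D%:R by rewrite divr_ge0 // ltW.
have dlk k : k%:R <= a^-1 -> (1 + eps) ^+ k * (lambda / D%:R) <= a ^+ 30.
  exact: powR_mul_growth_le.
have dl : lambda / D%:R <= a ^+ 30.
  by have := dlk 0%N; rewrite expr0 mul1r; apply; rewrite invr_ge0 ltW.
have NE : #|T|%:R / D%:R = expR (ln N) by rewrite Tn lnK.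
rewrite -Tn in mix.
have D0' : (0 < D)%N by exact: leq_trans D3.
have := giant_probability symE irrE reg lam0 D0' mix e0 a0e gx x1 x2 l0 al NE dl dlk.
rewrite site_probE Tn; apply: le_trans.
have l200 : 200 <= ln N by have := l_large a1 l0 al; lra.
by have := failure_le l200; rewrite lnK // lerD2l lerN2.
Qed.
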